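(* Let $\mathcal G$ be a compact group acting continuously and linearly on $\mathbb R^n$, let $\chi:\mathcal G\to\mathbb R$ be a (continuous) one-dimensional real character, and let $\psi:\mathbb R^n\times\mathbb R^m\to\mathbb R^n$, $(x,\lambda)\mapsto\psi_\lambda(x)$, be a smooth local family of diffeomorphisms, defined near the origin, such that for all $\lambda$ near $0$: $g\circ\psi_\lambda\circ g^{-1}=\psi_\lambda^{\chi(g)}$ for all $g\in\mathcal G$, $\psi_\lambda(0)=0$, and $A_0:=D_x\psi_0(0)$ is invertible. Let $q\ge 1$ be an integer, let $A_0=S_0+N_0$ be the Jordan--Chevalley decomposition of $A_0$, and define $U:=\ker(S_0^q-\mathrm I)\subseteq\mathbb R^n$. Then there exist a family of diffeomorphisms $\psi_{r,\lambda}:U\to U$ and a map $x^*:U\times\mathbb R^m\to\mathbb R^n$ such that for each sufficiently small $\lambda\in\mathbb R^m$ the following hold: (i) $\psi_{r,\lambda}(0)=0$, $D_u\psi_{r,0}(0)=A_0|_U$, $x^*(0,\lambda)=0$, and $D_ux^*(0,0)\cdot\tilde u=\tilde u$ for all $\tilde u\in U$; (ii) $\psi_{r,\lambda}(S_0u)=S_0\psi_{r,\lambda}(u)$; (iii) $g\circ\psi_{r,\lambda}\circ g^{-1}=\psi_{r,\lambda}^{\chi(g)}$ for all $g\in\mathcal G$; (iv) for sufficiently small $(x,\lambda)\in\mathbb R^n\times\mathbb R^m$, the point $x$ is $q$-periodic under $\psi_\lambda$ if and only if $x=x^*(u,\lambda)$, where $u\in U$ is $q$-periodic under $\psi_{r,\lambda}$;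 (v) for sufficiently small $(u,\lambda)\in U\times\mathbb R^m$, the point $u$ is $q$-periodic under $\psi_{r,\lambda}$ if and only if $\psi_{r,\lambda}(u)=S_0u$. Moreover, let $\mathcal B:U\times\mathbb R^m\to U$ be defined by $\mathcal B(u,\lambda):=S_0^{-1}\psi_{r,\lambda}(u)-S_0\psi_{r,\lambda}^{-1}(u)$. Then (vi) a point $(u,\lambda)\in U\times\mathbb R^m$ is a solution of $\psi_{r,\lambda}(u)=S_0u$ if and only if it is a solution of $\mathcal B(u,\lambda)=0$; (vii) $\mathcal B(S_0u,\lambda)=S_0\mathcal B(u,\lambda)$ and $\mathcal B(gu,\lambda)=\chi(g)\,g\,\mathcal B(u,\lambda)$ for all $g\in\mathcal G$.
   Context: The one-dimensional character satisfies $\chi(gh)=\chi(g)\chi(h)$ and, $\mathcal G$ being compact, $\chi(g)\in\{1,-1\}$; thus $\psi^{\chi(g)}$ is $\psi$ or its (compositional) inverse. The element $g\in\mathcal G$ is identified with the linear operator by which it acts. The Jordan--Chevalley decomposition $A_0=S_0+N_0$ is the unique one with $S_0$ semisimple (diagonalizable over $\mathbb C$), $N_0$ nilpotent and $S_0N_0=N_0S_0$. A point $x$ is $q$-periodic under a map $\psi$ if $\psi^q(x)=x$ (minimal period is not required to be $q$). All maps are local: they are defined and smooth near the origin (of $\mathbb R^n\times\mathbb R^m$, respectively $U\times\mathbb R^m$), ''diffeomorphism'' means local diffeomorphism near $0$, and all identities and equivalences are understood for sufficiently small points and parameters. *)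

(* Defs.v *)
From HB Require Import structures.
From mathcomp Require Import all_boot all_order all_algebra.
From mathcomp Require Import complex.
From mathcomp Require Import all_classical all_reals all_analysis.

Set Implicit Arguments.
Unset Strict Implicit.
Unset Printing Implicit Defensive.

Import Order.TTheory GRing.Theory Num.Theory.
Import numFieldNormedType.Exports.

Local Open Scope classical_set_scope.
Local Open Scope ring_scope.

HB.mixin Record Group_isTopological G of Group G & Topological G := {
  mulg_continuous : continuous (fun p : G * G => (p.1 * p.2)%g);
  invg_continuous : continuous (fun g : G => g^-1%g)
}.

#[short(type="topologicalGroupType")]
HB.structure Definition TopologicalGroup :=
  {G of Group_isTopological G & Group G & Topological G}.

(* The operator by which [g] acts on column vectors is the matrix [rho g]. *)
Record continuous_linear_action (R : realType) (n : nat)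
    (G : topologicalGroupType) (rho : G -> 'M[R]_n) : Prop := {
  action1 : rho 1%g = 1%:M;
  actionM : forall g h, rho (g * h)%g = rho g *m rho h;
  action_continuous : continuous (fun p : G * 'cV[R]_n => rho p.1 *m p.2)
}.

(* Multiplicativity and [chi 1 = 1] force the values of [chi] to be nonzero. *)
Record continuous_character (R : realType) (G : topologicalGroupType)
    (chi : G -> R) : Prop := {
  character1 : chi 1%g = 1;
  characterM : forall g h, chi (g * h)%g = chi g * chi h;
  character_continuous : continuous chi
}.

(* Here V is a linear subspace of E and A a relatively open subset of V, so
   only the values of f on A matter: every difference quotient is taken at a
   point of A in a direction of V.  In finite dimension, being k times
   continuously differentiable is the existence and continuity of all iterated
   directional derivatives up to order k. *)
Fixpoint Ck_on (R : realType) (E F : normedModType R) (V A : set E) (k : nat)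
    (f : E -> F) : Prop :=
  match k with
  | 0%N => {within A, continuous f}
  | k'.+1 => {within A, continuous f} /\
      forall v, V v ->
        (forall x, A x -> derivable f x v) /\ Ck_on V A k' (fun x => 'D_v f x)
  end.

(* C^oo on a neighbourhood of the origin of the linear subspace V. *)
Definition smooth_near0 (R : realType) (E F : normedModType R) (V : set E)
    (f : E -> F) : Prop :=
  exists2 W : set E, open_nbhs 0 W & forall k, Ck_on V (W `&` V) k f.

(* Local maps U x R^m -> F are represented by total functions on R^n x R^m of
   which only the values at points of U x R^m close to the origin are
   relevant.  [fV] is the family of the (compositional) inverses of the local
   diffeomorphisms f_lambda : U -> U. *)
Record local_diffeo_family (R : realType) (n m : nat) (U : set 'cV[R]_n)
    (f fV : 'cV[R]_n * 'cV[R]_m -> 'cV[R]_n) : Prop := {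
  diffeo_smooth : smooth_near0 (U `*` setT) f;
  diffeoV_smooth : smooth_near0 (U `*` setT) fV;
  diffeo_stable :
    \forall p \near ((0, 0) : 'cV[R]_n * 'cV[R]_m), U p.1 -> U (f p);
  diffeoV_stable :
    \forall p \near ((0, 0) : 'cV[R]_n * 'cV[R]_m), U p.1 -> U (fV p);
  diffeoK :
    \forall p \near ((0, 0) : 'cV[R]_n * 'cV[R]_m), U p.1 -> fV (f p, p.2) = p.1;
  diffeoVK :
    \forall p \near ((0, 0) : 'cV[R]_n * 'cV[R]_m), U p.1 -> f (fV p, p.2) = p.1
}.

(* f ^ e for e = 1 or e = -1, the only values of a continuous real character
   of a compact group; [fV] is the inverse of [f]. *)
Definition diffeo_pow (R : realType) (X Y : Type) (f fV : X -> Y) (e : R) :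
    X -> Y :=
  if e == 1 then f else fV.

Definition q_periodic (X L : Type) (q : nat) (f : X * L -> X) (p : X * L) :
    Prop :=
  iter q (fun y => f (y, p.2)) p.1 = p.1.

Definition semisimple_mx (R : realType) (n : nat) (S : 'M[R]_n) : Prop :=
  diagonalizable (map_mx (real_complex R) S).

Definition nilpotent_mx (R : realType) (n : nat) (N : 'M[R]_n) : Prop :=
  exists k : nat, N ^+ k = 0.

Record jordan_chevalley (R : realType) (n : nat) (A S N : 'M[R]_n) : Prop := {
  jc_sum : A = S + N;
  jc_semisimple : semisimple_mx S;
  jc_nilpotent : nilpotent_mx N;
  jc_comm : S *m N = N *m S
}.

Definition ker_space (R : realType) (n : nat) (M : 'M[R]_n) : set 'cV[R]_n :=
  [set u | M *m u = 0].

Definition bifurcation_map (R : realType) (n m : nat) (S : 'M[R]_n)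
    (f fV : 'cV[R]_n * 'cV[R]_m -> 'cV[R]_n) (p : 'cV[R]_n * 'cV[R]_m) :
    'cV[R]_n :=
  invmx S *m f p - S *m fV p.

(* Main.v *)
Require Import Defs.
From HB Require Import structures.
From mathcomp Require Import all_boot all_order all_algebra.
From mathcomp Require Import complex.
From mathcomp Require Import all_classical all_reals all_analysis.
From mathcomp Require Import ring lra zify.
From mathcomp Require Import separable.

Set Implicit Arguments.
Unset Strict Implicit.
Unset Printing Implicit Defensive.

Import Order.TTheory GRing.Theory Num.Theory.
Import numFieldNormedType.Exports.

Local Open Scope classical_set_scope.
Local Open Scope ring_scope.

(* Lyapunov-Schmidt reduction on the space of q-tuples of points.  A q-periodic
   orbit of f = psi_lambda is a cyclic sequence s_0, ..., s_(q-1) with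
   f (s_i) = s_(i+1).  Linearised with S_0 + N_0 in place of f, this operator has
   kernel and cokernel governed by the sequences (S_0^i u)_i with u in
   U = ker (S_0^q - 1), since nilpotency of N_0 makes everything else rigid.  So
   the implicit function theorem solves f (s_i) - s_(i+1) = S_0^i d for a sequence
   s of prescribed mean u in U, with a single unknown d in U.  Then x^* is s_0 and
   psi_r (u) = S_0 u + d, and the orbit closes up exactly when psi_r (u) = S_0 u.

   Everything else is uniqueness of the solution.  Shifting s gives
   S_0-equivariance; applying g with chi g = 1 to s gives equivariance; and when
   chi g = -1, the sequence g f (s_(-i)) gives reversibility.  Applied to psi_r
   itself, uniqueness shows that its q-periodic points satisfy
   psi_r (u) = S_0 u. *)

(** * Calculus in coordinates *)

(** The projection [E] onto U is a polynomial in S_0, so it commutes with all that commutes with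
    S_0. An element g with chi g = -1 only satisfies g S_0 g^-1 = S_0^-1, yet it commutes with [E]
    too, because S_0^-1 yields the same projection. That g A_0 g^-1 = A_0^(chi g) passes to S_0 is
    the uniqueness of the Jordan-Chevalley decomposition, applied to A_0 and to its inverse. Two
    obstacles shape the constructions. Smoothness and invertibility of psi_r are wanted relative to
    the subspace U; psi_r is therefore extended to R^n by the linear part S_0 + N_0 on the
    complement, everything is proved on open sets of the full space, and then restricted. Moreover
    every identity holds only near the origin but must hold for all g at once; compactness of the
    group bounds all operators [rho g] by one constant, which makes the neighbourhoods independent
    of g. For (vi), B = 0 says that u has period 2 under S_0^-1 psi_r, whose derivative at the
    origin is unipotent on U; the uniqueness argument that gives (v) then applies with q = 2 and the
    identity in place of S_0. *)

Section MatrixNorm.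
Variable R : realType.

Lemma mx_coord_le m n (M : 'M[R]_(m, n)) i j : `|M i j| <= `|M|.
Proof.
by rewrite [leRHS]/Num.Def.normr/= mx_normrE; exact: (le_bigmax _ _ (i, j)).
Qed.

Lemma mx_norm_le m n (M : 'M[R]_(m, n)) (e : R) :
  0 <= e -> (forall i j, `|M i j| <= e) -> `|M| <= e.
Proof.
move=> e0 H; rewrite /Num.Def.normr/= mx_normrE.
by apply: bigmax_le => // -[i j] _; exact: H.
Qed.

Lemma pair_norm_le (E F : normedModType R) (x : E) (y : F) (e : R) :
  (`|(x, y)| <= e) = (`|x| <= e) && (`|y| <= e).
Proof. by rewrite prod_normE ge_max. Qed.

Lemma pair_norm_lt (E F : normedModType R) (x : E) (y : F) (e : R) :
  (`|(x, y)| < e) = (`|x| < e) && (`|y| < e).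
Proof. by rewrite prod_normE gt_max. Qed.

Lemma pair_norm_ltI (E F : normedModType R) (x : E) (y : F) (e : R) :
  `|x| < e -> `|y| < e -> `|(x, y)| < e.
Proof. by move=> xe ye; rewrite pair_norm_lt xe. Qed.

Lemma pair_norm_leI (E F : normedModType R) (x : E) (y : F) (e : R) :
  `|x| <= e -> `|y| <= e -> `|(x, y)| <= e.
Proof. by move=> xe ye; rewrite pair_norm_le xe. Qed.

Lemma fst_norm_le (E F : normedModType R) (p : E * F) : `|p.1| <= `|p|.
Proof. by rewrite prod_normE le_max lexx. Qed.

Lemma snd_norm_le (E F : normedModType R) (p : E * F) : `|p.2| <= `|p|.
Proof. by rewrite prod_normE le_max lexx orbT. Qed.

Lemma nbhs_dist (E : normedModType R) (x : E) (P : E -> Prop) :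
  (\forall y \near x, P y) <->
  exists2 d : R, 0 < d & forall y, `|y - x| < d -> P y.
Proof.
split=> [/nbhs_normP[d d0 H]|[d d0 H]].
  by exists d => // y xy; apply: H; rewrite /ball_/= distrC.
by apply/nbhs_normP; exists d => // y; rewrite /ball_/= distrC; exact: H.
Qed.

Lemma nbhs0_dist (E : normedModType R) (P : E -> Prop) :
  (\forall y \near (0 : E), P y) <->
  exists2 d : R, 0 < d & forall y, `|y| < d -> P y.
Proof.
rewrite nbhs_dist; split=> -[d d0 H]; exists d => // y.
  by move=> yd; apply: H; rewrite subr0.
by rewrite subr0; exact: H.
Qed.

Lemma open_norm_lt (E : normedModType R) (r : R) : open [set x : E | `|x| < r].
Proof.
rewrite openE => x /= xr; apply/nbhs_dist.
exists (r - `|x|); first by rewrite subr_gt0.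
move=> y yx; rewrite -[y](subrK x); apply: le_lt_trans (ler_normD _ _) _.
by rewrite -ltrBrDr.
Qed.

End MatrixNorm.

(* A finite coordinate system bounded by the norm; it plays the role of finite
   dimension, uniformly for matrices and for their products. *)
Record coords (R : realType) (E : normedModType R) := Coords {
  cI : finType;
  ce : cI -> E;
  cc : cI -> E -> R;
  ccB : forall i x y, cc i (x - y) = cc i x - cc i y;
  ccZ : forall i a x, cc i (a *: x) = a * cc i x;
  cc_sum : forall x, x = \sum_i cc i x *: ce i;
  cc_le : forall i x, `|cc i x| <= `|x|;
  ce_le : forall i, `|ce i| <= 1
}.

(** Kept transparent, like [coords_prod], so that [cI], [ce] and [cc] compute when a coordinate of a
    product is split into its components. *)
Lemma coords_mx (R : realType) (m n : nat) : coords 'M[R]_(m, n).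
Proof.
exists ('I_m * 'I_n)%type (fun k : 'I_m * 'I_n => delta_mx k.1 k.2)
  (fun (k : 'I_m * 'I_n) (M : 'M[R]_(m, n)) => M k.1 k.2).
- by move=> k x y; rewrite !mxE.
- by move=> k a x; rewrite !mxE.
- by move=> x; rewrite {1}(matrix_sum_delta x) pair_big.
- by move=> k x; exact: mx_coord_le.
- move=> k; apply: mx_norm_le => // i j; rewrite mxE.
  by case: (_ && _); rewrite ?normr1 ?normr0.
Defined.

Lemma coords_prod (R : realType) (E F : normedModType R) :
  coords E -> coords F -> coords (E * F)%type.
Proof.
move=> K L.
exists (cI K + cI L)%type
  (fun k => match k with inl i => (ce i, 0) | inr j => (0, ce j) end)
  (fun k p => match k with inl i => cc i p.1 | inr j => cc j p.2 end).
- by case=> k x y; rewrite ccB.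
- by case=> k a x; rewrite ccZ.
- move=> [x y]; rewrite big_sumType /=.
  rewrite (eq_bigr (fun i => (cc i x *: ce i, 0))); last first.
    by move=> i _; congr pair; rewrite scaler0.
  rewrite [X in _ = _ + X](eq_bigr (fun i => (0, cc i y *: ce i))); last first.
    by move=> i _; congr pair; rewrite scaler0.
  apply: injective_projections.
    by rewrite /= !raddf_sum /= big1_eq addr0 -cc_sum.
  by rewrite /= !raddf_sum /= big1_eq add0r -cc_sum.
- by case=> k x; apply: le_trans (cc_le _ _) _; [exact: fst_norm_le|exact: snd_norm_le].
- by case=> k; rewrite pair_norm_le normr0 ler01 ce_le.
Defined.

Section Derivatives.
Variables (R : realType) (E : normedModType R).
Implicit Types (W : set E) (f g : E -> R).

Lemma is_derive_line f x v (l : R) :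
  (forall h, f (h *: v + x) - f x = h * l) -> is_derive x v f l.
Proof.
move=> H.
have L : h^-1 *: ((f \o shift x) (h *: v) - f x) @[h --> 0^'] --> l.
  apply: cvg_near_cst; near=> h; rewrite /= H /GRing.scale /= mulKf //.
  by near: h; exact: nbhs_dnbhs_neq.
by split; [apply/cvg_ex; exists l|exact: cvg_lim].
Unshelve. all: by end_near. Qed.

(** The scalar mean value theorem for s |-> f (s v + x); bounding [|s|] by [|t|] treats both signs
    of [t] uniformly. *)
Lemma MVT_dir f x v (t : R) :
  (forall s, `|s| <= `|t| -> derivable f (s *: v + x) v) ->
  exists2 s, `|s| <= `|t| & f (t *: v + x) - f x = t * 'D_v f (s *: v + x).
Proof.
move=> df; pose g s := f (s *: v + x).
have gE s : (fun h : R => h^-1 *: ((g \o shift s) (h *: (1 : R)) - g s)) =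
    (fun h => h^-1 *: ((f \o shift (s *: v + x)) (h *: v) - f (s *: v + x))).
  apply/funext => h; rewrite /g /=; congr (_ *: (f _ - _)).
  by rewrite [_%:A]mulr1 scalerDl addrA.
have gd s : `|s| <= `|t| -> is_derive s (1 : R) g ('D_v f (s *: v + x)).
  move=> st; split; first by rewrite /derivable gE; exact: df.
  by rewrite /derive gE.
have gc s : `|s| <= `|t| -> {for s, continuous g}.
  move=> st; apply: differentiable_continuous; apply/derivable1_diffP.
  exact: (@ex_derive _ _ _ _ _ _ _ (gd _ st)).
have [t0|t0] := leP 0 t.
  have [||s] := @MVT_segment R g (fun s => 'D_v f (s *: v + x)) 0 t t0.
  - move=> s; rewrite in_itv/= => /andP[s0 st]; apply: gd.
    by rewrite gtr0_norm // ger0_norm // ltW.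
  - apply: continuous_in_subspaceT => s; rewrite inE /= in_itv/= => /andP[s0 st].
    by apply: gc; rewrite !ger0_norm.
  rewrite in_itv/= => /andP[s0 st]; rewrite /g scale0r add0r subr0 => ->.
  by exists s; rewrite ?ger0_norm // mulrC.
have [||s] := @MVT_segment R g (fun s => 'D_v f (s *: v + x)) t 0 (ltW t0).
- move=> s; rewrite in_itv/= => /andP[s0 st]; apply: gd.
  by rewrite (ltr0_norm t0) ltr0_norm // lerN2 ltW.
- apply: continuous_in_subspaceT => s; rewrite inE /= in_itv/= => /andP[s0 st].
  by apply: gc; rewrite !ler0_norm ?lerN2 // ltW.
rewrite in_itv/= => /andP[s0 st]; rewrite /g scale0r add0r sub0r => H.
exists s; first by rewrite !ler0_norm ?lerN2 // ltW.
by rewrite -opprB H mulrN opprK mulrC.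
Qed.

(** Both points move: this is the form of C^1 that gives a contraction estimate in the implicit
    function theorem. *)
Definition strictly_diff f a (L : E -> R) := forall e : R, 0 < e ->
  exists2 d : R, 0 < d & forall x y, `|x - a| < d -> `|y - a| < d ->
    `|f x - f y - L (x - y)| <= e * `|x - y|.

(** Walking from [y] to [x] one coordinate at a time, the mean value theorem turns each leg into a
    partial derivative at a point near [a], hence within [e'] of its value at [a]. *)
Lemma C1_strictly_diff (K : coords E) f a :
  (\forall x \near a, forall i : cI K, derivable f x (ce i)) ->
  (forall i : cI K, {for a, continuous ('D_(ce i) f)}) ->
  strictly_diff f a (fun v => \sum_(i : cI K) cc i v * 'D_(ce i) f a).
Proof.
move=> df cf e e0; pose N : R := #|cI K|%:R.
have N0 : 0 <= N by exact: ler0n.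
pose e' := e / (N + 1).
have e'0 : 0 < e' by rewrite divr_gt0 // ltr_wpDl.
have : \forall x \near a, forall i : cI K,
    derivable f x (ce i) /\ `|'D_(ce i) f x - 'D_(ce i) f a| <= e'.
  apply: filter_forall => i.
  have := cf i; rewrite /prop_for /continuous_at => /cvgrPdist_le /(_ e' e'0).
  by apply: filterS2 df => x dx; rewrite distrC.
case/nbhs_dist => d d0 H.
(* Intermediate points are within |y - a| + N |x - y| of [a], which is less than 2 N + 1 times this
   radius. *)
exists (d / (2 * N + 1)); first by rewrite divr_gt0 // ltr_wpDl // mulr_ge0.
move=> x y xd yd; set v := x - y.
have key (s : seq (cI K)) : forall z : E, `|z - a| + (size s)%:R * `|v| < d ->
    `|f (\sum_(i <- s) cc i v *: ce i + z) - f z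
        - \sum_(i <- s) cc i v * 'D_(ce i) f a| <= (size s)%:R * (e' * `|v|).
  elim: s => [|i s IH] z zd.
    by rewrite !big_nil add0r !subrr normr0 mul0r.
  rewrite !big_cons /=.
  have vi : `|cc i v *: ce i| <= `|v|.
    rewrite normrZ -[leRHS]mulr1; apply: ler_pM => //; first exact: cc_le.
    exact: ce_le.
  move: zd; rewrite /= -natr1 mulrDl mul1r => zd.
  have zd' : `|z - a| + `|v| < d.
    by apply: le_lt_trans zd; rewrite lerD2l lerDr mulr_ge0 // ler0n.
  have [s' s'v Hs'] : exists2 t, `|t| <= `|cc i v| &
      f (cc i v *: ce i + z) - f z = cc i v * 'D_(ce i) f (t *: ce i + z).
    apply: MVT_dir => t tv; apply: (H _ _ i).1.
    rewrite -addrA; apply: le_lt_trans (ler_normD _ _) _.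
    have : `|t *: ce i| <= `|v|.
      rewrite normrZ -[leRHS]mulr1; apply: ler_pM => //; last exact: ce_le.
      by apply: le_trans tv _; exact: cc_le.
    by move: zd'; lra.
  have := IH (cc i v *: ce i + z).
  have -> : \sum_(j <- s) cc j v *: ce j + (cc i v *: ce i + z) =
    cc i v *: ce i + \sum_(j <- s) cc j v *: ce j + z by rewrite addrA [X in X + z]addrC.
  have lt1 : `|cc i v *: ce i + z - a| + (size s)%:R * `|v| < d.
    apply: le_lt_trans zd; rewrite addrA addrAC lerD2r [leRHS]addrC -addrA.
    by apply: le_trans (ler_normD _ _) _; rewrite lerD2r.
  move=> /(_ lt1) IH1.
  set S1 := \sum_(j <- s) cc j v * _ in IH1 *; set F := f _ in IH1 *.
  have -> : F - f z - (cc i v * 'D_(ce i) f a + S1) =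
    (F - f (cc i v *: ce i + z) - S1) +
    (f (cc i v *: ce i + z) - f z - cc i v * 'D_(ce i) f a) by ring.
  rewrite [leRHS]mulrDl mul1r.
  apply: le_trans (ler_normD _ _) _; apply: lerD => //.
  rewrite Hs' -mulrBr normrM mulrC; apply: ler_pM => //; last exact: cc_le.
  apply: (H _ _ i).2; rewrite -addrA; apply: le_lt_trans (ler_normD _ _) _.
  have : `|s' *: ce i| <= `|v|.
    rewrite normrZ -[leRHS]mulr1; apply: ler_pM => //; last exact: ce_le.
    by apply: le_trans s'v _; exact: cc_le.
  by move: zd'; lra.
have := key (index_enum (cI K)) y.
rewrite -cc_sum /v subrK -/v.
have -> : (size (index_enum (cI K)))%:R = N by rewrite -[index_enum _]enumT -cardE.
have vd : `|v| < 2 * (d / (2 * N + 1)).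
  have -> : v = (x - a) - (y - a) by rewrite /v opprB addrA subrK.
  by apply: le_lt_trans (ler_normB _ _) _; lra.
have lt2 : `|y - a| + N * `|v| < d.
  have : N * `|v| <= N * (2 * (d / (2 * N + 1))) by rewrite ler_wpM2l // ltW.
  have : d = d / (2 * N + 1) + N * (2 * (d / (2 * N + 1))).
    by field; rewrite gt_eqF // ltr_wpDl // mulr_ge0.
  lra.
move=> /(_ lt2) /le_trans; apply; rewrite mulrA; apply: ler_wpM2r => //.
by rewrite /e' mulrA ler_pdivrMr ?ltr_wpDl // mulrC ler_wpM2l ?ltW // ltrDl.
Qed.

End Derivatives.

Section Chain.
Variables (R : realType) (E F : normedModType R) (K : coords F).

Lemma coords_norm_le (u : F) : `|u| <= \sum_(i : cI K) `|cc i u|.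
Proof.
rewrite {1}(cc_sum K u); apply: le_trans (ler_norm_sum _ _ _) _.
apply: ler_sum => i _; rewrite normrZ -[leRHS]mulr1.
by apply: ler_pM => //; exact: ce_le.
Qed.

Lemma cvg_bigsum (T : Type) (FF : set_system T) {_ : Filter FF} (I : Type)
    (r : seq I) (u : I -> T -> R) (a : I -> R) :
  (forall i, u i t @[t --> FF] --> a i) ->
  \sum_(i <- r) u i t @[t --> FF] --> \sum_(i <- r) a i.
Proof.
move=> ua; elim: r => [|i r IH].
  by rewrite big_nil; under eq_fun do rewrite big_nil; exact: cvg_cst.
rewrite big_cons; under eq_fun do rewrite big_cons.
exact: cvgD.
Qed.

(** The inner map needs a derivative in the single direction [v] only: its difference quotients are
    then bounded near 0, its increment is O(h), and strict differentiability of [f] makes the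
    remainder o(h). *)
Lemma is_derive_chain (f : F -> R) (g : E -> F) x v (w l : cI K -> R) :
  strictly_diff f (g x) (fun u => \sum_i cc i u * l i) ->
  (forall i, is_derive x v (fun y => cc i (g y)) (w i)) ->
  is_derive x v (f \o g) (\sum_i w i * l i).
Proof.
move=> df dg.
pose D h : F := g (h *: v + x) - g x.
pose c (i : cI K) (h : R) : R := h^-1 * cc i (D h).
have cw i : c i h @[h --> 0^'] --> w i.
  have -> : c i = (fun h => h^-1 *: (((fun y => cc i (g y)) \o shift x) (h *: v) - cc i (g x))).
    by apply/funext => h; rewrite /c /D /= ccB.
  by have [dgi <-] := dg i; apply: (cvgP _ dgi).
pose s (h : R) := \sum_i c i h * l i.
have sS : s h @[h --> 0^'] --> \sum_i w i * l i.
  by apply: cvg_bigsum => i; apply: cvgM (cw i) _; exact: cvg_cst.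
pose q (h : R) : R := h^-1 *: (((f \o g) \o shift x) (h *: v) - (f \o g) x).
suff qs : q h @[h --> 0^'] --> \sum_i w i * l i.
  by split; [apply/cvg_ex; eexists; exact: qs|exact: cvg_lim qs].
have qs0 : (q h - s h) @[h --> 0^'] --> (0 : R).
  apply/cvgrPdist_le => e e0.
  pose B := \sum_i (`|w i| + 1) + 1.
  have B0 : 0 < B by rewrite ltr_wpDl // sumr_ge0 // => i _; rewrite addr_ge0.
  have [d d0 H] := df (e / B) (divr_gt0 e0 B0).
  near=> h.
  have h0 : h != 0 by near: h; exact: nbhs_dnbhs_neq.
  have cB i : `|c i h| <= `|w i| + 1.
    move: i; near: h; apply: filter_forall => i.
    have /cvgrPdist_le /(_ 1 ltr01) := cw i; apply: filterS => h.
    rewrite distrC => H1; rewrite -[c i h](subrK (w i)) addrC.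
    by apply: le_trans (ler_normD _ _) _; rewrite lerD2l.
  have hd : `|h| * B < d.
    rewrite -ltr_pdivlMr //; near: h; apply: dnbhs0_lt; exact: divr_gt0.
  have DE i : cc i (D h) = h * c i h by rewrite /c mulrA divff // mul1r.
  have DB : `|D h| <= `|h| * B.
    apply: le_trans (coords_norm_le _) _.
    rewrite (eq_bigr (fun i => `|h| * `|c i h|)); last first.
      by move=> i _; rewrite DE normrM.
    rewrite -mulr_sumr ler_wpM2l // /B ler_wpDr //; exact: ler_sum.
  have := H (g (h *: v + x)) (g x); rewrite subrr normr0 -/(D h).
  move=> /(_ (le_lt_trans DB hd) d0) H1.
  rewrite sub0r normrN.
  have -> : q h - s h = h^-1 * (f (g (h *: v + x)) - f (g x) - \sum_i cc i (D h) * l i).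
    rewrite mulrBr /q /s; congr (_ - _); rewrite mulr_sumr; apply: eq_bigr => i _.
    by rewrite mulrA.
  rewrite normrM normfV mulrC ler_pdivrMr ?normr_gt0 //.
  apply: le_trans H1 _; apply: le_trans (ler_wpM2l _ DB) _.
    by rewrite divr_ge0 ?ltW.
  by rewrite mulrCA mulrC divfK // gt_eqF.
exact: cvg_sub0 qs0 sS.
Unshelve. all: by end_near. Qed.

End Chain.

Section Ck.
Variables (R : realType) (E : normedModType R).
Implicit Types (W : set E) (f g : E -> R).

(** Scalar version of [Ck_on] in all directions of the space, with continuity at points in place of
    the subspace topology; the two agree on open sets, entry by entry ([Ck_on_mx]). *)
Fixpoint Ck W (k : nat) f : Prop :=
  match k with
  | 0%N => forall x, W x -> {for x, continuous f}
  | k'.+1 => (forall x, W x -> {for x, continuous f}) /\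
      forall v, (forall x, W x -> derivable f x v) /\ Ck W k' ('D_v f)
  end.

Lemma Ck_continuous W k f : Ck W k f -> forall x, W x -> {for x, continuous f}.
Proof. by case: k => [|k []]. Qed.

Lemma CkW W k f : Ck W k.+1 f -> Ck W k f.
Proof.
elim: k f => [|k IH] f [fc fd] //; split => // v.
by split; [exact: (fd v).1|apply: IH; exact: (fd v).2].
Qed.

Lemma Ck_sub W W' k f : W' `<=` W -> Ck W k f -> Ck W' k f.
Proof.
move=> sub; elim: k f => [|k IH] f /=.
  by move=> fc x /sub; exact: fc.
move=> [fc fd]; split; first by move=> x /sub; exact: fc.
by move=> v; split; [move=> x /sub; exact: (fd v).1|apply: IH; exact: (fd v).2].
Qed.

Lemma near_open W x (P : E -> Prop) :
  open W -> W x -> (forall y, W y -> P y) -> \forall y \near x, P y.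
Proof.
move=> oW Wx H; have := open_nbhs_nbhs (conj oW Wx).
by apply: filterS => y; exact: H.
Qed.

Lemma continuous_ext W f g : open W -> (forall x, W x -> f x = g x) ->
  (forall x, W x -> {for x, continuous f}) ->
  forall x, W x -> {for x, continuous g}.
Proof.
move=> oW fg fc x Wx; rewrite /prop_for /continuous_at -fg //.
apply: cvg_trans (fc x Wx); apply: near_eq_cvg.
by apply: near_open Wx _ => // y /fg ->.
Qed.

Lemma Ck_ext W k f g : open W -> (forall x, W x -> f x = g x) ->
  Ck W k f -> Ck W k g.
Proof.
move=> oW; elim: k f g => [|k IH] f g fg /=; first exact: continuous_ext.
move=> [fc fd]; split; first exact: continuous_ext fc.
move=> v; split.
  move=> x Wx; apply: near_eq_derivable ((fd v).1 _ Wx).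
  exact: near_open Wx fg.
apply: IH (fd v).2 => x Wx; apply: near_eq_derive.
exact: near_open Wx fg.
Qed.

Lemma Ck_cst W k (a : R) : Ck W k (fun=> a).
Proof.
elim: k a => [|k IH] a /=; first by move=> x _; exact: cst_continuous.
split; first by move=> x _; exact: cst_continuous.
move=> v; split; first by move=> x _; exact: derivable_cst.
have -> : 'D_v (fun=> a) = (fun=> 0) :> (E -> R).
  by apply/funext => x; exact: derive_cst.
exact: IH.
Qed.

Lemma Ck_add W k f g : open W ->
  Ck W k f -> Ck W k g -> Ck W k (fun x => f x + g x).
Proof.
move=> oW; elim: k f g => [|k IH] f g /=.
  by move=> fc gc x Wx; apply: cvgD; [exact: fc|exact: gc].
move=> [fc fd] [gc gd]; split.
  by move=> x Wx; apply: cvgD; [exact: fc|exact: gc].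
move=> v; split.
  by move=> x Wx; apply: derivableD; [exact: (fd v).1|exact: (gd v).1].
apply: Ck_ext (IH _ _ (fd v).2 (gd v).2) => // x Wx.
by rewrite -deriveD //; [exact: (fd v).1|exact: (gd v).1].
Qed.

Lemma Ck_mul W k f g : open W ->
  Ck W k f -> Ck W k g -> Ck W k (fun x => f x * g x).
Proof.
move=> oW; elim: k f g => [|k IH] f g /=.
  by move=> fc gc x Wx; apply: cvgM; [exact: fc|exact: gc].
move=> fk gk; have [fc fd] := fk; have [gc gd] := gk; split.
  by move=> x Wx; apply: cvgM; [exact: fc|exact: gc].
move=> v; split.
  by move=> x Wx; apply: derivableM; [exact: (fd v).1|exact: (gd v).1].
apply: Ck_ext (Ck_add oW (IH _ _ (CkW fk) (gd v).2) (IH _ _ (CkW gk) (fd v).2)) => //.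
by move=> x Wx; rewrite -deriveM //; [exact: (fd v).1|exact: (gd v).1].
Qed.

Lemma Ck_opp W k f : open W -> Ck W k f -> Ck W k (fun x => - f x).
Proof.
move=> oW fk; apply: Ck_ext (Ck_mul oW (Ck_cst W k (-1)) fk) => // x _.
by rewrite mulN1r.
Qed.

Lemma Ck_sum W k (I : Type) (r : seq I) (P : pred I) (F : I -> E -> R) : open W ->
  (forall i, P i -> Ck W k (F i)) -> Ck W k (fun x => \sum_(i <- r | P i) F i x).
Proof.
move=> oW H; elim: r => [|i r IH].
  by under eq_fun do rewrite big_nil; exact: Ck_cst.
under eq_fun do rewrite big_cons.
by case: (boolP (P i)) => // Pi; apply: Ck_add => //; exact: H.
Qed.

Lemma Ck_prod W k (I : Type) (r : seq I) (P : pred I) (F : I -> E -> R) : open W ->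
  (forall i, P i -> Ck W k (F i)) -> Ck W k (fun x => \prod_(i <- r | P i) F i x).
Proof.
move=> oW H; elim: r => [|i r IH].
  by under eq_fun do rewrite big_nil; exact: Ck_cst.
under eq_fun do rewrite big_cons.
by case: (boolP (P i)) => // Pi; apply: Ck_mul => //; exact: H.
Qed.

Lemma Ck_inv W k f : open W -> (forall x, W x -> f x != 0) ->
  Ck W k f -> Ck W k (fun x => (f x)^-1).
Proof.
move=> oW f0; elim: k => [|k IH] /=.
  by move=> fc x Wx; apply: cvgV (fc x Wx); exact: f0.
move=> fk; have [fc fd] := fk; split.
  by move=> x Wx; apply: cvgV (fc x Wx); exact: f0.
move=> v; split.
  by move=> x Wx; apply: derivableV; [exact: f0|exact: (fd v).1].
have fi := IH (CkW fk).
apply: Ck_ext (Ck_opp oW (Ck_mul oW (Ck_mul oW fi fi) (fd v).2)) => // x Wx.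
rewrite deriveV; [|exact: f0|exact: (fd v).1].
by rewrite expr2 invfM /GRing.scale /= mulNr.
Qed.

Lemma Ck_linear W k f : (forall x y, f (x - y) = f x - f y) ->
  (forall a x, f (a *: x) = a * f x) -> (forall x, `|f x| <= `|x|) -> Ck W k f.
Proof.
move=> fB fZ fle.
have fc x : {for x, continuous f}.
  apply/cvgrPdist_le => e e0; apply/nbhs_dist; exists e => // y yx.
  by rewrite -fB; apply: le_trans (fle _) _; rewrite distrC ltW.
case: k => [|k] /=; first by move=> x _; exact: fc.
split; first by move=> x _; exact: fc.
move=> v.
have dv x : is_derive x v f (f v).
  by apply: is_derive_line => h; rewrite -fB addrK fZ.
split; first by move=> x _; exact: (@ex_derive _ _ _ _ _ _ _ (dv x)).
have -> : 'D_v f = (fun=> f v).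
  by apply/funext => x; exact: (@derive_val _ _ _ _ _ _ _ (dv x)).
exact: Ck_cst.
Qed.

Lemma Ck_coord (K : coords E) W k (i : cI K) : Ck W k (cc i).
Proof.
by apply: Ck_linear; [exact: ccB|exact: ccZ|exact: (cc_le (c := K))].
Qed.

End Ck.

Section CkComp.
Variables (R : realType) (E F : normedModType R) (K : coords F).

Lemma coords_continuous (g : E -> F) x :
  (forall i : cI K, {for x, continuous (fun y => cc i (g y))}) ->
  {for x, continuous g}.
Proof.
move=> gc; apply/cvgrPdist_le => e e0.
have : \forall y \near x, forall i : cI K,
    `|cc i (g x) - cc i (g y)| <= e / (#|cI K|%:R + 1).
  apply: filter_forall => i; have := gc i.
  rewrite /prop_for /continuous_at => /cvgrPdist_le; apply.
  by rewrite divr_gt0 // ltr_wpDl.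
apply: filterS => y H; apply: le_trans (coords_norm_le K _) _.
apply: (@le_trans _ _ (\sum_(i : cI K) e / (#|cI K|%:R + 1))).
  by apply: ler_sum => i _; rewrite ccB.
have -> : \sum_(i : cI K) e / (#|cI K|%:R + 1) = #|cI K|%:R * (e / (#|cI K|%:R + 1)).
  by rewrite sumr_const mulr_natl.
by rewrite mulrA ler_pdivrMr ?ltr_wpDl // mulrC ler_wpM2l ?ltW // ltrDl.
Qed.

Lemma Ck_strictly_diff (W : set F) (f : F -> R) a : open W -> W a ->
  Ck W 1 f -> strictly_diff f a (fun u => \sum_(i : cI K) cc i u * 'D_(ce i) f a).
Proof.
move=> oW Wa [fc fd]; apply: C1_strictly_diff.
  by apply: near_open Wa _ => // x Wx i; exact: (fd _).1.
by move=> i; apply: (fd _).2.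
Qed.

(** By the chain rule the derivative is a sum of products of D_v g_i with partial derivatives of [f]
    composed with [g]; these compositions are one order lower, so induction applies. *)
Lemma Ck_comp (V : set E) (W : set F) k (f : F -> R) (g : E -> F) :
  open V -> open W -> (forall x, V x -> W (g x)) -> Ck W k f ->
  (forall i : cI K, Ck V k (fun x => cc i (g x))) -> Ck V k (fun x => f (g x)).
Proof.
move=> oV oW VW; elim: k f => [|k IH] f fk gk.
  move=> x Vx; apply: continuous_comp; last exact: fk (VW _ Vx).
  by apply: coords_continuous => i; exact: gk.
have dfg x v : V x -> is_derive x v (f \o g)
    (\sum_(i : cI K) 'D_v (fun y => cc i (g y)) x * 'D_(ce i) f (g x)).
  move=> Vx; apply: is_derive_chain.
    apply: (@Ck_strictly_diff W) => //; first exact: VW.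
    by elim: k fk {IH gk} => // k IH /CkW.
  by move=> i; apply: derivableP; have [_ gd] := gk i; exact: (gd v).1.
split.
  move=> x Vx; apply: continuous_comp.
    by apply: coords_continuous => i; exact: Ck_continuous (gk i) _ Vx.
  exact: Ck_continuous fk _ (VW _ Vx).
move=> v; split.
  by move=> x Vx; exact: (@ex_derive _ _ _ _ _ _ _ (dfg x v Vx)).
apply: (@Ck_ext _ _ V _
    (fun x => \sum_(i : cI K) 'D_v (fun y => cc i (g y)) x * 'D_(ce i) f (g x))) => //.
  by move=> x Vx; rewrite -(@derive_val _ _ _ _ _ _ _ (dfg x v Vx)).
apply: Ck_sum => // i _; apply: Ck_mul => //; first by have [_ gd] := gk i; exact: (gd v).2.
apply: (IH ('D_(ce i) f)); first by have [_ fd] := fk; exact: (fd _).2.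
by move=> j; exact: CkW.
Qed.

End CkComp.

(** * Implicit functions *)

(** Makes matrices a complete normed module, as the contraction principle requires. *)
HB.instance Definition _ (R : realType) (m n : nat) := Complete.on 'M[R]_(m, n).

Section CkMatrix.
Variables (R : realType) (E : normedModType R).

Lemma Ck_det (W : set E) k n (M : E -> 'M[R]_n) : open W ->
  (forall i j, Ck W k (fun x => M x i j)) -> Ck W k (fun x => \det (M x)).
Proof.
move=> oW H; apply: Ck_sum => // s _; apply: Ck_mul => //; first exact: Ck_cst.
by apply: Ck_prod => // i _; exact: H.
Qed.

(** Cramer's rule: an entry of the inverse is a cofactor divided by the determinant. *)
Lemma Ck_invmx (W : set E) k n (M : E -> 'M[R]_n) i j : open W ->
  (forall x, W x -> M x \in unitmx) ->
  (forall i j, Ck W k (fun x => M x i j)) -> Ck W k (fun x => invmx (M x) i j).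
Proof.
move=> oW uM H.
apply: (@Ck_ext _ _ W _ (fun x => (\det (M x))^-1 * (\adj (M x)) i j)) => //.
  by move=> x Wx; rewrite /invmx uM // [RHS]mxE.
apply: Ck_mul => //.
  apply: Ck_inv => //; last exact: Ck_det.
  by move=> x /uM; rewrite unitmxE unitfE.
under eq_fun do rewrite mxE /cofactor.
apply: Ck_mul => //; first exact: Ck_cst.
apply: Ck_det => // a b.
by under eq_fun do rewrite !mxE; exact: H.
Qed.

Lemma mulmx_norm_le m n (A : 'M[R]_(m, n)) :
  exists2 C : R, 0 < C & forall v : 'rV[R]_m, `|v *m A| <= C * `|v|.
Proof.
exists (\sum_i \sum_j `|A i j| + 1).
  by rewrite ltr_wpDl // sumr_ge0 // => i _; exact: sumr_ge0.
move=> v; apply: mx_norm_le.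
  by rewrite mulr_ge0 // addr_ge0 // sumr_ge0 // => i _; exact: sumr_ge0.
move=> i j; rewrite mxE mulrDl mul1r ler_wpDr // mulr_suml.
apply: le_trans (ler_norm_sum _ _ _) _; apply: ler_sum => k _.
rewrite normrM mulrC; apply: ler_pM => //; last exact: mx_coord_le.
by rewrite (bigD1 j) //= lerDl sumr_ge0.
Qed.

End CkMatrix.

Section ImplicitFunction.
Variables (R : realType) (N : nat) (P : normedModType R) (KP : coords P).
Variables (G : 'rV[R]_N * P -> 'rV[R]_N) (W : set ('rV[R]_N * P)).
Hypotheses (oW : open W) (W0 : W 0) (G0 : G 0 = 0).
Hypothesis GC : forall j k, Ck W k (fun z => G z 0 j).
(** Injectivity is what the applications can check directly; since there are as many equations as
    unknowns, it gives invertibility ([J0unit]). *)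
Hypothesis Ginj : forall w : 'rV[R]_N,
  (forall j, 'D_(w, 0) (fun z => G z 0 j) 0 = 0) -> w = 0.

Let K := coords_prod (coords_mx R 1 N) KP.
(** The transposed Jacobian in the unknown, acting on row vectors from the right; [LP] is the part
    of the total derivative [L] that comes from the parameter. *)
Let J (z : 'rV[R]_N * P) : 'M[R]_N :=
  \matrix_(i, j) 'D_(delta_mx 0 i, 0) (fun z => G z 0 j) z.
Let L z (v : 'rV[R]_N * P) : 'rV[R]_N :=
  \row_j \sum_(i : cI K) cc i v * 'D_(ce i) (fun z => G z 0 j) z.
Let LP z (h : P) : 'rV[R]_N :=
  \row_j \sum_(i : cI KP) cc i h * 'D_(0, ce i) (fun z => G z 0 j) z.

Let LE z y h : L z (y, h) = y *m J z + LP z h.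
Proof.
apply/rowP => j; rewrite !mxE big_sumType /=; congr (_ + _).
rewrite -(pair_bigA _ (fun a b => y a b * 'D_(delta_mx a b, 0) (fun z => G z 0 j) z)).
by rewrite big_ord1; apply: eq_bigr => i _; rewrite !mxE.
Qed.

Let GL z : W z -> forall e : R, 0 < e -> exists2 d : R, 0 < d &
  forall x y, `|x - z| < d -> `|y - z| < d ->
    `|G x - G y - L z (x - y)| <= e * `|x - y|.
Proof.
move=> Wz e e0.
have : \forall d \near 0^'+, forall j x y, `|x - z| < d -> `|y - z| < d ->
    `|G x 0 j - G y 0 j - L z (x - y) 0 j| <= e * `|x - y|.
  apply: filter_forall => j.
  have [d d0 H] := Ck_strictly_diff K oW Wz (GC j 1) e0.
  near=> d' => x y xd yd; rewrite [L _ _ _ _]mxE; apply: H.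
    by apply: lt_trans xd _; near: d'; exact: nbhs_right_lt.
  by apply: lt_trans yd _; near: d'; exact: nbhs_right_lt.
move=> H; have [d [d0 Hd]] : exists d : R, 0 < d /\ forall j x y, `|x - z| < d -> `|y - z| < d ->
    `|G x 0 j - G y 0 j - L z (x - y) 0 j| <= e * `|x - y|.
  near (0 : R)^'+ => d; exists d; split; first by near: d; exact: nbhs_right_gt.
  by near: d.
exists d => // x y xd yd; apply: mx_norm_le; first by rewrite mulr_ge0 // ltW.
by move=> i j; rewrite ord1 !mxE; have := Hd j x y xd yd; rewrite mxE.
Unshelve. all: by end_near. Qed.

Let GD z v j : W z -> is_derive z v (fun z => G z 0 j) (L z v 0 j).
Proof.
move=> Wz; rewrite mxE; apply: (@is_derive_chain _ _ _ K (fun z => G z 0 j) id).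
  exact: (Ck_strictly_diff K oW Wz (GC j 1)).
by move=> i; apply: is_derive_line => h; rewrite -ccB addrK ccZ.
Qed.

Let J0unit : J 0 \in unitmx.
Proof.
rewrite -row_free_unit; apply/inj_row_free => w wJ; apply: Ginj => j.
have H := GD (w, 0) j W0; rewrite (@derive_val _ _ _ _ _ _ _ H).
rewrite LE wJ add0r mxE big1 // => i _.
have -> : cc i (0 : P) = 0 by rewrite -(scale0r 0) ccZ mul0r.
by rewrite mul0r.
Qed.

Let JC i j k : Ck W k (fun z => J z i j).
Proof. by under eq_fun do rewrite mxE; have [_ H] := GC j k.+1; exact: (H _).2. Qed.

Let LPC h j k : Ck W k (fun z => LP z h 0 j).
Proof.
under eq_fun do rewrite mxE; apply: Ck_sum => // i _; apply: Ck_mul => //.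
  exact: Ck_cst.
by have [_ H] := GC j k.+1; exact: (H _).2.
Qed.

Let LP_bound z : exists2 C : R, 0 <= C & forall h, `|LP z h| <= C * `|h|.
Proof.
exists (\sum_j \sum_(i : cI KP) `|'D_(0, ce i) (fun z => G z 0 j) z|).
  by apply: sumr_ge0 => i _; exact: sumr_ge0.
move=> h; apply: mx_norm_le.
  by rewrite mulr_ge0 // sumr_ge0 // => i _; exact: sumr_ge0.
move=> i j; rewrite mxE {i}; apply: le_trans (ler_norm_sum _ _ _) _.
rewrite mulr_suml (bigD1 j) //= ler_wpDr //.
  by rewrite sumr_ge0 // => i _; rewrite mulr_ge0 // sumr_ge0.
rewrite mulr_suml; apply: ler_sum => i _; rewrite normrM mulrC.
by apply: ler_pM => //; exact: cc_le.
Qed.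

(* The Newton map at frozen slope, [y - G (y, p) J^-1], contracts in y and is
   Lipschitz in p. *)
Let newton_lipschitz : exists d C : R, [/\ 0 < d, 0 < C,
  forall z, `|z| < d -> W z /\ J z \in unitmx &
  forall y y' p p', `|(y, p)| < d -> `|(y', p')| < d ->
   `|(y - G (y, p) *m invmx (J 0)) - (y' - G (y', p') *m invmx (J 0))| <=
   C * `|p - p'| + 2^-1 * `|y - y'| ].
Proof.
have [C C0 HC] := mulmx_norm_le (invmx (J 0)).
have [C1 C10 HC1] := LP_bound 0.
(* [C] bounds multiplication by the inverse of [J 0], so this accuracy becomes a contraction factor
   1/2. *)
have e0 : 0 < 2^-1 / C by rewrite divr_gt0 ?invr_gt0.
have [d d0 Hd] := GL W0 e0.
have detJ0 : \det (J 0) != 0 by rewrite -unitfE -unitmxE.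
have : \forall z \near (0 : 'rV[R]_N * P), W z /\ J z \in unitmx.
  near=> z; split; first by near: z; exact: open_nbhs_nbhs (conj oW W0).
  rewrite unitmxE unitfE; near: z.
  have cd : {for 0, continuous (fun z => \det (J z))}.
    by apply: (@Ck_continuous _ _ W 0) => //; apply: Ck_det => // i j; exact: JC.
  have /(@cvgr_neq0 _ _ _ _ _ _ _ cd) : \det (J 0) != 0 by [].
  by [].
case/nbhs0_dist => d' d'0 Hd'.
exists (Num.min d d'), (C * C1 + 2^-1); split.
- by rewrite lt_min d0.
- by rewrite ltr_wpDl ?invr_gt0 // mulr_ge0 // ltW.
- by move=> z; rewrite lt_min => /andP[_ zd]; exact: Hd'.
move=> y y' p p'; rewrite !lt_min => /andP[zd _] /andP[zd' _].
have := Hd (y, p) (y', p'); rewrite !subr0 => /(_ zd zd').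
set z := (y, p); set z' := (y', p').
have -> : z - z' = (y - y', p - p') by [].
rewrite LE; set rho := G z - G z' - _ => Hr.
have -> : y - G z *m invmx (J 0) - (y' - G z' *m invmx (J 0)) =
    - (LP 0 (p - p') + rho) *m invmx (J 0).
  have -> : LP 0 (p - p') + rho = G z - G z' - (y - y') *m J 0.
    have aux (V : zmodType) (a b c : V) : b + (a - (c + b)) = a - c.
      by rewrite (addrC c) opprD addrCA addNKr.
    exact: aux.
  have aux (V : zmodType) (a b c e : V) : a - b - (c - e) = - (b - e - (a - c)).
    by rewrite [RHS]opprB !opprD !opprK addrACA.
  by rewrite mulNmx !mulmxBl !mulmxK //; exact: aux.
rewrite mulNmx normrN.
apply: le_trans (HC _) _.
have : `|LP 0 (p - p') + rho| <= C1 * `|p - p'| + 2^-1 / C * `|(y - y', p - p')|.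
  by apply: le_trans (ler_normD _ _) _; apply: lerD => //; exact: HC1.
move=> /(ler_wpM2l (ltW C0)) /le_trans; apply.
rewrite mulrDr mulrA [C * (_ / _ * _)]mulrA [C * (_ / _)]mulrC divfK ?gt_eqF //.
have : `|(y - y', p - p')| <= `|y - y'| + `|p - p'|.
  by apply: pair_norm_leI; rewrite ?lerDl ?lerDr normr_ge0.
by lra.
Unshelve. all: by end_near. Qed.

(** The contraction principle gives existence, and the contraction estimate gives uniqueness in the
    same closed ball. The last clause is the linearised equation satisfied by the derivative of
    [ys]; it lets a caller identify this derivative without mentioning a Jacobian. *)
Lemma implicit_function : exists (ys : P -> 'rV[R]_N) (r s : R),
  [/\ 0 < r, 0 < s, ys 0 = 0,
     (forall j k, Ck [set p | `|p| < s] k (fun p => ys p 0 j)) &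
     [/\ (forall p, `|p| < s -> `|ys p| < r /\ G (ys p, p) = 0),
      (forall p y, `|p| < s -> `|y| <= r -> G (y, p) = 0 -> y = ys p) &
      forall h j, 'D_(\row_i 'D_h (fun p => ys p 0 i) 0, h) (fun z => G z 0 j) 0 = 0]].
Proof.
have [d [C [d0 C0 Hd HT]]] := newton_lipschitz.
pose T p y := y - G (y, p) *m invmx (J 0).
(* With C |p| < r / 2 the map [T p] sends the closed ball of radius [r] into the open one: the other
   half of the bound is the contraction factor times [r]. *)
pose r := d / 2; pose s := Num.min r (r / (2 * C)).
have r0 : 0 < r by rewrite divr_gt0.
have rd : r < d by rewrite /r; lra.
have s0 : 0 < s by rewrite lt_min r0 divr_gt0 // mulr_gt0.
have sr : s <= r by rewrite ge_min lexx.
have Cs (p : P) : `|p| < s -> C * `|p| < r / 2.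
  rewrite lt_min => /andP[_]; rewrite ltr_pdivlMr ?mulr_gt0 //; lra.
have T00 : T 0 0 = 0 by rewrite /T G0 mul0mx subr0.
have small (y : 'rV[R]_N) (p : P) : `|p| < s -> `|y| <= r -> `|(y, p)| < d.
  move=> ps yr; apply: pair_norm_ltI; first exact: le_lt_trans yr rd.
  exact: lt_trans (lt_le_trans ps sr) rd.
have TC (p p' : P) (y y' : 'rV[R]_N) : `|p| < s -> `|p'| < s -> `|y| <= r -> `|y'| <= r ->
    `|T p y - T p' y'| <= C * `|p - p'| + 2^-1 * `|y - y'|.
  by move=> ps ps' yr yr'; apply: HT; exact: small.
have Tr (p : P) (y : 'rV[R]_N) : `|p| < s -> `|y| <= r -> `|T p y| < r.
  move=> ps yr; have := TC p 0 y 0 ps; rewrite !normr0 T00 !subr0.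
  by move=> /(_ s0 yr (ltW r0)); have := Cs p ps; lra.
have Tfix p y : G (y, p) = 0 <-> y = T p y.
  rewrite /T; split=> [->|H]; first by rewrite mul0mx subr0.
  have : G (y, p) *m invmx (J 0) *m J 0 = 0.
    have -> : G (y, p) *m invmx (J 0) = 0; last by rewrite mul0mx.
    by apply/eqP; rewrite -oppr_eq0 -(inj_eq (addrI y)) addr0 -H.
  by rewrite mulmxKV.
have uniq (p : P) (y y' : 'rV[R]_N) : `|p| < s -> `|y| <= r -> `|y'| <= r -> G (y, p) = 0 ->
    G (y', p) = 0 -> y = y'.
  move=> ps yr yr' /Tfix Hy /Tfix Hy'; have := TC p p y y' ps ps yr yr'.
  rewrite -Hy -Hy' subrr normr0 mulr0 add0r => H.
  apply/subr0_eq/eqP; rewrite -normr_le0; lra.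
have ex (p : P) : `|p| < s -> exists y, `|y| <= r /\ G (y, p) = 0.
  move=> ps; pose B : set ('rV[R]_N : completeNormedModType R) := closed_ball_ Num.norm 0 r.
  have BE y : B y = (`|y| <= r) :> Prop by rewrite /B /closed_ball_/= sub0r normrN.
  have homT : {homo T p : y / B y >-> B y}.
    by move=> y; rewrite !BE => yr; exact: ltW (Tr _ _ ps yr).
  pose f : {fun B >-> B} := HB.pack_for {fun B >-> B} (T p) (isFun.Build _ _ B B (T p) homT).
  have [||| y By yf] := @banach_fixed_point R ('rV[R]_N : completeNormedModType R) B f.
  - exists (2^-1)%:nng; split; first by rewrite /= invf_lt1 // ltr1n.
    move=> [y y'] [/= By By'].
    have := TC p p y y' ps ps; rewrite subrr normr0 mulr0 add0r; apply.
      by rewrite -BE.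
    by rewrite -BE.
  - exact: closed_closed_ball_.
  - by exists 0; rewrite BE normr0 ltW.
  by exists y; split; [rewrite -BE|apply/Tfix].
pose ys p := xget 0 [set y | `|y| <= r /\ G (y, p) = 0].
have ysP (p : P) : `|p| < s -> `|ys p| <= r /\ G (ys p, p) = 0.
  by move=> /ex; exact: (@xgetPex _ 0 [set y | `|y| <= r /\ G (y, p) = 0]).
have ysr (p : P) : `|p| < s -> `|ys p| < r.
  move=> ps; have [yr /Tfix ->] := ysP _ ps; exact: Tr.
have ys0 : ys 0 = 0.
  have [yr y0] := ysP 0 (ltac:(by rewrite normr0)).
  by apply: (uniq 0) => //; rewrite normr0 ?ltW.
(* Both values are fixed points, so |ys p - ys p'| appears on the right with factor 1/2; absorbing
   it doubles [C]. *)
have lip (p p' : P) : `|p| < s -> `|p'| < s -> `|ys p - ys p'| <= 2 * C * `|p - p'|.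
  move=> ps ps'; have [yr /Tfix Hy] := ysP _ ps; have [yr' /Tfix Hy'] := ysP _ ps'.
  have := TC p p' _ _ ps ps' yr yr'; rewrite -Hy -Hy'; lra.
have oV : open [set p : P | `|p| < s] by exact: open_norm_lt.
have oD : open [set z : 'rV[R]_N * P | `|z| < d] by exact: open_norm_lt.
have sD : [set z : 'rV[R]_N * P | `|z| < d] `<=` W by move=> z /Hd[].
have LPZ z t h : LP z (t *: h) = t *: LP z h.
  apply/rowP => j; rewrite !mxE mulr_sumr; apply: eq_bigr => i _.
  by rewrite ccZ mulrA.
(* [G] vanishes at both (ys p, p) and (ys pt, pt), so its first-order expansion reads 0 = dy J + t
   LP h + o(t); the Lipschitz bound on [ys] is what makes the error o(t). *)
have HD (p h : P) j : `|p| < s -> is_derive p h (fun p => ys p 0 j)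
    ((- LP (ys p, p) h *m invmx (J (ys p, p))) 0 j).
  move=> ps; have [yr Gy] := ysP _ ps.
  have zd := small _ _ ps yr; set z0 := (ys p, p) in zd Gy *.
  have [Wz Jz] := Hd _ zd.
  have [CJ CJ0 HCJ] := mulmx_norm_le (invmx (J z0)).
  set w := - _ *m _.
  suff wc : t^-1 *: (((fun p => ys p 0 j) \o shift p) (t *: h) - ys p 0 j)
      @[t --> 0^'] --> w 0 j.
    by split; [apply/cvg_ex; eexists; exact: wc|exact: cvg_lim wc].
  apply/cvgrPdist_le => e e0.
  pose B := (2 * C + 1) * (`|h| + 1).
  have h1 : 0 < `|h| + 1 by rewrite ltr_wpDl.
  have B0 : 0 < B by rewrite mulr_gt0 // addr_gt0 // mulr_gt0.
  have e'0 : 0 < e / (CJ * B) by rewrite divr_gt0 // mulr_gt0.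
  have [dl dl0 HG] := GL Wz e'0.
  near=> t.
  have t0 : t != 0 by near: t; exact: nbhs_dnbhs_neq.
  have tn0 : 0 < `|t| by rewrite normr_gt0.
  have td : `|t| * B < dl.
    by rewrite -ltr_pdivlMr //; near: t; apply: dnbhs0_lt; exact: divr_gt0.
  have ts : `|t| * (`|h| + 1) < s - `|p|.
    rewrite -ltr_pdivlMr ?ltr_wpDl //; near: t; apply: dnbhs0_lt.
    by rewrite divr_gt0 ?subr_gt0 // ltr_wpDl.
  have th : `|t *: h| <= `|t| * (`|h| + 1).
    by rewrite normrZ ler_wpM2l // lerDl.
  have pts : `|t *: h + p| < s.
    by apply: le_lt_trans (ler_normD _ _) _; move: th ts; lra.
  set pt := t *: h + p in pts *.
  have ptp : pt - p = t *: h by rewrite /pt addrK.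
  have [ytr Gyt] := ysP _ pts.
  have zE : (ys pt, pt) - z0 = (ys pt - ys p, pt - p) by [].
  have DL : `|(ys pt, pt) - z0| <= `|t| * B.
    rewrite zE.
    have l1 : `|ys pt - ys p| <= 2 * C * (`|t| * (`|h| + 1)).
      apply: le_trans (lip _ _ pts ps) _; rewrite ptp ler_wpM2l //.
      by rewrite mulr_ge0 // ltW.
    have X0 : 0 <= `|t| * (`|h| + 1) by rewrite mulr_ge0 // addr_ge0.
    have X1 : 0 <= 2 * C * (`|t| * (`|h| + 1)) by rewrite !mulr_ge0 // ltW.
    have -> : `|t| * B = 2 * C * (`|t| * (`|h| + 1)) + `|t| * (`|h| + 1).
      by rewrite /B; ring.
    apply: pair_norm_leI; first by apply: le_trans l1 _; rewrite lerDl.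
    by rewrite ptp; apply: le_trans th _; rewrite lerDr.
  have := HG (ys pt, pt) z0; rewrite subrr normr0 => /(_ (le_lt_trans DL td) dl0).
  rewrite Gyt Gy subr0 sub0r normrN.
  rewrite zE LE ptp LPZ.
  set u := _ *m _ + _ => Hu.
  have uE : u *m invmx (J z0) = (ys pt - ys p) - t *: w.
    by rewrite /u mulmxDl mulmxK // /w mulNmx scalerN opprK scalemxAl.
  have uB : `|u *m invmx (J z0)| <= e * `|t|.
    apply: le_trans (HCJ _) _.
    apply: (@le_trans _ _ (CJ * (e / (CJ * B) * (`|t| * B)))).
      apply: (ler_wpM2l (ltW CJ0)); apply: le_trans Hu _.
      by apply: (ler_wpM2l (ltW e'0)); rewrite -ptp -zE.
    have -> // : CJ * (e / (CJ * B) * (`|t| * B)) = e * `|t|.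
    by field; rewrite !gt_eqF.
  have -> : w 0 j - t^-1 *: (((fun p => ys p 0 j) \o shift p) (t *: h) - ys p 0 j)
     = - (t^-1 * (u *m invmx (J z0)) 0 j).
    by rewrite uE !mxE /= -/pt /GRing.scale /=; field.
  rewrite normrN normrM normfV mulrC ler_pdivrMr //.
  exact: le_trans (mx_coord_le _ _ _) uB.
exists ys, r, s; split => //; last first.
  split; first by move=> p ps; split; [exact: ysr|exact: (ysP p ps).2].
    move=> p y ps yr Gy; have [yr' Gy'] := ysP _ ps; exact: (uniq p).
  move=> h j; have n0 : `|0 : P| < s by rewrite normr0.
  set w := \row__ _.
  have -> : w = - LP 0 h *m invmx (J 0).
    apply/rowP => i; rewrite !mxE (@derive_val _ _ _ _ _ _ _ (HD 0 h i n0)) ys0.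
    by rewrite mxE.
  have H := GD (- LP 0 h *m invmx (J 0), h) j W0.
  by rewrite (@derive_val _ _ _ _ _ _ _ H) LE mulmxKV // addNr mxE.
move=> j k; elim: k j => [|k IH] j.
  move=> p ps; apply/cvgrPdist_le => e e0.
  have e'0 : 0 < e / (2 * C) by rewrite divr_gt0 // mulr_gt0.
  near=> p'.
  have p's : `|p'| < s by near: p'; exact: open_nbhs_nbhs (conj oV ps).
  have -> : ys p 0 j - ys p' 0 j = (ys p - ys p') 0 j by rewrite !mxE.
  apply: le_trans (mx_coord_le _ _ _) _; apply: le_trans (lip _ _ ps p's) _.
  rewrite mulrC -ler_pdivlMr ?mulr_gt0 //; near: p'; apply/nbhs_dist.
split.
  by apply: (@Ck_continuous _ _ _ k); exact: IH.
move=> h; split.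
  by move=> p ps; exact: (@ex_derive _ _ _ _ _ _ _ (HD p h j ps)).
(* Bootstrapping: the derivative of [ys] is a smooth expression in [ys] itself, so order k for [ys]
   gives order k for its derivative. *)
apply: (@Ck_ext _ _ _ _ (fun p => \sum_i (- LP (ys p, p) h 0 i *
    invmx (J (ys p, p)) i j))) => //.
  move=> p ps; rewrite (@derive_val _ _ _ _ _ _ _ (HD p h j ps)) mxE.
  by apply: eq_bigr => i _; rewrite !mxE.
have comp f : Ck [set z | `|z| < d] k f ->
    Ck [set p | `|p| < s] k (fun p => f (ys p, p)).
  move=> fk; apply: (Ck_comp (K := K) (W := [set z | `|z| < d])) fk _ => //.
    by move=> p ps /=; apply: small => //; exact: (ysP p ps).1.
  case=> i /=; last exact: Ck_coord.
  by rewrite (ord1 i.1); exact: IH.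
apply: Ck_sum => // i _; apply: Ck_mul => //.
  apply: Ck_opp => //; apply: (comp (fun z => LP z h 0 i)).
  exact: Ck_sub sD (LPC h i k).
apply: (comp (fun z => invmx (J z) i j)); apply: Ck_invmx => //.
  by move=> z /Hd[].
by move=> a b; exact: Ck_sub sD (JC a b k).
Unshelve. all: by end_near. Qed.

End ImplicitFunction.

(** * Jordan-Chevalley decomposition *)

Section FieldJordanChevalley.
Variables (F : fieldType) (n : nat).
Implicit Types A S N M P : 'M[F]_n.

Lemma diagonalizable_similarP A :
  diagonalizable A <->
  exists P (d : 'rV[F]_n), P \in unitmx /\ P *m A = diag_mx d *m P.
Proof.
split=> [[P Pu /similar_diagPex[d /(similarP Pu) H]]|[P [d [Pu H]]]].
  by exists P, d.
by exists P => //; apply/similar_diagPex; exists d; apply/(similarP Pu).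
Qed.

Lemma diagonalizable_ker_sqr M (v : 'rV[F]_n) : diagonalizable M ->
  v *m M *m M = 0 -> v *m M = 0.
Proof.
move=> /diagonalizable_similarP[P [d [Pu PM]]] vMM.
have ME : M = invmx P *m diag_mx d *m P by rewrite -mulmxA -PM mulKmx.
have w2 : v *m invmx P *m diag_mx d *m diag_mx d = 0.
  have : v *m M *m M *m invmx P = 0 by rewrite vMM mul0mx.
  by rewrite ME !mulmxA !mulmxK.
have w1 : v *m invmx P *m diag_mx d = 0.
  apply/rowP => j; move/rowP: w2 => /(_ j).
  rewrite !mul_mx_diag !mxE -mulrA => /eqP; rewrite !mulf_eq0 orbb => H.
  by apply/eqP; rewrite mulf_eq0.
by rewrite ME !mulmxA w1 mul0mx.
Qed.

Lemma diagonalizable_ker_expr M (v : 'rV[F]_n) k : diagonalizable M ->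
  v *m (M ^+ k.+1) = 0 -> v *m M = 0.
Proof.
move=> dM; elim: k => [|k IH]; first by rewrite expr1.
rewrite !exprSr -!mulmxE !mulmxA => /(diagonalizable_ker_sqr dM) H.
by apply: IH; rewrite exprSr -mulmxE mulmxA.
Qed.

Lemma diagonalizable_subC A (a : F) : diagonalizable A -> diagonalizable (A - a%:M).
Proof.
move=> /diagonalizable_similarP[P [d [Pu PM]]].
apply/diagonalizable_similarP; exists P, (d - const_mx a); split => //.
have -> : diag_mx (d - const_mx a) = diag_mx d - a%:M.
  by rewrite -diag_const_mx raddfB.
by rewrite mulmxBr mulmxBl PM scalar_mxC.
Qed.

(** S and S' are not known to commute with each other, so they are compared on the left eigenvectors
    [v] of S. If v S = a v, then A - a acts on [v] as N and is nilpotent there; subtracting N',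
    which commutes with A, shows that a power of S' - a kills [v], and semisimplicity of S' gives v
    S' = a v. *)
Lemma jordan_chevalley_unique_field A S N S' N' k k' :
  A = S + N -> A = S' + N' -> diagonalizable S -> diagonalizable S' ->
  N ^+ k = 0 -> N' ^+ k' = 0 -> S *m N = N *m S -> S' *m N' = N' *m S' -> S = S'.
Proof.
move=> AE AE' /diagonalizable_similarP[P [d [Pu PS]]] dS' Nk N'k cSN cSN'.
suff PS' : P *m S' = P *m S by rewrite -[LHS](mulKmx Pu) -PS' mulKmx.
apply/row_matrixP => i; rewrite !row_mul; set v := row i P.
pose a := d 0 i.
have vS : v *m S = a *: v.
  by rewrite /v -row_mul PS row_mul row_diag_mx -scalemxAl -rowE.
have vSa : v *m (S - a%:M) = 0 by rewrite mulmxBr vS mul_mx_scalar subrr.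
have cN : GRing.comm (S - a%:M) N.
  by rewrite /GRing.comm -!mulmxE mulmxBl mulmxBr cSN scalar_mxC.
have AEa : A - a%:M = (S - a%:M) + N by rewrite AE addrAC.
have vA j : v *m (A - a%:M) ^+ j = v *m N ^+ j.
  elim: j => [//|j IH].
  rewrite exprSr -mulmxE mulmxA IH AEa mulmxDr [in RHS]exprSr -mulmxE mulmxA.
  rewrite -[v *m _ *m (S - _)]mulmxA.
  have -> : N ^+ j *m (S - a%:M) = (S - a%:M) *m N ^+ j.
    by rewrite !mulmxE; exact/esym/commrX.
  by rewrite mulmxA vSa mul0mx add0r.
have cx : GRing.comm (A - a%:M) N'.
  by rewrite /GRing.comm -!mulmxE mulmxBl mulmxBr AE' mulmxDl mulmxDr cSN' scalar_mxC.
have S'E : S' - a%:M = (A - a%:M) - N' by rewrite AE' addrAC addrK.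
(* In every binomial term either the power of N' is at least [k'] or the power of A - a is at least
   [k]. *)
have : v *m (S' - a%:M) ^+ (k + k').+1 = 0.
  rewrite S'E exprBn_comm // mulmx_sumr big1 // => -[j /= jk] _.
  rewrite -scaler_nat -scalemxAr.
  suff -> : v *m ((-1) ^+ j * (A - a%:M) ^+ ((k + k').+1 - j) * N' ^+ j) = 0.
    by rewrite scaler0.
  have [jk'|jk'] := leqP k' j.
    have -> : N' ^+ j = 0 by rewrite -(subnK jk') exprD N'k mulr0.
    by rewrite mulr0 mulmx0.
  have kj : (k <= (k + k').+1 - j)%N by lia.
  rewrite -(commrX j (commrN1 ((A - a%:M) ^+ ((k + k').+1 - j)))) -!mulmxE.
  rewrite -(subnKC kj) exprD -!mulmxE !mulmxA vA Nk mulmx0 !mul0mx.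
  by [].
move/(diagonalizable_ker_expr (diagonalizable_subC a dS')).
by rewrite mulmxBr mul_mx_scalar -vS => /subr0_eq.
Qed.

End FieldJordanChevalley.

Section JordanChevalley.
Variable R : realType.

Lemma map_mxX (rR sR : pzRingType) (f : {rmorphism rR -> sR}) n (A : 'M[rR]_n) k :
  map_mx f (A ^+ k) = (map_mx f A) ^+ k.
Proof.
elim: k => [|k IH]; first by rewrite !expr0 map_mx1.
by rewrite !exprS -!mulmxE map_mxM IH.
Qed.

(** Semisimplicity is a condition over the complex numbers, so uniqueness is obtained there and
    pulled back along the injective entrywise embedding. *)
Lemma jordan_chevalley_unique n (A S N S' N' : 'M[R]_n) :
  jordan_chevalley A S N -> jordan_chevalley A S' N' -> S = S'.
Proof.
move=> [A1 S1 [k N1] C1] [A2 S2 [k' N2] C2].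
apply: (map_mx_inj (f := real_complex R)).
pose f : 'M[R]_n -> 'M[complex R]_n := map_mx (real_complex R).
have H1 : f A = f S + f N by rewrite /f A1 map_mxD.
have H2 : f A = f S' + f N' by rewrite /f A2 map_mxD.
have H3 : f N ^+ k = 0 by rewrite /f -map_mxX N1 map_mx0.
have H4 : f N' ^+ k' = 0 by rewrite /f -map_mxX N2 map_mx0.
have H5 : f S *m f N = f N *m f S by rewrite /f -!map_mxM C1.
have H6 : f S' *m f N' = f N' *m f S' by rewrite /f -!map_mxM C2.
exact: (jordan_chevalley_unique_field H1 H2 S1 S2 H3 H4 H5 H6).
Qed.

(** Since N^k = 0, the invertible matrix A^k equals A^k - N^k, which is divisible by A - N = S. *)
Lemma jordan_chevalley_unit n (A S N : 'M[R]_n) :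
  jordan_chevalley A S N -> A \in unitmx -> S \in unitmx.
Proof.
move=> [AE _ [k Nk] C] Au.
have cAN : GRing.comm A N by rewrite /GRing.comm -!mulmxE AE mulmxDl mulmxDr C.
have := subrXX_comm k cAN; rewrite Nk subr0 AE addrK -AE -mulmxE => Ak.
have : A ^+ k \in unitmx.
  by elim: k {Nk Ak} => [|k IH]; rewrite ?expr0 ?unitmx1 // exprS -mulmxE unitmx_mul Au.
by rewrite Ak unitmx_mul => /andP[].
Qed.

Lemma jordan_chevalley_conj n (A S N X X' : 'M[R]_n) :
  X *m X' = 1%:M -> jordan_chevalley A S N ->
  jordan_chevalley (X *m A *m X') (X *m S *m X') (X *m N *m X').
Proof.
move=> XX' [AE Sd [k Nk] C]; have X'X := mulmx1C XX'.
have XM (M M' : 'M[R]_n) : (X *m M *m X') *m (X *m M' *m X') = X *m (M *m M') *m X'.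
  by rewrite !mulmxA -(mulmxA _ X' X) X'X mulmx1.
split; first by rewrite AE mulmxDr mulmxDl.
- move: Sd => /diagonalizable_similarP[P [d [Pu PS]]].
  apply/diagonalizable_similarP.
  exists (P *m map_mx (real_complex R) X'), d; split.
    by rewrite unitmx_mul Pu map_unitmx; have [] := mulmx1_unit XX'.
  have X'Xc : map_mx (real_complex R) X' *m map_mx (real_complex R) X = 1%:M.
    by rewrite -map_mxM X'X map_mx1.
  rewrite !map_mxM !mulmxA -[P *m _ *m _]mulmxA X'Xc mulmx1 PS.
  by [].
- exists k; have -> : (X *m N *m X') ^+ k = X *m N ^+ k *m X'.
    elim: k {Nk} => [|k IH]; first by rewrite !expr0 mulmx1 XX'.
    by rewrite !exprS -!mulmxE IH XM.
  by rewrite Nk mulmx0 mul0mx.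
- by rewrite !XM C.
Qed.

(** The nilpotent part is A^-1 - S^-1 = - A^-1 N S^-1. This serves the group elements that conjugate
    A to its inverse. *)
Lemma jordan_chevalley_inv n (A S N : 'M[R]_n) : A \in unitmx ->
  jordan_chevalley A S N ->
  jordan_chevalley (invmx A) (invmx S) (- (invmx A *m N *m invmx S)).
Proof.
move=> Au jc; have Su := jordan_chevalley_unit jc Au.
have [AE Sd [k Nk] C] := jc.
have comm_inv (M M' : 'M[R]_n) : M \in unitmx -> M *m M' = M' *m M ->
    invmx M *m M' = M' *m invmx M.
  move=> Mu H; apply: (canRL (mulmxK Mu)).
  by rewrite -mulmxA -H mulKmx.
have cAN : A *m N = N *m A by rewrite AE mulmxDl mulmxDr C.
have cAS : A *m S = S *m A by rewrite AE mulmxDl mulmxDr C.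
have cANi := comm_inv _ _ Au cAN.
have cSNi := comm_inv _ _ Su C.
have cSAi : invmx S *m invmx A = invmx A *m invmx S.
  have cASi := comm_inv _ _ Au cAS.
  by apply: comm_inv => //; rewrite cASi.
split.
- have -> : N = A - S by rewrite AE addrC addKr.
  by rewrite mulmxBr mulmxBl mulVmx // mul1mx mulmxK // opprB addrC subrK.
- move: Sd => /diagonalizable_similarP[P [d [Pu PS]]].
  apply/diagonalizable_similarP; exists P, (\row_i (d 0 i)^-1); split => //.
  have du : diag_mx d \in unitmx.
    have : P *m map_mx (real_complex R) S \in unitmx by rewrite unitmx_mul Pu map_unitmx.
    by rewrite PS unitmx_mul => /andP[].
  have dd : diag_mx (\row_i (d 0 i)^-1) *m diag_mx d = 1%:M.
    rewrite mulmx_diag -diag_const_mx; congr diag_mx; apply/rowP => j; rewrite !mxE.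
    rewrite mulVf //; move: du; rewrite unitmxE unitfE det_diag.
    by move=> /prodf_neq0; apply.
  rewrite map_invmx; apply: (canLR (mulmxK _)); first by rewrite map_unitmx.
  by rewrite -mulmxA PS mulmxA dd mul1mx.
- exists k; rewrite exprNn.
  have -> : invmx A *m N *m invmx S = (invmx A *m invmx S) *m N.
    by rewrite -!mulmxA cSNi.
  rewrite !mulmxE exprMn_comm.
    by rewrite Nk mulr0 mulr0.
  by rewrite /GRing.comm -!mulmxE -mulmxA cSNi !mulmxA cANi.
- by rewrite mulmxN mulNmx !mulmxA cSAi -!mulmxA; congr (- (_ *m _)); rewrite mulmxA cSNi -!mulmxA.
Qed.

(** The minimal polynomial p of S is separable, so it splits as r d with d = gcd (p, X^q - 1) and r
    coprime to X^q - 1. From a Bezout relation a r + b (X^q - 1) = 1, take E = (a r)(S) and T =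
    b(S). Being a polynomial in S, E commutes with the whole commutant of S. *)
Lemma spectral_projection n (S : 'M[R]_n) q : (0 < q)%N -> semisimple_mx S ->
  exists E T : 'M[R]_n,
    [/\ (S ^+ q - 1%:M) *m E = 0, 1%:M - E = T *m (S ^+ q - 1%:M) &
     forall X, X *m S = S *m X -> X *m E = E *m X].
Proof.
case: n S => [|n] S q0 Sd.
  have e0 (M M' : 'M[R]_0) : M = M' by apply/matrixP => -[].
  by exists 0, 0; split=> [||X _]; exact: e0.
have [rs urs prs] : exists2 rs : seq (complex R), uniq rs &
    mxminpoly (map_mx (real_complex R) S) %| \prod_(x <- rs) ('X - x%:P).
  exact/diagonalizableP.
set p := mxminpoly S.
have sp : separable_poly p.
  rewrite -(separable_map (real_complex R)) -mxminpoly_map.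
  by apply: dvdp_separable prs _; rewrite separable_prod_XsubC.
pose c : {poly R} := 'X^q - 1.
pose d := gcdp p c; pose r := p %/ d.
have pE : p = r * d by rewrite /r divpK // dvdp_gcdl.
have crd : coprimep r d.
  by move: sp; rewrite pE separable_mul => /and3P[].
have crc : coprimep r c.
  have : gcdp r c %| gcdp r d.
    rewrite dvdp_gcd dvdp_gcdl /= dvdp_gcd dvdp_gcdr andbT pE.
    by apply: dvdp_mulr; exact: dvdp_gcdl.
  by rewrite (@eqp_dvdr _ 1) ?gcdp_eqp1 // dvdp1.
have [[a b] /= ab] := Bezout_eq1_coprimepP _ _ crc.
have hc : horner_mx S c = S ^+ q - 1%:M.
  by rewrite /c rmorphB /= rmorph1 rmorphXn /= horner_mx_X.
exists (horner_mx S (a * r)), (horner_mx S b); split.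
- rewrite -hc mulmxE -rmorphM.
  have /dvdpP[e ->] : p %| c * (a * r).
    rewrite mulrCA pE [r * d]mulrC; apply: dvdp_mull.
    by apply: dvdp_mul => //; exact: dvdp_gcdr.
  by rewrite rmorphM /= mx_root_minpoly mulr0.
- by rewrite -hc mulmxE -rmorphM -[1%:M](rmorph1 (horner_mx S)) -rmorphB /= -ab addrC addKr.
- by move=> X XS; exact: comm_mx_horner.
Qed.

End JordanChevalley.

(** * Germs of smooth maps *)

Section SmoothNear0.
Variable R : realType.

(** One radius serves all orders, as in [smooth_near0]. Matrix-valued maps are handled entry by
    entry, and [smooth_near0P] is the bridge between the two notions. *)
Definition smooth0 (E : normedModType R) (f : E -> R) : Prop :=
  exists2 r : R, 0 < r & forall k, Ck [set x | `|x| < r] k f.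

Definition smooth0mx (E : normedModType R) a b (f : E -> 'M[R]_(a, b)) : Prop :=
  forall i j, smooth0 (fun x => f x i j).

Definition deriv0mx (E : normedModType R) a b (f : E -> 'M[R]_(a, b)) (v : E)
    (D : 'M[R]_(a, b)) : Prop :=
  forall i j, is_derive (0 : E) v (fun x => f x i j) (D i j).

Lemma common_radius (I : finType) (P : I -> R -> Prop) :
  (forall i, exists2 r : R, 0 < r & P i r) ->
  (forall i r r', r' <= r -> P i r -> P i r') ->
  exists2 r : R, 0 < r & forall i, P i r.
Proof.
move=> H mono.
have : \forall r \near 0^'+, forall i, P i r.
  apply: filter_forall => i; have [r r0 Pr] := H i.
  near=> r'; apply: mono Pr; near: r'; exact: nbhs_right_le.
move=> HH; near (0 : R)^'+ => r; exists r; first by near: r; exact: nbhs_right_gt.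
by near: r.
Unshelve. all: by end_near. Qed.

Lemma ball_sub (E : normedModType R) (r r' : R) : r' <= r ->
  [set x : E | `|x| < r'] `<=` [set x | `|x| < r].
Proof. by move=> rr x /= xr; exact: lt_le_trans xr rr. Qed.

Lemma smooth0mx_radius (E : normedModType R) a b (f : E -> 'M[R]_(a, b)) :
  smooth0mx f -> exists2 r : R, 0 < r & forall i j k,
    Ck [set x | `|x| < r] k (fun x => f x i j).
Proof.
move=> H; have [||r r0 Hr] := @common_radius ('I_a * 'I_b)%type
  (fun ij r => forall k, Ck [set x | `|x| < r] k (fun x => f x ij.1 ij.2)).
- by move=> [i j]; exact: H.
- by move=> ij r r' rr Hk k; exact: Ck_sub (ball_sub rr) (Hk k).
- by exists r => // i j k; exact: (Hr (i, j)).
Qed.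

Section Closure.
Variable E : normedModType R.
Implicit Types f g : E -> R.

Lemma smooth0_cst (a : R) : smooth0 (fun _ : E => a).
Proof. by exists 1 => // k; exact: Ck_cst. Qed.

Lemma smooth0_linear f : (forall x y, f (x - y) = f x - f y) ->
  (forall a x, f (a *: x) = a * f x) -> (forall x, `|f x| <= `|x|) -> smooth0 f.
Proof. by move=> fB fZ fle; exists 1 => // k; exact: Ck_linear. Qed.

Lemma smooth0_add f g : smooth0 f -> smooth0 g -> smooth0 (fun x => f x + g x).
Proof.
move=> [r r0 fr] [s s0 gs]; exists (Num.min r s); first by rewrite lt_min r0.
move=> k; apply: Ck_add; first exact: open_norm_lt.
  by apply: Ck_sub (fr k); apply: ball_sub; rewrite ge_min lexx.
by apply: Ck_sub (gs k); apply: ball_sub; rewrite ge_min lexx orbT.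
Qed.

Lemma smooth0_mul f g : smooth0 f -> smooth0 g -> smooth0 (fun x => f x * g x).
Proof.
move=> [r r0 fr] [s s0 gs]; exists (Num.min r s); first by rewrite lt_min r0.
move=> k; apply: Ck_mul; first exact: open_norm_lt.
  by apply: Ck_sub (fr k); apply: ball_sub; rewrite ge_min lexx.
by apply: Ck_sub (gs k); apply: ball_sub; rewrite ge_min lexx orbT.
Qed.

Lemma smooth0_sum (I : Type) (r : seq I) (F : I -> E -> R) :
  (forall i, smooth0 (F i)) -> smooth0 (fun x => \sum_(i <- r) F i x).
Proof.
move=> H; elim: r => [|i r IH].
  by under eq_fun do rewrite big_nil; exact: smooth0_cst.
under eq_fun do rewrite big_cons.
exact: smooth0_add.
Qed.

Lemma smooth0_continuous f : smooth0 f -> {for 0, continuous f}.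
Proof. by move=> [r r0 fr]; apply: (Ck_continuous (fr 0%N)); rewrite /= normr0. Qed.

Lemma smooth0_comp (F : normedModType R) (K : coords F) (f : F -> R) (g : E -> F) :
  g 0 = 0 -> smooth0 f -> (forall i : cI K, smooth0 (fun x => cc i (g x))) ->
  smooth0 (fun x => f (g x)).
Proof.
move=> g0 [r r0 fr] gs.
have [||s s0 Hs] := @common_radius (cI K)
    (fun i s => forall k, Ck [set x | `|x| < s] k (fun x => cc i (g x))).
- by move=> i; exact: gs.
- by move=> i s s' ss Hk k; exact: Ck_sub (ball_sub ss) (Hk k).
have gc : {for 0, continuous g}.
  by apply: (coords_continuous (K := K)) => i; exact: smooth0_continuous.
have : \forall x \near (0 : E), `|g x| < r.
  have := gc; rewrite /prop_for /continuous_at g0 => /cvgrPdist_lt /(_ r r0).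
  by apply: filterS => x; rewrite sub0r normrN.
case/nbhs0_dist => d d0 Hd.
exists (Num.min d s); first by rewrite lt_min d0.
move=> k; apply: (@Ck_comp _ _ _ K _ [set x | `|x| < r]).
- exact: open_norm_lt.
- exact: open_norm_lt.
- by move=> x /=; rewrite lt_min => /andP[/Hd].
- exact: fr.
- by move=> i; apply: Ck_sub (Hs i k); apply: ball_sub; rewrite ge_min lexx orbT.
Qed.

Lemma smooth0_strictly_diff (K : coords E) f : smooth0 f ->
  strictly_diff f 0 (fun u => \sum_(i : cI K) cc i u * 'D_(ce i) f 0).
Proof.
move=> [r r0 fr]; apply: (@Ck_strictly_diff _ _ K [set x | `|x| < r]) => //.
  exact: open_norm_lt.
by rewrite /= normr0.
Qed.

Lemma smooth0_deriveE (K : coords E) f v : smooth0 f ->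
  is_derive (0 : E) v f (\sum_(i : cI K) cc i v * 'D_(ce i) f 0).
Proof.
move=> fs; apply: (@is_derive_chain _ _ _ K f id).
  exact: smooth0_strictly_diff.
by move=> i; apply: is_derive_line => h; rewrite -ccB addrK ccZ.
Qed.

Lemma smooth0_derive (K : coords E) f v : smooth0 f ->
  is_derive (0 : E) v f ('D_v f 0).
Proof.
move=> fs; apply: derivableP.
exact: (@ex_derive _ _ _ _ _ _ _ (smooth0_deriveE K v fs)).
Qed.

End Closure.

Lemma smooth0_comp_derive (E F : normedModType R) (K : coords F) (f : F -> R)
    (g : E -> F) v w : g 0 = 0 -> smooth0 f ->
  (forall i : cI K, is_derive (0 : E) v (fun x => cc i (g x)) (cc i w)) ->
  is_derive (0 : E) v (fun x => f (g x)) ('D_w f 0).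
Proof.
move=> g0 fs dg.
rewrite (@derive_val _ _ _ _ _ _ _ (smooth0_deriveE K w fs)).
apply: (@is_derive_chain _ _ _ K f g) => //; rewrite g0.
exact: smooth0_strictly_diff.
Qed.

Section MatrixClosure.
Variable E : normedModType R.

Lemma smooth0mx_add a b (f g : E -> 'M[R]_(a, b)) :
  smooth0mx f -> smooth0mx g -> smooth0mx (fun x => f x + g x).
Proof.
move=> fs gs i j; under eq_fun do rewrite mxE.
by apply: smooth0_add; [exact: fs|exact: gs].
Qed.

Lemma smooth0mx_scale a b (c : R) (f : E -> 'M[R]_(a, b)) :
  smooth0mx f -> smooth0mx (fun x => c *: f x).
Proof.
move=> fs i j; under eq_fun do rewrite mxE.
by apply: smooth0_mul; [exact: smooth0_cst|exact: fs].
Qed.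

Lemma smooth0mx_sub a b (f g : E -> 'M[R]_(a, b)) :
  smooth0mx f -> smooth0mx g -> smooth0mx (fun x => f x - g x).
Proof.
move=> fs gs; apply: smooth0mx_add => //.
by under eq_fun do rewrite -scaleN1r; exact: smooth0mx_scale.
Qed.

Lemma smooth0mx_mul a b c (A : 'M[R]_(a, b)) (f : E -> 'M[R]_(b, c)) :
  smooth0mx f -> smooth0mx (fun x => A *m f x).
Proof.
move=> fs i j; under eq_fun do rewrite mxE.
apply: smooth0_sum => k; apply: smooth0_mul; first exact: smooth0_cst.
exact: fs.
Qed.

Lemma smooth0mx_sum a b (I : Type) (r : seq I) (F : I -> E -> 'M[R]_(a, b)) :
  (forall k, smooth0mx (F k)) -> smooth0mx (fun x => \sum_(k <- r) F k x).
Proof.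
move=> fs i j; under eq_fun do rewrite summxE.
by apply: smooth0_sum => k; exact: fs.
Qed.

Lemma smooth0mx_comp a b n m (f : 'cV[R]_n * 'cV[R]_m -> 'M[R]_(a, b))
    (g : E -> 'cV[R]_n) (h : E -> 'cV[R]_m) : g 0 = 0 -> h 0 = 0 ->
  smooth0mx f -> smooth0mx g -> smooth0mx h -> smooth0mx (fun x => f (g x, h x)).
Proof.
move=> g0 h0 fs gs hs i j.
apply: (@smooth0_comp _ _ (coords_prod (coords_mx R n 1) (coords_mx R m 1))
   (fun z => f z i j) (fun x => (g x, h x))).
- by rewrite g0 h0.
- exact: fs.
- by case=> k /=; [exact: gs|exact: hs].
Qed.

Lemma deriv0mx_add a b (f g : E -> 'M[R]_(a, b)) v A B :
  deriv0mx f v A -> deriv0mx g v B -> deriv0mx (fun x => f x + g x) v (A + B).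
Proof.
move=> fs gs i j; under eq_fun do rewrite mxE.
by rewrite mxE; apply: is_deriveD; [exact: fs|exact: gs].
Qed.

Lemma is_derive_scale (f : E -> R) v c l : is_derive (0 : E) v f l ->
  is_derive (0 : E) v (fun x => c * f x) (c * l).
Proof. by move=> H; exact: is_deriveZ. Qed.

Lemma is_derive_bigsum (I : Type) (r : seq I) (F : I -> E -> R) v (l : I -> R) :
  (forall i, is_derive (0 : E) v (F i) (l i)) ->
  is_derive (0 : E) v (fun x => \sum_(i <- r) F i x) (\sum_(i <- r) l i).
Proof.
move=> H; elim: r => [|i r IH].
  rewrite big_nil; under eq_fun do rewrite big_nil.
  by apply: is_derive_line => h; rewrite subrr mulr0.
rewrite big_cons; under eq_fun do rewrite big_cons.
exact: is_deriveD.
Qed.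

Lemma deriv0mx_scale a b (c : R) (f : E -> 'M[R]_(a, b)) v A :
  deriv0mx f v A -> deriv0mx (fun x => c *: f x) v (c *: A).
Proof.
move=> fs i j; under eq_fun do rewrite mxE.
by rewrite mxE; exact: is_derive_scale.
Qed.

Lemma deriv0mx_sub a b (f g : E -> 'M[R]_(a, b)) v A B :
  deriv0mx f v A -> deriv0mx g v B -> deriv0mx (fun x => f x - g x) v (A - B).
Proof.
move=> fs gs; apply: deriv0mx_add => //.
have -> : (fun x => - g x) = (fun x => -1 *: g x).
  by apply/funext => x; rewrite scaleN1r.
by rewrite -[- B]scaleN1r; exact: deriv0mx_scale.
Qed.

Lemma deriv0mx_mul a b c (M : 'M[R]_(a, b)) (f : E -> 'M[R]_(b, c)) v A :
  deriv0mx f v A -> deriv0mx (fun x => M *m f x) v (M *m A).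
Proof.
move=> fs i j; under eq_fun do rewrite mxE; rewrite mxE.
by apply: is_derive_bigsum => k; apply: is_derive_scale; exact: fs.
Qed.

Lemma deriv0mx_sum a b (I : Type) (r : seq I) (F : I -> E -> 'M[R]_(a, b)) v A :
  (forall k, deriv0mx (F k) v (A k)) ->
  deriv0mx (fun x => \sum_(k <- r) F k x) v (\sum_(k <- r) A k).
Proof.
move=> fs i j; under eq_fun do rewrite summxE; rewrite summxE.
by apply: is_derive_bigsum => k; exact: fs.
Qed.

Lemma deriv0mx_comp a b n m (f : 'cV[R]_n * 'cV[R]_m -> 'M[R]_(a, b))
    (g : E -> 'cV[R]_n) (h : E -> 'cV[R]_m) v A B D : g 0 = 0 -> h 0 = 0 ->
  smooth0mx f -> deriv0mx f (A, B) D -> deriv0mx g v A -> deriv0mx h v B ->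
  deriv0mx (fun x => f (g x, h x)) v D.
Proof.
move=> g0 h0 fs fD gD hD i j.
rewrite -(@derive_val _ _ _ _ _ _ _ (fD i j)).
apply: (@smooth0_comp_derive _ _ (coords_prod (coords_mx R n 1) (coords_mx R m 1))
   (fun z => f z i j) (fun x => (g x, h x))).
- by rewrite g0 h0.
- exact: fs.
- by case=> k /=; [exact: gD|exact: hD].
Qed.

Lemma deriv0mx_eq a b (f : E -> 'M[R]_(a, b)) v A : deriv0mx f v A ->
  derivable f 0 v /\ 'D_v f 0 = A.
Proof.
move=> fA.
have fd : derivable f 0 v.
  by apply/derivable_mxP => i j; exact: (@ex_derive _ _ _ _ _ _ _ (fA i j)).
split=> //; rewrite derive_mx //; apply/matrixP => i j; rewrite mxE.
exact: (@derive_val _ _ _ _ _ _ _ (fA i j)).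
Qed.

Lemma deriv0mx_unique a b (f : E -> 'M[R]_(a, b)) v A B :
  deriv0mx f v A -> deriv0mx f v B -> A = B.
Proof. by move=> /deriv0mx_eq[_ <-] /deriv0mx_eq[]. Qed.

Lemma deriv0mx_ext a b (f g : E -> 'M[R]_(a, b)) v A :
  (\forall x \near (0 : E), f x = g x) -> deriv0mx f v A -> deriv0mx g v A.
Proof.
move=> fg fA i j; apply: near_eq_is_derive (fA i j).
by apply: filterS fg => x ->.
Qed.

Lemma smooth0mx_derive (K : coords E) a b (f : E -> 'M[R]_(a, b)) v :
  smooth0mx f -> deriv0mx f v ('D_v f 0).
Proof.
move=> fs; have H i j := smooth0_derive K v (fs i j).
have fd : derivable f 0 v.
  by apply/derivable_mxP => i j; exact: (@ex_derive _ _ _ _ _ _ _ (H i j)).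
by move=> i j; rewrite derive_mx // mxE; exact: H.
Qed.

End MatrixClosure.

Lemma smooth0mx_fst n (F : normedModType R) : smooth0mx (fun z : 'cV[R]_n * F => z.1).
Proof.
move=> i j; apply: smooth0_linear.
- by move=> x y; rewrite !mxE.
- by move=> a x; rewrite !mxE.
- by move=> x; apply: le_trans (mx_coord_le _ _ _) _; exact: fst_norm_le.
Qed.

Lemma smooth0mx_snd n (F : normedModType R) : smooth0mx (fun z : F * 'cV[R]_n => z.2).
Proof.
move=> i j; apply: smooth0_linear.
- by move=> x y; rewrite !mxE.
- by move=> a x; rewrite !mxE.
- by move=> x; apply: le_trans (mx_coord_le _ _ _) _; exact: snd_norm_le.
Qed.

Lemma deriv0mx_fst n (F : normedModType R) v :
  deriv0mx (fun z : 'cV[R]_n * F => z.1) v v.1.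
Proof. by move=> i j; apply: is_derive_line => h; rewrite !mxE /= addr0 subr0. Qed.

Lemma deriv0mx_snd n (F : normedModType R) v :
  deriv0mx (fun z : F * 'cV[R]_n => z.2) v v.2.
Proof. by move=> i j; apply: is_derive_line => h; rewrite !mxE /= addr0 subr0. Qed.

(** The theorem differentiates the slice at parameter 0, the calculus here the map of both
    variables; the difference quotients are the same. *)
Lemma deriv0mx_slice a b n m (f : 'cV[R]_n * 'cV[R]_m -> 'M[R]_(a, b)) v A :
  (deriv0mx f (v, 0) A -> 'D_v (fun x => f (x, 0)) 0 = A) /\
  'D_v (fun x => f (x, 0)) 0 = 'D_(v, 0) f 0.
Proof.
have E0 : 'D_v (fun x => f (x, 0)) 0 = 'D_(v, 0) f 0.
  rewrite /derive; set u := fun h => _; set w := fun h => _.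
  suff -> : u = w by [].
  apply/funext => h; rewrite /u /w /=; congr (_ *: (f _ - _)).
  by congr pair; rewrite /= scaler0 addr0.
by split=> //; rewrite E0 => /deriv0mx_eq[].
Qed.

Lemma Ck_on_mx (E : normedModType R) (W : set E) k a b (f : E -> 'M[R]_(a, b)) :
  open W -> Ck_on setT W k f <-> forall i j, Ck W k (fun x => f x i j).
Proof.
move=> oW.
have cP (g : E -> 'M[R]_(a, b)) : {within W, continuous g} <->
    forall i j x, W x -> {for x, continuous (fun x => g x i j)}.
  rewrite continuous_open_subspace //; split.
    move=> gc i j x Wx; apply: (@continuous_comp _ _ _ g (fun M : 'M[R]_(a, b) => M i j)).
      by apply: gc; rewrite inE.
    exact: coord_continuous.
  move=> H x; rewrite inE => Wx.
  by apply: (coords_continuous (K := coords_mx R a b)) => -[i j] /=; exact: H.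
elim: k f => [|k IH] f /=; first exact: cP.
split.
  move=> [/cP fc fd] i j; split; first exact: fc.
  move=> v; have [fv Dv] := fd v I; split.
    by move=> x Wx; have /derivable_mxP := fv x Wx; exact.
  have /IH /(_ i j) := Dv; apply: Ck_ext => // x Wx.
  by rewrite derive_mx ?mxE //; exact: fv.
move=> H; split; first by apply/cP => i j; have [] := H i j.
move=> v _; have fv x : W x -> derivable f x v.
  by move=> Wx; apply/derivable_mxP => i j; have [_ Hv] := H i j; exact: (Hv v).1.
split=> //; apply/IH => i j; have [_ /(_ v)[_]] := H i j; apply: Ck_ext => // x Wx.
by rewrite derive_mx ?mxE //; exact: fv.
Qed.

Lemma Ck_on_sub (E F : normedModType R) (V V' A A' : set E) k (f : E -> F) :
  V' `<=` V -> A' `<=` A -> Ck_on V A k f -> Ck_on V' A' k f.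
Proof.
move=> sV sA; elim: k f => [|k IH] f /=; first exact: continuous_subspaceW.
move=> [fc fd]; split; first exact: continuous_subspaceW fc.
move=> v /sV Vv; have [fv Dv] := fd v Vv; split; first by move=> x /sA; exact: fv.
exact: IH.
Qed.

Lemma smooth_near0P (E : normedModType R) a b (f : E -> 'M[R]_(a, b)) :
  smooth_near0 setT f <-> smooth0mx f.
Proof.
split=> [[W [oW W0] H]|/smooth0mx_radius[r r0 H]].
  have /nbhs0_dist[r r0 Wr] := open_nbhs_nbhs (conj oW W0).
  move=> i j; exists r => // k; apply: (@Ck_sub _ _ W); first by move=> x /= /Wr.
  by move: i j; apply/(Ck_on_mx _ _ oW); have := H k; rewrite setIT.
exists [set x | `|x| < r]; first by split; [exact: open_norm_lt|rewrite /= normr0].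
move=> k; rewrite setIT; apply/Ck_on_mx; first exact: open_norm_lt.
by move=> i j; exact: H.
Qed.

(** This is how smoothness along U is obtained: all maps are built smooth on the full space. *)
Lemma smooth_near0_sub (E F : normedModType R) (V : set E) (f : E -> F) :
  smooth_near0 setT f -> smooth_near0 V f.
Proof.
move=> [W oW H]; exists W => // k; apply: Ck_on_sub (H k) => // x.
by rewrite setIT => -[].
Qed.

End SmoothNear0.

(** * Pseudo-orbits *)

Section Orbits.
Variables (R : realType) (n q : nat) (q_gt0 : (0 < q)%N).
Variables (S N E T : 'M[R]_n) (k : nat).
Hypotheses (Su : S \in unitmx) (Nk : N ^+ k = 0) (SN : S *m N = N *m S).
Hypotheses (ES : E *m S = S *m E) (EN : E *m N = N *m E).
Hypotheses (SqE : (S ^+ q - 1%:M) *m E = 0).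
Hypothesis (ET : 1%:M - E = T *m (S ^+ q - 1%:M)).
Implicit Types (s : 'I_q -> 'cV[R]_n).

(* The average of the points S^-i s_i, projected to ker (S^q - 1); it is a left
   inverse of u |-> (S^i u)_i on that space. *)
Definition orbit_mean s : 'cV[R]_n :=
  q%:R^-1 *: \sum_(i < q) invmx S ^+ i *m (E *m s i).

Lemma orbit_mean_ext s s' : s =1 s' -> orbit_mean s = orbit_mean s'.
Proof. by move=> ss'; rewrite /orbit_mean; under eq_bigr do rewrite ss'. Qed.

Lemma orbit_meanD s s' : orbit_mean (fun i => s i + s' i) = orbit_mean s + orbit_mean s'.
Proof.
rewrite /orbit_mean -scalerDr -big_split; congr (_ *: _).
by apply: eq_bigr => i _; rewrite !mulmxDr.
Qed.

Lemma orbit_meanB s s' : orbit_mean (fun i => s i - s' i) = orbit_mean s - orbit_mean s'.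
Proof.
rewrite /orbit_mean -scalerBr -sumrB; congr (_ *: _).
by apply: eq_bigr => i _; rewrite !mulmxBr.
Qed.

Lemma expr_commute (X Y : 'M[R]_n) i : X *m Y = Y *m X -> X ^+ i *m Y = Y *m X ^+ i.
Proof.
move=> XY; elim: i => [|i IH]; first by rewrite expr0 mul1mx mulmx1.
by rewrite exprS -!mulmxE -mulmxA IH !mulmxA XY.
Qed.

Lemma inv_commute (X : 'M[R]_n) : X *m S = S *m X -> X *m invmx S = invmx S *m X.
Proof.
move=> XS; apply: (canRL (mulKmx Su)).
by rewrite mulmxA -XS mulmxK.
Qed.

Lemma orbit_mean_comm X s : X *m S = S *m X -> X *m E = E *m X ->
  orbit_mean (fun i => X *m s i) = X *m orbit_mean s.
Proof.
move=> XS XE; rewrite /orbit_mean -scalemxAr mulmx_sumr; congr (_ *: _).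
apply: eq_bigr => i _; have -> : E *m (X *m s i) = X *m (E *m s i) by rewrite !mulmxA XE.
by rewrite !mulmxA (expr_commute i (esym (inv_commute XS))).
Qed.

Lemma projE_idem : E *m E = E.
Proof.
have : (1%:M - E) *m E = 0 by rewrite ET -mulmxA SqE mulmx0.
by rewrite mulmxBl mul1mx => /subr0_eq.
Qed.

Lemma projE_id (u : 'cV[R]_n) : (E *m u = u) <-> (S ^+ q - 1%:M) *m u = 0.
Proof.
split=> [<-|H]; first by rewrite mulmxA SqE mul0mx.
have : (1%:M - E) *m u = 0 by rewrite ET -mulmxA H mulmx0.
by rewrite mulmxBl mul1mx => /subr0_eq.
Qed.

Lemma exprq_projE : S ^+ q *m E = E.
Proof. by have := SqE; rewrite mulmxBl mul1mx => /subr0_eq. Qed.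

Lemma invmx_exprK i : invmx S ^+ i *m S ^+ i = 1%:M.
Proof.
elim: i => [|i IH]; first by rewrite !expr0 mulmx1.
by rewrite exprSr exprS -!mulmxE mulmxA mulmxKV.
Qed.

Lemma invmx_exprqE : invmx S ^+ q *m E = E.
Proof. by rewrite -{1}exprq_projE mulmxA invmx_exprK mul1mx. Qed.

(** On the range of E exponents count modulo q, which is what allows indices in ['I_q] to wrap
    around. *)
Lemma expr_modE (X : 'M[R]_n) i : X ^+ q *m E = E -> X ^+ (i %% q) *m E = X ^+ i *m E.
Proof.
move=> XqE; rewrite [in RHS](divn_eq i q) addnC exprD -mulmxE -mulmxA; congr (_ *m _).
rewrite mulnC exprM; elim: (i %/ q)%N => [|j IH]; first by rewrite expr0 mul1mx.
by rewrite exprSr -mulmxE -mulmxA XqE.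
Qed.

(** Reindexing by the cyclic shift leaves one factor S in each term; the wrapped term agrees because
    S^-q is the identity on the range of E. *)
Lemma orbit_mean_shift s : orbit_mean (fun i => s (ordS i)) = S *m orbit_mean s.
Proof.
rewrite /orbit_mean -scalemxAr mulmx_sumr; congr (_ *: _).
rewrite [RHS](reindex (@ordS q)) /=; last first.
  by apply: onW_bij; exists (@ord_pred q); [exact: ordSK|exact: ord_predK].
apply: eq_bigr => i _; rewrite !mulmxA -[S *m _ *m E]mulmxA.
by rewrite expr_modE ?invmx_exprqE // exprS -mulmxE !mulmxA mulmxV // mul1mx.
Qed.

Lemma orbit_mean_rot (u : 'cV[R]_n) : orbit_mean (fun i => S ^+ i *m u) = E *m u.
Proof.
rewrite /orbit_mean (eq_bigr (fun=> E *m u)); last first.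
  move=> i _; rewrite !mulmxA -[_ *m E *m _]mulmxA -(expr_commute i (esym ES)).
  by rewrite mulmxA invmx_exprK mul1mx.
by rewrite sumr_const card_ord -[E *m u *+ q]scaler_nat scalerA mulVf ?scale1r // pnatr_eq0 -lt0n.
Qed.

Lemma projE_orbit_mean s : E *m orbit_mean s = orbit_mean s.
Proof.
rewrite -orbit_mean_comm //; rewrite /orbit_mean; congr (_ *: _).
by apply: eq_bigr => i _; rewrite !mulmxA -[_ *m E *m E]mulmxA projE_idem.
Qed.

Lemma orbit_rot_shift (u : 'cV[R]_n) (i : 'I_q) : E *m u = u ->
  S ^+ (ordS i) *m u = S *m (S ^+ i *m u).
Proof.
move=> Eu; rewrite -Eu !mulmxA /= expr_modE ?exprq_projE //.
by rewrite exprS -mulmxE.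
Qed.

Lemma iter_ordS j (i : 'I_q) : iter j (@ordS q) i = ((i + j) %% q)%N :> nat.
Proof.
elim: j => [|j IH]; first by rewrite addn0 modn_small.
by rewrite iterS /= IH -addn1 modnDml -addnA addn1.
Qed.

(* The powers of N kill the orbit one after the other, from N^k = 0 down to
   N^0: an orbit killed by N is an orbit of S, hence u, S u, S^2 u, ... with
   u in the range of E, and u is then its own mean. *)
Lemma orbit_injective s : (forall i, (S + N) *m s i = s (ordS i)) ->
  orbit_mean s = 0 -> forall i, s i = 0.
Proof.
move=> sS m0.
suff H j : (j <= k)%N -> forall i, N ^+ (k - j) *m s i = 0.
  by move=> i; have := H k (leqnn k) i; rewrite subnn expr0 mul1mx.
elim: j => [_ i|j IH jk]; first by rewrite subn0 Nk mul0mx.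
pose x i := N ^+ (k - j.+1) *m s i.
have Nx i : N *m x i = 0.
  rewrite /x mulmxA mulmxE -exprS -subSn // subSS; apply: IH; exact: ltnW.
have Sx i : S *m x i = x (ordS i).
  have NN : N ^+ (k - j.+1) *m (N *m s i) = 0.
    by rewrite mulmxA mulmxE -exprSr exprS -mulmxE -mulmxA; exact: Nx.
  rewrite /x -sS mulmxDl mulmxDr NN addr0 !mulmxA.
  by rewrite (expr_commute _ (esym SN)).
have Six j' i : S ^+ j' *m x i = x (iter j' (@ordS q) i).
  elim: j' => [|j' IH']; first by rewrite expr0 mul1mx.
  by rewrite exprS -mulmxE -mulmxA IH' Sx.
have Ex i : E *m x i = x i.
  apply/projE_id; rewrite mulmxBl mul1mx Six; apply/eqP; rewrite subr_eq0; apply/eqP.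
  by congr x; apply: ord_inj; rewrite iter_ordS modnDr modn_small.
have xm : orbit_mean x = 0.
  rewrite orbit_mean_comm ?m0 ?mulmx0 //.
    by apply: expr_commute; exact: esym.
  by apply: expr_commute; exact: esym.
pose i0 := Ordinal q_gt0.
have xi i : x i = S ^+ i *m x i0.
  rewrite Six; congr x; apply: ord_inj.
  by rewrite iter_ordS add0n modn_small.
have x0 : x i0 = 0.
  by rewrite -xm (orbit_mean_ext xi) orbit_mean_rot Ex.
by move=> i; rewrite -/(x i) xi x0 mulmx0.
Qed.

Variables (m : nat) (f : 'cV[R]_n * 'cV[R]_m -> 'cV[R]_n).
Hypotheses (fs : smooth0mx f) (f0 : \forall l \near (0 : 'cV[R]_m), f (0, l) = 0).
Hypothesis (fD : forall v, deriv0mx f (v, 0) ((S + N) *m v)).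

(* The defects f (s_i) - s_(i+1) of the pseudo-orbit s form a sequence (S^i d)_i,
   where d is then necessarily their mean, and s itself has mean E u. *)
Definition orbit_eqn s (u : 'cV[R]_n) (l : 'cV[R]_m) : Prop :=
  orbit_mean s = E *m u /\
  forall i, f (s i, l) - s (ordS i) =
    S ^+ i *m orbit_mean (fun j => f (s j, l) - s (ordS j)).

(** [implicit_function] solves for a single row vector, so the q columns of a sequence are flattened
    into one; under the sup norm, smallness of the vector is smallness of every point. *)
Let orb (y : 'rV[R]_(n * q)) (i : 'I_q) : 'cV[R]_n := col i (vec_mx y).
Let vec s : 'rV[R]_(n * q) := mxvec (\matrix_(a, i) s i a 0).

Let orbE y i a : orb y i a 0 = y 0 (mxvec_index a i).
Proof. by rewrite !mxE. Qed.

Let vecE s i a : vec s 0 (mxvec_index a i) = s i a 0.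
Proof. by rewrite mxvecE mxE. Qed.

Let vecK s i : orb (vec s) i = s i.
Proof. by apply/colP => a; rewrite orbE vecE. Qed.

Let orb_inj y y' : (forall i, orb y i = orb y' i) -> y = y'.
Proof.
move=> H; apply/rowP => j; case/mxvec_indexP: j => a i.
by rewrite -!orbE H.
Qed.

Let orb_norm y (r : R) : 0 <= r -> (`|y| <= r <-> forall i, `|orb y i| <= r).
Proof.
move=> r0; split=> H.
  move=> i; apply: mx_norm_le => // a b; rewrite ord1 orbE.
  exact: le_trans (mx_coord_le _ _ _) H.
apply: mx_norm_le => // a j; rewrite ord1; case/mxvec_indexP: j => b i.
by rewrite -orbE; apply: le_trans (mx_coord_le _ _ _) (H i).
Qed.

(** The defects with their component along (S^i d)_i removed, plus the mean condition reinserted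
    along that same family. This makes a square system, and the two parts lie in complementary
    subspaces. *)
Let res (z : 'rV[R]_(n * q) * ('cV[R]_n * 'cV[R]_m)) (i : 'I_q) : 'cV[R]_n :=
  f (orb z.1 i, z.2.2) - orb z.1 (ordS i)
  - S ^+ i *m orbit_mean (fun j => f (orb z.1 j, z.2.2) - orb z.1 (ordS j))
  + S ^+ i *m (orbit_mean (orb z.1) - E *m z.2.1).

Let resD (w : 'rV[R]_(n * q)) (v : 'cV[R]_n) (i : 'I_q) : 'cV[R]_n :=
  (S + N) *m orb w i - orb w (ordS i)
  - S ^+ i *m orbit_mean (fun j => (S + N) *m orb w j - orb w (ordS j))
  + S ^+ i *m (orbit_mean (orb w) - E *m v).

(** Taking the mean of the equation kills the first difference and leaves [c]. *)
Let splitE (x : 'I_q -> 'cV[R]_n) (c : 'cV[R]_n) : E *m c = c ->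
  (forall i, x i - S ^+ i *m orbit_mean x + S ^+ i *m c = 0) <->
  (c = 0 /\ forall i, x i = S ^+ i *m orbit_mean x).
Proof.
move=> Ec; split=> [H|[-> H] i]; last by rewrite -H subrr mulmx0 addr0.
have c0 : c = 0.
  have := orbit_mean_ext H; rewrite orbit_meanD orbit_meanB.
  rewrite !orbit_mean_rot projE_orbit_mean subrr add0r Ec => ->.
  by rewrite /orbit_mean big1 ?scaler0 // => i _; rewrite !mulmx0.
split=> // i; have := H i; rewrite c0 mulmx0 addr0 => /subr0_eq.
by [].
Qed.

Let Ediff s u : E *m (orbit_mean s - E *m u) = orbit_mean s - E *m u.
Proof. by rewrite mulmxBr projE_orbit_mean mulmxA projE_idem. Qed.

Let resP z : (forall i, res z i = 0) <-> orbit_eqn (orb z.1) z.2.1 z.2.2.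
Proof.
rewrite /res (splitE _ (Ediff _ _)) /orbit_eqn.
split=> -[H1 H2]; split=> //; first by apply/subr0_eq.
by rewrite H1 subrr.
Qed.

(** The mean of [w] is E v, so its defects have mean N E v and coincide with those of the sequence
    S^i E v. The difference of the two sequences is an orbit of S + N with mean zero, hence zero.
    The case v = 0 is the injectivity that [implicit_function] asks for; general v yields the
    derivative of its solution. *)
Let resDP w v : (forall i, resD w v i = 0) -> forall i, orb w i = S ^+ i *m (E *m v).
Proof.
rewrite /resD (splitE _ (Ediff _ _)) => -[/subr0_eq mw H].
have mN : orbit_mean (fun j => (S + N) *m orb w j - orb w (ordS j)) = N *m (E *m v).
  rewrite orbit_meanB orbit_mean_comm ?orbit_mean_shift ?mw.
  - by rewrite mulmxDl addrC addKr.
  - by rewrite mulmxDr mulmxDl SN.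
  - by rewrite mulmxDr mulmxDl ES EN.
have EEv : E *m (E *m v) = E *m v by rewrite mulmxA projE_idem.
have H' i : (S + N) *m orb w i - orb w (ordS i) = S ^+ i *m (N *m (E *m v)).
  by rewrite H mN.
have key := @orbit_injective (fun i => orb w i - S ^+ i *m (E *m v)).
move=> i; apply/subr0_eq; apply: key => {i}.
  move=> i; rewrite orbit_rot_shift // mulmxBr.
  have -> : (S + N) *m orb w i = orb w (ordS i) + S ^+ i *m (N *m (E *m v)).
    by rewrite -H' [RHS]addrC subrK.
  rewrite mulmxDl -addrA; congr (_ + _).
  have -> : S ^+ i *m (N *m (E *m v)) = N *m (S ^+ i *m (E *m v)).
    by rewrite !mulmxA (expr_commute i SN).
  by rewrite opprD addrCA subrr addr0.
by rewrite orbit_meanB orbit_mean_rot mw EEv subrr.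
Qed.

Let P := ('rV[R]_(n * q) * ('cV[R]_n * 'cV[R]_m))%type.
Let KP := coords_prod (coords_mx R n 1) (coords_mx R m 1).
Let K := coords_prod (coords_mx R 1 (n * q)) KP.

Lemma smooth0mx_orbit_mean (F : normedModType R) (g : 'I_q -> F -> 'cV[R]_n) :
  (forall i, smooth0mx (g i)) -> smooth0mx (fun x => orbit_mean (fun i => g i x)).
Proof.
move=> gs; apply: smooth0mx_scale; apply: smooth0mx_sum => i.
by apply: smooth0mx_mul; apply: smooth0mx_mul; exact: gs.
Qed.

Lemma deriv0mx_orbit_mean (F : normedModType R) (g : 'I_q -> F -> 'cV[R]_n) v D :
  (forall i, deriv0mx (g i) v (D i)) ->
  deriv0mx (fun x => orbit_mean (fun i => g i x)) v (orbit_mean D).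
Proof.
move=> gs; apply: deriv0mx_scale; apply: deriv0mx_sum => i.
by apply: deriv0mx_mul; apply: deriv0mx_mul; exact: gs.
Qed.

Let orbZ c y i : orb (c *: y) i = c *: orb y i.
Proof. by apply/colP => a; rewrite !mxE. Qed.

Let orb0 i : orb 0 i = 0.
Proof. by apply/colP => a; rewrite !mxE. Qed.

Let orb_smooth i : smooth0mx (fun z : P => orb z.1 i).
Proof.
move=> a b; rewrite ord1; apply: smooth0_linear.
- by move=> x y; rewrite !mxE.
- by move=> c x; rewrite !mxE.
- move=> x; rewrite orbE; apply: le_trans (mx_coord_le _ _ _) _.
  exact: fst_norm_le.
Qed.

Let orb_deriv i w : deriv0mx (fun z : P => orb z.1 i) w (orb w.1 i).
Proof.
by move=> a b; apply: is_derive_line => h; rewrite /= !addr0 orb0 orbZ !mxE subr0.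
Qed.

Let par_smooth : smooth0mx (fun z : P => z.2.2).
Proof.
move=> a b; apply: smooth0_linear.
- by move=> x y; rewrite !mxE.
- by move=> c x; rewrite !mxE.
- move=> x; apply: le_trans (mx_coord_le _ _ _) _.
  by apply: le_trans (snd_norm_le _) _; exact: snd_norm_le.
Qed.

Let var_smooth : smooth0mx (fun z : P => z.2.1).
Proof.
move=> a b; apply: smooth0_linear.
- by move=> x y; rewrite !mxE.
- by move=> c x; rewrite !mxE.
- move=> x; apply: le_trans (mx_coord_le _ _ _) _.
  by apply: le_trans (fst_norm_le _) _; exact: snd_norm_le.
Qed.

Let par_deriv w : deriv0mx (fun z : P => z.2.2) w w.2.2.
Proof. by move=> i j; apply: is_derive_line => h; rewrite !mxE /= addr0 subr0. Qed.

Let var_deriv w : deriv0mx (fun z : P => z.2.1) w w.2.1.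
Proof. by move=> i j; apply: is_derive_line => h; rewrite !mxE /= addr0 subr0. Qed.

Let fy_smooth i : smooth0mx (fun z : P => f (orb z.1 i, z.2.2)).
Proof. by apply: smooth0mx_comp => //; exact: orb0. Qed.

Let fy_deriv i w v : deriv0mx (fun z : P => f (orb z.1 i, z.2.2)) (w, (v, 0))
  ((S + N) *m orb w i).
Proof.
apply: (@deriv0mx_comp _ _ _ _ _ _ _ _ _ _ (orb w i) 0) => //.
Qed.

Let res_smooth i : smooth0mx (fun z => res z i).
Proof.
apply: smooth0mx_add.
  apply: smooth0mx_sub; first by apply: smooth0mx_sub.
  by apply: smooth0mx_mul; apply: smooth0mx_orbit_mean => j; apply: smooth0mx_sub.
apply: smooth0mx_mul; apply: smooth0mx_sub; first exact: smooth0mx_orbit_mean.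
exact: smooth0mx_mul.
Qed.

Let res_deriv i w v : deriv0mx (fun z => res z i) (w, (v, 0)) (resD w v i).
Proof.
apply: deriv0mx_add.
  apply: deriv0mx_sub.
    by apply: deriv0mx_sub; [exact: fy_deriv|exact: (orb_deriv _ (w, (v, 0)))].
  apply: deriv0mx_mul; apply: deriv0mx_orbit_mean => j; apply: deriv0mx_sub.
    exact: fy_deriv.
  exact: (orb_deriv _ (w, (v, 0))).
apply: deriv0mx_mul; apply: deriv0mx_sub.
  by apply: deriv0mx_orbit_mean => j; exact: (orb_deriv _ (w, (v, 0))).
by apply: deriv0mx_mul; exact: (var_deriv (w, (v, 0))).
Qed.

Let f00 : f (0, 0) = 0.
Proof. exact: (nbhs_singleton f0). Qed.

Let res0 l : f (0, l) = 0 -> forall i, res (0, (0, l)) i = 0.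
Proof.
move=> fl; apply/resP; split=> /=.
  by rewrite mulmx0 /orbit_mean big1 ?scaler0 // => j _; rewrite orb0 !mulmx0.
have e1 : orbit_mean (fun j => f (orb 0 j, l) - orb 0 (ordS j)) = 0.
  by rewrite /orbit_mean big1 ?scaler0 // => j _; rewrite !orb0 fl subrr !mulmx0.
by move=> j; rewrite e1 mulmx0 !orb0 fl subrr.
Qed.

(** [u] ranges over the whole space, although only E u enters the equation, so that the solution is
    smooth on an open set. It vanishes at u = 0 by uniqueness, the zero sequence being a
    solution. *)
Lemma orbit_reduction : exists ys : 'I_q -> 'cV[R]_n * 'cV[R]_m -> 'cV[R]_n,
  exists r : R, [/\ 0 < r, (forall i, smooth0mx (ys i)),
    (forall i v, deriv0mx (ys i) (v, 0) (S ^+ i *m (E *m v))),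
    (forall i l, `|l| < r -> ys i (0, l) = 0) &
    [/\ forall u l, `|u| < r -> `|l| < r -> orbit_eqn (fun i => ys i (u, l)) u l &
        forall s u l, `|u| < r -> `|l| < r -> (forall i, `|s i| <= r) ->
          orbit_eqn s u l -> forall i, s i = ys i (u, l)]].
Proof.
pose G (z : P) := vec (res z).
have [r0 r00 Hr0] : exists2 r : R, 0 < r & forall j k,
    Ck [set x | `|x| < r] k (fun z => G z 0 j).
  have Gs : smooth0mx G.
    move=> a j; rewrite ord1; case/mxvec_indexP: j => b i.
    by under eq_fun do rewrite vecE; exact: res_smooth.
  by have [r r0 H] := smooth0mx_radius Gs; exists r => // j k'; exact: H.
have GD w v a i : is_derive (0 : P) (w, (v, 0)) (fun z => G z 0 (mxvec_index a i))
    (resD w v i a 0).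
  by under eq_fun do rewrite vecE; exact: res_deriv.
have [|||||ys [r [s [r1 s1 ys0 ysC [ysP ysU ysD]]]]] :=
  @implicit_function R (n * q) _ KP G [set x | `|x| < r0].
- exact: open_norm_lt.
- by rewrite /= normr0.
- apply/rowP => j; case/mxvec_indexP: j => a i.
  by rewrite vecE (res0 f00 i : res 0 i = 0) !mxE.
- exact: Hr0.
- move=> w H; apply: orb_inj => i; rewrite orb0.
  rewrite (@resDP w 0) ?mulmx0 // => j; apply/colP => a; rewrite [RHS]mxE.
  by rewrite -(H (mxvec_index a j)) (@derive_val _ _ _ _ _ _ _ (GD w 0 a j)).
have [d d0 Hd] := (nbhs0_dist _).1 f0.
exists (fun i p => orb (ys p) i), (Num.min d (Num.min r s)); split.
- by rewrite !lt_min d0 r1.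
- move=> i a b; rewrite ord1; under eq_fun do rewrite orbE.
  by exists s.
- move=> i v a b; rewrite ord1; under eq_fun do rewrite orbE.
  have sm j : smooth0 (fun p => ys p 0 j) by exists s.
  have dy j := smooth0_derive KP (v, 0) (sm j).
  have := ysD (v, 0); set w := \row__ _ => Hw.
  have : forall j, resD w v j = 0.
    move=> j; apply/colP => c; rewrite [RHS]mxE -(Hw (mxvec_index c j)).
    by rewrite (@derive_val _ _ _ _ _ _ _ (GD w v c j)).
  move/resDP => /(_ i) <-; rewrite orbE /w mxE; exact: dy.
- move=> i l; rewrite !lt_min => /and3P[ld lr ls].
  have pl : `|((0 : 'cV[R]_n), l)| < s by apply: pair_norm_ltI; rewrite ?normr0.
  rewrite -(ysU (0, l) 0 pl) ?orb0 ?normr0 ?ltW //.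
  apply/rowP => j; case/mxvec_indexP: j => a j; rewrite vecE [RHS]mxE.
  by rewrite res0 ?mxE //; exact: Hd.
- split.
    move=> u l; rewrite !lt_min => /and3P[_ _ us] /and3P[_ _ ls].
    have pl : `|(u, l)| < s by exact: pair_norm_ltI.
    have [_ Gy] := ysP _ pl.
    apply/(resP (ys (u, l), (u, l))) => i; apply/colP => a.
    by rewrite -vecE [LHS](congr1 (fun g : 'rV_ _ => g 0 _) Gy) !mxE.
  move=> t u l; rewrite !lt_min => /and3P[_ _ us] /and3P[_ _ ls] tr Ht i.
  have pl : `|(u, l)| < s by exact: pair_norm_ltI.
  rewrite -(vecK t i); congr (orb _ i); apply: ysU => //.
    apply/orb_norm; first exact: ltW.
    by move=> j; rewrite vecK; apply: le_trans (tr j) _; rewrite !ge_min lexx orbT.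
  have Ht' : orbit_eqn (orb (vec t)) u l.
    have [H1 H2] := Ht; split; first by rewrite -H1; exact: orbit_mean_ext (vecK t).
    move=> j; rewrite !vecK H2; congr (_ *m _); apply: orbit_mean_ext => b.
    by rewrite !vecK.
  have H := (resP (vec t, (u, l))).2 Ht'.
  by apply/rowP => j; case/mxvec_indexP: j => a j; rewrite vecE H !mxE.
Qed.

End Orbits.

Lemma near_all (R : realType) (E : normedModType R) (x : E) (I : finType)
    (Q : I -> E -> Prop) : (forall i, \forall y \near x, Q i y) ->
  \forall y \near x, forall i, Q i y.
Proof. exact: filter_forall. Qed.

Lemma iter_ord_cycle (X : Type) q (h : X -> X) (x : X) :
  iter q h x = x -> forall i : 'I_q, iter (ordS i) h x = h (iter i h x).
Proof.
move=> per i /=; have := ltn_ord i; rewrite leq_eqVlt => /orP[/eqP iq|iq].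
  have per' : iter i.+1 h x = x by rewrite iq.
  have -> : (i.+1 %% q = 0)%N by rewrite iq modnn.
  exact: esym per'.
by rewrite modn_small.
Qed.

Lemma iter_cycle (X : Type) q (q_gt0 : (0 < q)%N) (h : X -> X) (s : 'I_q -> X) :
  (forall i, h (s i) = s (ordS i)) ->
  iter q h (s (Ordinal q_gt0)) = s (Ordinal q_gt0).
Proof.
move=> hs.
have H j : iter j h (s (Ordinal q_gt0)) = s (iter j (@ordS q) (Ordinal q_gt0)).
  by elim: j => //= j ->; rewrite hs.
by rewrite H; congr s; apply: ord_inj; rewrite iter_ordS modnDr mod0n.
Qed.

(** * Neighbourhoods of the origin, iterates and local inverses *)

Section Nearness.
Variables (R : realType) (n m : nat).
Local Notation P := ('cV[R]_n * 'cV[R]_m)%type.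

Lemma smooth0mx_near (F : normedModType R) a b (h : F -> 'M[R]_(a, b)) (r : R) :
  smooth0mx h -> h 0 = 0 -> 0 < r -> \forall p \near (0 : F), `|h p| < r.
Proof.
move=> hs h0 r0.
have hc : {for 0, continuous h}.
  apply: (coords_continuous (K := coords_mx R a b)) => i.
  by apply: (@smooth0_continuous _ _ (fun y => cc i (h y))); exact: hs.
have := hc; rewrite /prop_for /continuous_at h0 => /cvgrPdist_lt /(_ r r0).
by apply: filterS => x; rewrite sub0r normrN.
Qed.

Lemma near_app (Q : P -> Prop) (h : P -> 'cV[R]_n) : smooth0mx h -> h 0 = 0 ->
  (\forall p \near (0 : P), Q p) -> \forall p \near (0 : P), Q (h p, p.2).
Proof.
move=> hs h0 /nbhs0_dist[d d0 Hd].
have H1 := smooth0mx_near hs h0 d0.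
have H2 : \forall p \near (0 : P), `|p| < d by apply/nbhs0_dist; exists d.
apply: filterS2 H1 H2 => p h1 h2; apply: Hd; apply: pair_norm_ltI => //.
exact: le_lt_trans (snd_norm_le _) h2.
Qed.

(** The common bound [C] gives one neighbourhood valid for all g simultaneously. *)
Lemma near_act (I : Type) (rho : I -> 'M[R]_n) (C : R) (Q : P -> Prop)
    (h : P -> 'cV[R]_n) : (forall g (u : 'cV[R]_n), `|rho g *m u| <= C * `|u|) ->
  smooth0mx h -> h 0 = 0 ->
  (\forall p \near (0 : P), Q p) -> \forall p \near (0 : P), forall g, Q (rho g *m h p, p.2).
Proof.
move=> HC hs h0 /nbhs0_dist[d d0 Hd].
have C0 : 0 < `|C| + 1 by rewrite ltr_wpDl.
have H1 := smooth0mx_near hs h0 (divr_gt0 d0 C0).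
have H2 : \forall p \near (0 : P), `|p| < d by apply/nbhs0_dist; exists d.
apply: filterS2 H1 H2 => p h1 h2 g; apply: Hd; apply: pair_norm_ltI => //; last first.
  exact: le_lt_trans (snd_norm_le _) h2.
apply: le_lt_trans (HC g _) _.
apply: (@le_lt_trans _ _ ((`|C| + 1) * `|h p|)).
  by apply: ler_wpM2r => //; rewrite ler_wpDr // ler_norm.
by rewrite mulrC -ltr_pdivlMr.
Qed.

Lemma smooth0mx_iter (f : P -> 'cV[R]_n) i : smooth0mx f -> f 0 = 0 ->
  smooth0mx (fun p : P => iter i (fun y => f (y, p.2)) p.1) /\
  iter i (fun y => f (y, 0)) 0 = 0.
Proof.
move=> fs f0; elim: i => [|i [IH1 IH2]] /=; first by split=> //; exact: smooth0mx_fst.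
by split; [apply: smooth0mx_comp => //; exact: smooth0mx_snd|rewrite IH2].
Qed.

(** The implicit function theorem for f (y, l) - u = 0: existence makes the solution a right
    inverse, uniqueness makes it a left inverse. *)
Lemma local_inverse (A : 'M[R]_n) (f : P -> 'cV[R]_n) :
  A \in unitmx -> smooth0mx f -> f 0 = 0 ->
  (forall v, deriv0mx f (v, 0) (A *m v)) ->
  exists fV : P -> 'cV[R]_n, [/\ smooth0mx fV, fV 0 = 0,
    \forall p \near (0 : P), f (fV p, p.2) = p.1 &
    \forall p \near (0 : P), fV (f p, p.2) = p.1].
Proof.
move=> Au fs f0 fD.
pose KP := coords_prod (coords_mx R n 1) (coords_mx R m 1).
pose G (z : 'rV[R]_n * P) : 'rV[R]_n := (f (z.1^T, z.2.2) - z.2.1)^T.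
pose F (z : 'rV[R]_n * P) : 'cV[R]_n := f (z.1^T, z.2.2) - z.2.1.
have GE j : (fun z => G z 0 j) = (fun z => F z j 0).
  by apply/funext => z; rewrite /G mxE.
have ts : smooth0mx (fun z : 'rV[R]_n * P => z.1^T).
  move=> a b; apply: smooth0_linear.
  - by move=> x y; rewrite !mxE.
  - by move=> c x; rewrite !mxE.
  - move=> x; rewrite mxE; apply: le_trans (mx_coord_le _ _ _) _.
    exact: fst_norm_le.
have ls : smooth0mx (fun z : 'rV[R]_n * P => z.2.2).
  move=> a b; apply: smooth0_linear.
  - by move=> x y; rewrite !mxE.
  - by move=> c x; rewrite !mxE.
  - move=> x; apply: le_trans (mx_coord_le _ _ _) _.
    by apply: le_trans (snd_norm_le _) _; exact: snd_norm_le.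
have us : smooth0mx (fun z : 'rV[R]_n * P => z.2.1).
  move=> a b; apply: smooth0_linear.
  - by move=> x y; rewrite !mxE.
  - by move=> c x; rewrite !mxE.
  - move=> x; apply: le_trans (mx_coord_le _ _ _) _.
    by apply: le_trans (fst_norm_le _) _; exact: snd_norm_le.
have Fs : smooth0mx F.
  by apply: smooth0mx_sub => //; apply: smooth0mx_comp => //; exact: trmx0.
have FD w : deriv0mx F (w, 0) (A *m w^T).
  rewrite -[_ *m _]subr0; apply: deriv0mx_sub.
    apply: (@deriv0mx_comp _ _ _ _ _ _ _ _ _ _ w^T 0) => //.
    - exact: trmx0.
    - by move=> i j; apply: is_derive_line => h; rewrite !mxE /= !addr0 subr0.
    - by move=> i j; apply: is_derive_line => h; rewrite !mxE /= !addr0 subr0.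
  by move=> i j; apply: is_derive_line => h; rewrite !mxE /= !addr0 subr0.
have [r0 r00 Hr0] : exists2 r : R, 0 < r & forall j k,
    Ck [set x | `|x| < r] k (fun z => G z 0 j).
  have [r rr H] := smooth0mx_radius Fs; exists r => // j k.
  by rewrite GE; exact: H.
have [|||||ys [r [s [r1 s1 ys0 ysC [ysP ysU _]]]]] :=
  @implicit_function R n _ KP G [set x | `|x| < r0].
- exact: open_norm_lt.
- by rewrite /= normr0.
- by rewrite /G /= trmx0 -[(0, 0)]/(0 : P) f0 subr0 trmx0.
- exact: Hr0.
- move=> w H; have Aw : A *m w^T = 0.
    apply/colP => j; rewrite [RHS]mxE -(H j).
    by rewrite GE (@derive_val _ _ _ _ _ _ _ (FD w j 0)).
  by rewrite -[w]trmxK -[w^T](mulKmx Au) Aw mulmx0 trmx0.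
exists (fun p => (ys p)^T); split.
- by move=> i j; rewrite ord1; under eq_fun do rewrite mxE; exists s.
- by rewrite ys0 trmx0.
- apply/nbhs0_dist; exists s => // p ps; have [_ /(congr1 trmx)] := ysP p ps.
  by rewrite /G trmxK trmx0 => /subr0_eq.
have near1 := smooth0mx_near fs f0 s1.
have near2 : \forall p \near (0 : P), `|p| < Num.min s r.
  by apply/nbhs0_dist; exists (Num.min s r) => //; rewrite lt_min s1.
apply: filterS2 near1 near2 => -[u l] fps; rewrite lt_min => /andP[ps pr].
rewrite -(ysU (f (u, l), l) u^T) ?trmxK //.
- by apply: pair_norm_ltI => //; exact: le_lt_trans (snd_norm_le (u, l)) ps.
- apply: mx_norm_le; first exact: ltW.
  move=> i j; rewrite mxE; apply: le_trans (mx_coord_le _ _ _) _.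
  by apply: le_trans (fst_norm_le (u, l)) (ltW _).
- by rewrite /G /= trmxK subrr trmx0.
Qed.

End Nearness.

(** * Periodic points of maps commuting with S on the range of E *)

Section Rigidity.
Variables (R : realType) (n m q : nat) (q_gt0 : (0 < q)%N).
Variables (S N E T : 'M[R]_n) (k : nat).
Hypotheses (Su : S \in unitmx) (Nk : N ^+ k = 0) (SN : S *m N = N *m S).
Hypotheses (ES : E *m S = S *m E) (EN : E *m N = N *m E).
Hypotheses (SqE : (S ^+ q - 1%:M) *m E = 0).
Hypothesis (ET : 1%:M - E = T *m (S ^+ q - 1%:M)).
Variable f : 'cV[R]_n * 'cV[R]_m -> 'cV[R]_n.
Local Notation P := ('cV[R]_n * 'cV[R]_m)%type.
Hypotheses (fs : smooth0mx f) (f0 : \forall l \near (0 : 'cV[R]_m), f (0, l) = 0).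
Hypothesis fS : \forall p \near (0 : P), E *m p.1 = p.1 -> f (S *m p.1, p.2) = S *m f p.

Lemma near_commX j : \forall p \near (0 : P), E *m p.1 = p.1 ->
  f (S ^+ j *m p.1, p.2) = S ^+ j *m f p.
Proof.
elim: j => [|j IH].
  by apply/nbhs0_dist; exists 1 => // -[u l] _ _; rewrite expr0 !mul1mx.
have h : smooth0mx (fun p : P => S ^+ j *m p.1).
  by apply: smooth0mx_mul; exact: smooth0mx_fst.
have H := near_app h (mulmx0 _ _) fS.
apply: filterS2 IH H => -[u l] /= IH H Eu.
rewrite exprS -!mulmxE -!mulmxA H ?IH //.
by rewrite mulmxA -(expr_commute j (esym ES)) -mulmxA Eu.
Qed.

(** Commutation propagates f u = S u to f (S^j u) = S^(j+1) u, and S^q u = u. *)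
Lemma iter_rot : \forall p \near (0 : P), E *m p.1 = p.1 -> f p = S *m p.1 ->
  iter q (fun y => f (y, p.2)) p.1 = p.1.
Proof.
have : \forall p \near (0 : P), forall j : 'I_q, E *m p.1 = p.1 ->
  f (S ^+ j *m p.1, p.2) = S ^+ j *m f p.
  by apply: near_all => j; exact: near_commX.
apply: filterS => -[u l] /= H Eu fu.
suff Hj j : (j <= q)%N -> iter j (fun y => f (y, l)) u = S ^+ j *m u.
  by rewrite Hj // -{1}Eu mulmxA (exprq_projE SqE).
elim: j => [|j IH] jq; first by rewrite expr0 mul1mx.
rewrite iterS IH 1?ltnW // (H (Ordinal jq)) //= fu exprSr -mulmxE mulmxA.
by [].
Qed.

Hypothesis fE : \forall p \near (0 : P), E *m p.1 = p.1 -> E *m f p = f p.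
Hypothesis (fD : forall v, deriv0mx f (v, 0) ((S + N) *m v)).

(* The sequence of the S^i u, with u the mean of the orbit of x, solves the
   same reduced equation as the orbit, which has only one small solution. *)
Lemma periodic_rot : \forall p \near (0 : P),
  iter q (fun y => f (y, p.2)) p.1 = p.1 -> f p = S *m p.1.
Proof.
have [ys [r [r0 _ _ _ [_ ysU]]]] :=
  @orbit_reduction R n q q_gt0 S N E T k Su Nk SN ES EN SqE ET m f fs f0 fD.
have f00 : f 0 = 0 by exact: (nbhs_singleton f0).
pose o (p : P) (i : nat) := iter i (fun y => f (y, p.2)) p.1.
pose mo (p : P) := orbit_mean S E (fun i : 'I_q => o p i).
have os i : smooth0mx (fun p => o p i) by have [] := smooth0mx_iter i fs f00.
have o0 i : o 0 i = 0 by have [] := smooth0mx_iter i fs f00.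
have mos : smooth0mx mo by apply: smooth0mx_orbit_mean => i; exact: os.
have mo0 : mo 0 = 0.
  by rewrite /mo /orbit_mean big1 ?scaler0 // => i _; rewrite o0 !mulmx0.
have n1 : \forall p \near (0 : P), forall i : 'I_q, `|o p i| < r.
  by apply: near_all => i; exact: smooth0mx_near.
have n2 := smooth0mx_near mos mo0 r0.
have n3 : \forall p \near (0 : P), `|p| < r by apply/nbhs0_dist; exists r.
have n4 : \forall p \near (0 : P), forall i : 'I_q, `|S ^+ i *m mo p| < r.
  apply: near_all => i; apply: smooth0mx_near => //.
    exact: smooth0mx_mul.
  by rewrite mo0 mulmx0.
have n5 := near_app mos mo0 fE.
have n6 : \forall p \near (0 : P), forall j : 'I_q, E *m mo p = mo p ->
    f (S ^+ j *m mo p, p.2) = S ^+ j *m f (mo p, p.2).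
  by apply: near_all => j; exact: near_app mos mo0 (near_commX j).
near=> p => per.
have Em : E *m mo p = mo p by rewrite (projE_orbit_mean Su ES SqE ET).
have ld : `|p.2| < r.
  by apply: le_lt_trans (snd_norm_le p) _; near: p.
have md : `|mo p| < r by near: p.
have fm : E *m f (mo p, p.2) = f (mo p, p.2).
  by have := Em; near: p.
have oS (i : 'I_q) : o p (ordS i) = f (o p i, p.2).
  exact: (iter_ord_cycle per i).
have e1 : orbit_eqn S E f (fun i : 'I_q => o p i) (mo p) p.2.
  split; first by rewrite Em.
  move=> i; rewrite oS subrr.
  by rewrite /orbit_mean big1 ?scaler0 ?mulmx0 // => j _; rewrite oS subrr !mulmx0.
have rot i : f (S ^+ (i : 'I_q) *m mo p, p.2) - S ^+ (ordS i) *m mo p =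
    S ^+ i *m (f (mo p, p.2) - S *m mo p).
  have -> : f (S ^+ i *m mo p, p.2) = S ^+ i *m f (mo p, p.2).
    by move: i Em; near: p.
  rewrite (orbit_rot_shift SqE) // mulmxBr; congr (_ - _).
  by rewrite !mulmxA (expr_commute i (erefl : S *m S = S *m S)).
(* This sequence need not be an orbit: its defects are S^i (f (m) - S m), with m the mean, and [fE]
   places f (m) - S m in the range of E, so they are of the permitted form. *)
have e2 : orbit_eqn S E f (fun i : 'I_q => S ^+ i *m mo p) (mo p) p.2.
  split; first by rewrite (orbit_mean_rot q_gt0 Su ES).
  move=> i; rewrite (orbit_mean_ext _ _ rot) (orbit_mean_rot q_gt0 Su ES).
  rewrite rot; congr (_ *m _); rewrite mulmxBr fm; congr (_ - _).
  by rewrite mulmxA ES -mulmxA Em.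
have sE (i : 'I_q) : o p i = S ^+ i *m mo p.
  rewrite (ysU _ _ _ md ld _ e1) ?(ysU _ _ _ md ld _ e2) //.
    by move=> j; apply: ltW; move: j; near: p.
  by move=> j; apply: ltW; move: j; near: p.
pose i0 := Ordinal q_gt0.
have op : o p i0 = p.1 by [].
have := oS i0; rewrite op -surjective_pairing => <-.
by rewrite (sE (ordS i0)) (orbit_rot_shift SqE) // -(sE i0) op.
Unshelve. all: by end_near. Qed.

End Rigidity.

(** * Consequences of compactness of the group *)

Section CompactGroup.
Variables (R : realType) (G : topologicalGroupType) (G_compact : compact [set: G]).

(** If [|chi|] is maximal at c, then |chi (h c)| <= |chi c| with chi c nonzero forces |chi h| <= 1;
    applying this to g and to its inverse gives equality. *)
Lemma character_normr (chi : G -> R) : continuous_character chi ->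
  forall g, chi g = 1 \/ chi g = -1.
Proof.
move=> [c1 cM cc] g.
have [c _ Hc] : exists2 c, c \in [set: G] & forall t, t \in [set: G] -> `|chi t| <= `|chi c|.
  apply: (@compact_EVT_max _ _ (fun t => `|chi t|)) => //; first by exists 1%g.
  apply: continuous_subspaceT => t.
  by apply: continuous_comp; [exact: cc|exact: norm_continuous].
have c_ge1 : 1 <= `|chi c| by rewrite -(normr1 R) -c1; apply: Hc; rewrite inE.
have le1 h : `|chi h| <= 1.
  have := Hc (h * c)%g; rewrite inE cM normrM => /(_ I).
  by rewrite -[X in _ <= X]mul1r ler_pM2r // (lt_le_trans ltr01).
have gV : chi g * chi g^-1%g = 1 by rewrite -cM mulgV c1.
have : `|chi g| = 1.
  apply/eqP; rewrite eq_le le1 /=.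
  have <- : `|chi g| * `|chi g^-1%g| = 1 by rewrite -normrM gV normr1.
  by rewrite -[X in _ <= X]mulr1 ler_wpM2l.
by move/eqP; rewrite eqr_norml => /andP[/orP[]/eqP -> _]; [left|right].
Qed.

(** The group orbits of the finitely many basis vectors are compact, hence bounded. *)
Lemma action_bound n (rho : G -> 'M[R]_n) : continuous_linear_action rho ->
  exists C : R, forall g (u : 'cV[R]_n), `|rho g *m u| <= C * `|u|.
Proof.
move=> [_ _ rc]; pose K := coords_mx R n 1.
have H (i : cI K) : exists M : R, forall g, `|rho g *m ce i| <= M.
  have : compact [set rho g *m ce i | g in [set: G]].
    apply: continuous_compact => //; apply: continuous_subspaceT => g.
    apply: (@continuous_comp _ _ _ (fun g => (g, ce i)) (fun p => rho p.1 *m p.2)).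
      move=> A [[B1 B2] /= [HB1 HB2] sub]; apply: filterS HB1 => h Bh.
      by apply: sub; split=> //; exact: nbhs_singleton HB2.
    exact: rc.
  move=> /compact_bounded[M [_ HM]]; exists (M + 1) => g.
  by apply: (HM (M + 1)); [rewrite ltrDl|exists g].
have [M HM] := choice H.
exists (\sum_i M i) => g u.
rewrite {1}(cc_sum K u) mulmx_sumr; apply: le_trans (ler_norm_sum _ _ _) _.
rewrite mulr_suml; apply: ler_sum => i _.
rewrite -scalemxAr normrZ mulrC; apply: ler_pM => //; exact: cc_le.
Qed.

End CompactGroup.

Section Reversal.
Variables (q : nat) (q_gt0 : (0 < q)%N).

(** The reflection i |-> -i of Z/q; the reduction modulo q only acts at i = 0. *)
Definition ord_neg (i : 'I_q) : 'I_q := Ordinal (ltn_pmod (q - i) q_gt0).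

Lemma ord_negK : involutive ord_neg.
Proof.
move=> i; apply: ord_inj => /=; have iq := ltn_ord i.
have [->|i0] := posnP (val i); first by rewrite subn0 modnn subn0 modnn.
have h : (q - i < q)%N by rewrite ltn_subrL i0.
by rewrite (modn_small h) subKn ?modn_small // ltnW.
Qed.

Lemma ordS_neg i : ordS (ord_neg (ordS i)) = ord_neg i.
Proof.
apply: ord_inj => /=; have := ltn_ord i; rewrite leq_eqVlt => /orP[/eqP iq|iq].
  have -> : (i.+1 %% q = 0)%N by rewrite iq modnn.
  by rewrite subn0 modnn; congr (_ %% _)%N; lia.
have h : (q - i.+1 < q)%N by lia.
by rewrite (modn_small iq) (modn_small h); congr (_ %% _)%N; lia.
Qed.

End Reversal.

(** * The reduced map *)

Section Reduction.
Variables (R : realType) (n m q : nat) (q_gt0 : (0 < q)%N).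
Variables (S N E T : 'M[R]_n).
Hypotheses (Su : S \in unitmx) (SN : S *m N = N *m S).
Hypotheses (ES : E *m S = S *m E) (EN : E *m N = N *m E).
Hypotheses (SqE : (S ^+ q - 1%:M) *m E = 0).
Hypothesis (ET : 1%:M - E = T *m (S ^+ q - 1%:M)).
Local Notation P := ('cV[R]_n * 'cV[R]_m)%type.
Variable f : P -> 'cV[R]_n.
Hypotheses (fs : smooth0mx f) (f0 : \forall l \near (0 : 'cV[R]_m), f (0, l) = 0).
Hypothesis (fD : forall v, deriv0mx f (v, 0) ((S + N) *m v)).
Variables (ys : 'I_q -> P -> 'cV[R]_n) (r : R).
Hypotheses (r_gt0 : 0 < r) (yss : forall i, smooth0mx (ys i)).
Hypothesis ysD : forall i v, deriv0mx (ys i) (v, 0) (S ^+ i *m (E *m v)).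
Hypothesis ys0 : forall i l, `|l| < r -> ys i (0, l) = 0.
Hypothesis ysE : forall u l, `|u| < r -> `|l| < r ->
  orbit_eqn S E f (fun i => ys i (u, l)) u l.
Hypothesis ysU : forall s u l, `|u| < r -> `|l| < r -> (forall i, `|s i| <= r) ->
  orbit_eqn S E f s u l -> forall i, s i = ys i (u, l).

(* On ker (S^q - 1) the second term vanishes; it makes the map a local
   diffeomorphism of the whole space, with derivative S + N. *)
Definition reduced_map (p : P) : 'cV[R]_n :=
  orbit_mean S E (fun i => f (ys i p, p.2)) +
  (1%:M - E) *m ((S + N) *m p.1).

Let EE : E *m E = E. Proof. exact: projE_idem SqE ET. Qed.

Let Emean (s : 'I_q -> 'cV[R]_n) : E *m orbit_mean S E s = orbit_mean S E s.
Proof. by rewrite (projE_orbit_mean Su ES SqE ET). Qed.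

Let mean_rot (u : 'cV[R]_n) : orbit_mean S E (fun i : 'I_q => S ^+ i *m u) = E *m u.
Proof. exact: orbit_mean_rot. Qed.

Let f00 : f 0 = 0.
Proof. exact: (nbhs_singleton f0). Qed.

Let ys00 i : ys i 0 = 0.
Proof. by apply: ys0; rewrite normr0. Qed.

Let fys_smooth i : smooth0mx (fun p => f (ys i p, p.2)).
Proof. by apply: smooth0mx_comp => //; exact: smooth0mx_snd. Qed.

Lemma reduced_map_smooth : smooth0mx reduced_map.
Proof.
apply: smooth0mx_add; first exact: smooth0mx_orbit_mean.
by apply: smooth0mx_mul; apply: smooth0mx_mul; exact: smooth0mx_fst.
Qed.

Lemma reduced_map_deriv v : deriv0mx reduced_map (v, 0) ((S + N) *m v).
Proof.
have AE : (S + N) *m E = E *m (S + N) by rewrite mulmxDr mulmxDl ES EN.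
have -> : (S + N) *m v =
    orbit_mean S E (fun i : 'I_q => (S + N) *m (S ^+ i *m (E *m v))) +
    (1%:M - E) *m ((S + N) *m v).
  rewrite orbit_mean_comm ?mean_rot //; last by rewrite mulmxDl mulmxDr SN.
  by rewrite (mulmxA E E) EE mulmxBl mul1mx (mulmxA E) -AE -mulmxA [RHS]addrC subrK.
apply: deriv0mx_add.
  apply: deriv0mx_orbit_mean => i.
  apply: (@deriv0mx_comp _ _ _ _ _ _ _ _ _ _ (S ^+ i *m (E *m v)) 0) => //.
  exact: (@deriv0mx_snd _ _ _ (v, 0)).
by apply: deriv0mx_mul; apply: deriv0mx_mul; exact: (@deriv0mx_fst _ _ _ (v, 0)).
Qed.

Lemma reduced_map0 : \forall l \near (0 : 'cV[R]_m), reduced_map (0, l) = 0.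
Proof.
have lr : \forall l \near (0 : 'cV[R]_m), `|l| < r by apply/nbhs0_dist; exists r.
apply: filterS2 lr f0 => l lr fl.
rewrite /reduced_map /= !mulmx0 addr0 /orbit_mean big1 ?scaler0 // => i _.
by rewrite ys0 // fl !mulmx0.
Qed.

Lemma reduced_mapE u l : E *m u = u ->
  reduced_map (u, l) = orbit_mean S E (fun i => f (ys i (u, l), l)).
Proof.
move=> Eu; rewrite /reduced_map /= mulmxA.
have -> : (1%:M - E) *m (S + N) *m u = 0.
  rewrite mulmxBl mul1mx [E *m _]mulmxDr ES EN -mulmxDl mulmxBl -mulmxA Eu subrr.
  by [].
by rewrite addr0.
Qed.

Lemma reduced_map_range p : E *m p.1 = p.1 -> E *m reduced_map p = reduced_map p.
Proof. by case: p => u l /= Eu; rewrite reduced_mapE. Qed.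

(** The complementary component evolves linearly and on its own, which later shows that the inverse
    preserves U. *)
Lemma reduced_map_compl p : (1%:M - E) *m reduced_map p = (S + N) *m ((1%:M - E) *m p.1).
Proof.
rewrite /reduced_map mulmxDr mulmxBl mul1mx Emean subrr add0r !mulmxA; congr (_ *m _).
have -> : (1%:M - E) *m (1%:M - E) = 1%:M - E.
  by rewrite mulmxBr mulmx1 mulmxBl mul1mx EE subrr subr0.
by rewrite mulmxBl mulmxBr mul1mx mulmx1 mulmxDr mulmxDl ES EN.
Qed.

(** Symmetries and periodicity statements reduce to this: it suffices to exhibit a small sequence
    with the right mean and defects, and the value of the reduced map can be read off the
    defects. *)
Lemma reduced_map_unique s u u' l : `|u| < r -> `|l| < r ->
  (forall i, `|s i| <= r) -> E *m u = u -> E *m u' = u' ->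
  orbit_mean S E s = u ->
  (forall i, f (s i, l) - s (ordS i) = S ^+ i *m (u' - S *m u)) ->
  (forall i, s i = ys i (u, l)) /\ reduced_map (u, l) = u'.
Proof.
move=> ur lr sr Eu Eu' su H.
have Ed : E *m (u' - S *m u) = u' - S *m u.
  by rewrite mulmxBr Eu' mulmxA ES -mulmxA Eu.
have e : orbit_eqn S E f s u l.
  split; first by rewrite Eu.
  by move=> i; rewrite (orbit_mean_ext _ _ H) mean_rot H Ed.
have sE := ysU ur lr sr e; split=> //.
rewrite reduced_mapE //.
have -> : orbit_mean S E (fun i => f (ys i (u, l), l)) =
    orbit_mean S E (fun i : 'I_q => S ^+ i *m (u' - S *m u) + s (ordS i)).
  by apply: orbit_mean_ext => i; rewrite -H subrK sE.
by rewrite orbit_meanD mean_rot Ed (orbit_mean_shift Su SqE) su subrK.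
Qed.

(** The shifted sequence has mean S u, so the mean d of the defects is the mean of the f (s_i) minus
    S u. This reconciles the definition as a mean with psi_r (u) = S_0 u + d. *)
Lemma reduced_orbit u l : `|u| < r -> `|l| < r -> E *m u = u ->
  orbit_mean S E (fun i => ys i (u, l)) = u /\
  forall i, f (ys i (u, l), l) - ys (ordS i) (u, l) =
    S ^+ i *m (reduced_map (u, l) - S *m u).
Proof.
move=> ur lr Eu; have [H1 H2] := ysE ur lr; rewrite Eu in H1; split=> // i.
rewrite H2 orbit_meanB (orbit_mean_shift Su SqE (fun i => ys i (u, l))).
by rewrite H1 reduced_mapE.
Qed.

Let near_r : \forall p \near (0 : P), `|p| < r.
Proof. by apply/nbhs0_dist; exists r. Qed.

Let near_u (h : P -> 'cV[R]_n) : smooth0mx h -> h 0 = 0 ->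
  \forall p \near (0 : P), `|h p| < r.
Proof. by move=> hs h0; exact: smooth0mx_near. Qed.

Let near_ys : \forall p \near (0 : P), forall i, `|ys i p| < r.
Proof. by apply: near_all => i; exact: near_u. Qed.

Lemma reduced_map_comm : \forall p \near (0 : P), E *m p.1 = p.1 ->
  reduced_map (S *m p.1, p.2) = S *m reduced_map p.
Proof.
have n1 : \forall p \near (0 : P), `|S *m p.1| < r.
  apply: near_u; last exact: mulmx0.
  by apply: smooth0mx_mul; exact: smooth0mx_fst.
near=> p => Eu.
have pr : `|p| < r by near: p.
have ur := le_lt_trans (fst_norm_le p) pr; have lr := le_lt_trans (snd_norm_le p) pr.
have sr : `|S *m p.1| < r by near: p.
have yr : forall i, `|ys i p| < r by near: p.
move: (p.1) (p.2) (surjective_pairing p) Eu ur lr sr => u l pE Eu ur lr sr.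
rewrite pE in yr *.
have [H1 H2] := reduced_orbit ur lr Eu.
have Ew := @reduced_map_range (u, l) Eu.
set w := reduced_map (u, l) in H2 Ew *.
have Ed : E *m (w - S *m u) = w - S *m u by rewrite mulmxBr Ew mulmxA ES -mulmxA Eu.
have ESx x : E *m x = x -> E *m (S *m x) = S *m x by move=> Ex; rewrite mulmxA ES -mulmxA Ex.
apply: (@reduced_map_unique (fun i => ys (ordS i) (u, l)) _ _ _ sr lr _ _ _ _ _).2.
- by move=> i; exact: ltW.
- exact: ESx.
- exact: ESx.
- by rewrite (orbit_mean_shift Su SqE (fun i => ys i (u, l))) H1.
- move=> i; rewrite H2 (orbit_rot_shift SqE) // -mulmxBr !mulmxA.
  by rewrite (expr_commute i (erefl : S *m S = S *m S)).
Unshelve. all: by end_near. Qed.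

(** The parameter u attached to a periodic point. It is defined at every point, so that it is a
    smooth germ and u is small when the point is. *)
Definition orbit_center (p : P) : 'cV[R]_n :=
  orbit_mean S E (fun i : 'I_q => iter i (fun y => f (y, p.2)) p.1).

Lemma orbit_center_smooth : smooth0mx orbit_center /\ orbit_center 0 = 0.
Proof.
split; last first.
  rewrite /orbit_center /orbit_mean big1 ?scaler0 // => i _.
  by rewrite (smooth0mx_iter i fs f00).2 !mulmx0.
by apply: smooth0mx_orbit_mean => i; have [] := smooth0mx_iter i fs f00.
Qed.

(** A closed orbit has zero defects, so [reduced_map_unique] applies with S u as the value at its
    center u. *)
Lemma periodic_reduced : \forall p \near (0 : P),
  iter q (fun y => f (y, p.2)) p.1 = p.1 ->
  [/\ E *m orbit_center p = orbit_center p,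
      reduced_map (orbit_center p, p.2) = S *m orbit_center p &
      p.1 = ys (Ordinal q_gt0) (orbit_center p, p.2)].
Proof.
have [cs c0] := orbit_center_smooth.
have n1 := near_u cs c0.
have n2 : \forall p \near (0 : P), forall i : 'I_q,
    `|iter i (fun y => f (y, p.2)) p.1| < r.
  by apply: near_all => i; have [h1 h2] := smooth0mx_iter i fs f00; exact: near_u h1 h2.
near=> p => per.
have pr : `|p| < r by near: p.
have lr := le_lt_trans (snd_norm_le p) pr.
have cr : `|orbit_center p| < r by near: p.
have Ec : E *m orbit_center p = orbit_center p by exact: Emean.
have [||||sE H] := @reduced_map_unique
  (fun i : 'I_q => iter i (fun y => f (y, p.2)) p.1) (orbit_center p)
  (S *m orbit_center p) p.2 cr lr _ Ec.
- by move=> i; apply: ltW; move: i; near: p.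
- by rewrite mulmxA ES -mulmxA Ec.
- by [].
- by move=> i; rewrite (iter_ord_cycle per i) !subrr mulmx0.
by split=> //; exact: (sE (Ordinal q_gt0)).
Unshelve. all: by end_near. Qed.

Lemma reduced_periodic u l : `|u| < r -> `|l| < r -> E *m u = u ->
  reduced_map (u, l) = S *m u ->
  iter q (fun y => f (y, l)) (ys (Ordinal q_gt0) (u, l)) = ys (Ordinal q_gt0) (u, l).
Proof.
move=> ur lr Eu Hu; have [_ H] := reduced_orbit ur lr Eu.
apply: (iter_cycle q_gt0 (s := fun i => ys i (u, l))) => i.
by apply/subr0_eq; rewrite H Hu subrr mulmx0.
Qed.

(** [X] stands for the operators of the group; in the next lemmas [D] selects the elements with chi
    g = 1 or those with chi g = -1. *)
Variables (I : Type) (X : I -> 'M[R]_n) (C : R).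
Hypothesis XC : forall g (u : 'cV[R]_n), `|X g *m u| <= C * `|u|.

Lemma reduced_map_equivariant (D : I -> Prop) :
  (forall g, D g -> X g *m S = S *m X g /\ X g *m E = E *m X g) ->
  (\forall p \near (0 : P), forall g, D g -> f (X g *m p.1, p.2) = X g *m f p) ->
  \forall p \near (0 : P), forall g, D g -> E *m p.1 = p.1 ->
    reduced_map (X g *m p.1, p.2) = X g *m reduced_map p.
Proof.
move=> XSE Xf.
have n1 : \forall p \near (0 : P), forall g, `|X g *m p.1| < r.
  have ru := near_u (@smooth0mx_fst R n _) (erefl : (0 : P).1 = 0).
  exact: (@near_act _ _ _ _ _ _ (fun p => `|p.1| < r) (fun p => p.1) XC (@smooth0mx_fst R n _) erefl ru).
have n2 : \forall p \near (0 : P), forall i : 'I_q, forall g, `|X g *m ys i p| < r.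
  apply: near_all => i.
  have ru := near_u (@smooth0mx_fst R n _) (erefl : (0 : P).1 = 0).
  exact: (@near_act _ _ _ _ _ _ (fun p => `|p.1| < r) (fun p => ys i p) XC (yss i) (ys00 i) ru).
have n3 : \forall p \near (0 : P), forall i : 'I_q, forall g, D g ->
    f (X g *m ys i p, p.2) = X g *m f (ys i p, p.2).
  by apply: near_all => i; exact: (near_app (yss i) (ys00 i) Xf).
near=> p => g Dg Eu.
have pr : `|p| < r by near: p.
have ur := le_lt_trans (fst_norm_le p) pr; have lr := le_lt_trans (snd_norm_le p) pr.
have sr : `|X g *m p.1| < r by move: g {Dg}; near: p.
have yr i : `|X g *m ys i p| < r by move: i g {Dg sr}; near: p.
have fX i : f (X g *m ys i p, p.2) = X g *m f (ys i p, p.2).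
  by move: i g Dg {sr yr}; near: p.
have [XS XE] := XSE g Dg.
move: (p.1) (p.2) (surjective_pairing p) Eu ur lr sr fX => u l pE Eu ur lr sr fX.
rewrite pE in yr fX *.
have [H1 H2] := reduced_orbit ur lr Eu.
have Ew := @reduced_map_range (u, l) Eu.
apply: (@reduced_map_unique (fun i => X g *m ys i (u, l)) _ _ _ sr lr _ _ _ _ _).2.
- by move=> i; exact: ltW.
- by rewrite mulmxA -XE -mulmxA Eu.
- by rewrite mulmxA -XE -mulmxA Ew.
- by rewrite (orbit_mean_comm Su _ XS XE) H1.
- move=> i; rewrite fX -mulmxBr H2 !mulmxA -(expr_commute i (esym XS)).
  by rewrite -!mulmxA mulmxBr !mulmxA XS.
Unshelve. all: by end_near. Qed.

Lemma expr_ord_neg (i : 'I_q) : S ^+ (ord_neg q_gt0 i) *m E = invmx S ^+ i *m E.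
Proof.
rewrite /= (expr_modE _ (exprq_projE SqE)) -[LHS]mul1mx -(invmx_exprK Su i).
rewrite -!mulmxA; congr (_ *m _); rewrite mulmxA mulmxE -exprD subnKC; last exact: ltnW.
exact: exprq_projE SqE.
Qed.

(* When X conjugates f to its inverse, the reflection i -> -i of the index
   replaces the orbit s_i by the orbit X f(s_{-i}). *)
Lemma reduced_map_reversible (D : I -> Prop) :
  (forall g, D g -> S *m X g *m S = X g /\ X g *m E = E *m X g) ->
  (\forall p \near (0 : P), forall g, D g -> f (X g *m f p, p.2) = X g *m p.1) ->
  \forall p \near (0 : P), forall g, D g -> E *m p.1 = p.1 ->
    reduced_map (X g *m reduced_map p, p.2) = X g *m p.1.
Proof.
move=> XSE Xf.
have ru := near_u (@smooth0mx_fst R n _) (erefl : (0 : P).1 = 0).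
have n1 : \forall p \near (0 : P), forall g, `|X g *m reduced_map p| < r.
  apply: (@near_act _ _ _ _ _ _ (fun p => `|p.1| < r) _ XC _ _ ru).
    exact: reduced_map_smooth.
  exact: (nbhs_singleton reduced_map0).
have n2 : \forall p \near (0 : P), forall i : 'I_q, forall g,
    `|X g *m f (ys i p, p.2)| < r.
  apply: near_all => i.
  apply: (@near_act _ _ _ _ _ _ (fun p => `|p.1| < r) _ XC (fys_smooth i) _ ru).
  by rewrite ys00.
have n3 : \forall p \near (0 : P), forall i : 'I_q, forall g, D g ->
    f (X g *m f (ys i p, p.2), p.2) = X g *m ys i p.
  by apply: near_all => i; exact: (near_app (yss i) (ys00 i) Xf).
near=> p => g Dg Eu.
have pr : `|p| < r by near: p.
have ur := le_lt_trans (fst_norm_le p) pr; have lr := le_lt_trans (snd_norm_le p) pr.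
have sr : `|X g *m reduced_map p| < r by move: g {Dg}; near: p.
have yr i : `|X g *m f (ys i p, p.2)| < r by move: i g {Dg sr}; near: p.
have fX i : f (X g *m f (ys i p, p.2), p.2) = X g *m ys i p.
  by move: i g Dg {sr yr}; near: p.
have [XS XE] := XSE g Dg.
move: (p.1) (p.2) (surjective_pairing p) Eu ur lr yr fX => u l pE Eu ur lr yr fX.
rewrite pE in sr yr fX *.
have [H1 H2] := reduced_orbit ur lr Eu.
have Ew := @reduced_map_range (u, l) Eu.
set w := reduced_map (u, l) in sr H2 Ew *; set x := X g in XS XE sr yr fX *.
have EX y : E *m y = y -> E *m (x *m y) = x *m y.
  by move=> Ey; rewrite mulmxA -XE -mulmxA Ey.
have xS i : x *m S ^+ i = invmx S ^+ i *m x.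
  elim: i => [|i IH]; first by rewrite !expr0 mulmx1 mul1mx.
  rewrite exprSr -mulmxE mulmxA IH exprSr -mulmxE -!mulmxA; congr (_ *m _).
  by rewrite -[in RHS]XS !mulmxA mulVmx // mul1mx.
pose d := w - S *m u.
have Ed : E *m d = d by rewrite mulmxBr Ew mulmxA ES -mulmxA Eu.
pose ng := ord_neg q_gt0.
have neg i y : E *m y = y -> invmx S ^+ (ng i) *m y = S ^+ i *m y.
  move=> <-; rewrite !mulmxA; congr (_ *m _).
  by rewrite -(expr_ord_neg (ng i)) /ng ord_negK.
apply: (@reduced_map_unique (fun i => x *m f (ys (ng i) (u, l), l)) _ _ _ sr lr _ _ _ _ _).2.
- by move=> i; exact: ltW.
- exact: EX.
- exact: EX.
(* Moving x across S^-i gives x S^i, and after i -> -i this is x S^-i on the range of E: the mean is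
   x w. *)
- rewrite /w reduced_mapE // /orbit_mean -scalemxAr mulmx_sumr; congr (_ *: _).
  rewrite [RHS](reindex_inj (can_inj (ord_negK q_gt0))) /=; apply: eq_bigr => i _.
  rewrite !mulmxA -(mulmxA _ E x) -XE mulmxA -xS; congr (_ *m _).
  by rewrite -!mulmxA -(expr_ord_neg (ng i)) /ng ord_negK.
(* With t_i = x f (s_(-i)): f (t_i) = x s_(-i), while t_(i+1) = x (s_(-i) + S^(-i-1) d). The defect
   is - x S^(-i-1) d = S^i (- S x d), and - S x d = x u - S x w because S x S = x. *)
- move=> i; rewrite fX.
  have -> : f (ys (ng (ordS i)) (u, l), l) = ys (ng i) (u, l) + S ^+ (ng (ordS i)) *m d.
    by rewrite /d -H2 addrC /ng ordS_neg subrK.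
  rewrite (mulmxDr x) opprD addNKr mulmxA xS -mulmxA neg; last exact: EX.
  rewrite (orbit_rot_shift SqE); last exact: EX.
  rewrite mulmxA -(expr_commute i (erefl : S *m S = S *m S)) -mulmxA -mulmxN.
  by congr (_ *m _); rewrite /d mulmxBr mulmxBr opprB !mulmxA XS.
Unshelve. all: by end_near. Qed.

End Reduction.

Section Symmetry.
Variables (R : realType) (n : nat).

Lemma mulmx_col_inj (A B : 'M[R]_n) : (forall v : 'cV[R]_n, A *m v = B *m v) -> A = B.
Proof.
move=> H; apply/matrixP => i j; have := H (delta_mx j 0).
by rewrite -!colE => /colP /(_ i); rewrite !mxE.
Qed.

Lemma commute_of_conj (X X' S : 'M[R]_n) : X' *m X = 1%:M -> X *m S *m X' = S ->
  X *m S = S *m X.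
Proof. by move=> X'X H; rewrite -[in RHS]H -mulmxA X'X mulmx1. Qed.

(* E is the projection onto ker (S^q - 1) along the image of S^q - 1, and S^-1
   gives the same kernel and image as S. *)
Lemma reversing_projection q (S E T X X' : 'M[R]_n) :
  S \in unitmx -> X *m X' = 1%:M ->
  (S ^+ q - 1%:M) *m E = 0 -> 1%:M - E = T *m (S ^+ q - 1%:M) ->
  E *m S = S *m E ->
  (forall Y, Y *m S = S *m Y -> Y *m E = E *m Y) ->
  X *m S *m X' = invmx S -> S *m X *m S = X /\ X *m E = E *m X.
Proof.
move=> Su XX' SqE ET ES comm XSX; have X'X := mulmx1C XX'.
have XS : X *m S = invmx S *m X by rewrite -XSX -[RHS]mulmxA X'X mulmx1.
split; first by rewrite -mulmxA XS mulKVmx.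
(* Conjugation turns S^q - 1 into S^-q - 1, which is S^q - 1 times an invertible factor. Hence E E'
   = E' and E' E = E; as E' commutes with S it commutes with E, and the two coincide. *)
pose E' := X *m E *m X'.
have XSi i : X *m S ^+ i = invmx S ^+ i *m X.
  elim: i => [|i IH]; first by rewrite !expr0 mulmx1 mul1mx.
  by rewrite !exprSr -!mulmxE mulmxA IH -mulmxA XS mulmxA.
have Vi : S ^+ q *m invmx S ^+ q = 1%:M.
  by apply: mulmx1C; exact: invmx_exprK.
have XM : X *m (S ^+ q - 1%:M) = - (invmx S ^+ q *m (S ^+ q - 1%:M) *m X).
  rewrite mulmxBr mulmx1 XSi mulmxBr mulmx1 (mulmx1C Vi) mulmxBl mul1mx opprB.
  by [].
have ME' : (S ^+ q - 1%:M) *m E' = 0.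
  have H : X *m (S ^+ q - 1%:M) *m E *m X' = 0 by rewrite -mulmxA -mulmxA (mulmxA _ E) SqE mul0mx mulmx0.
  move: H; rewrite XM !mulNmx => /eqP; rewrite oppr_eq0 => /eqP H.
  have H2 : invmx S ^+ q *m ((S ^+ q - 1%:M) *m E') = 0 by rewrite /E' !mulmxA.
  by have := congr1 (mulmx (S ^+ q)) H2; rewrite mulmx0 (mulmxA (S ^+ q)) Vi mul1mx.
have EE' : E *m E' = E'.
  have : (1%:M - E) *m E' = 0 by rewrite ET -mulmxA ME' mulmx0.
  by rewrite mulmxBl mul1mx => /subr0_eq.
have E'E : E' *m E = E.
  have : (1%:M - E') *m E = 0.
    have -> : 1%:M - E' = X *m T *m (S ^+ q - 1%:M) *m X'.
      by rewrite -(mulmxA X) -ET mulmxBr mulmxBl mulmx1 XX'.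
    have MX' : (S ^+ q - 1%:M) *m X' = - (X' *m (invmx S ^+ q *m (S ^+ q - 1%:M))).
      have := congr1 (fun Z => X' *m (Z *m X')) XM.
      rewrite /= -(mulmxA X) (mulmxA X') X'X mul1mx => ->.
      by rewrite mulNmx mulmxN -!mulmxA XX' mulmx1.
    by rewrite -!mulmxA (mulmxA _ X') MX' mulNmx -!mulmxA SqE !mulmx0 oppr0 !mulmx0.
  by rewrite mulmxBl mul1mx => /subr0_eq.
have E'S : E' *m S = S *m E'.
  have X'Si : X' *m invmx S = S *m X' by rewrite -XSX !mulmxA X'X mul1mx.
  have X'S : X' *m S = invmx S *m X'.
    by apply: (canRL (mulKmx Su)); rewrite mulmxA -X'Si mulmxKV.
  have EiS : E *m invmx S = invmx S *m E by exact: inv_commute.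
  rewrite /E' -mulmxA X'S !mulmxA -(mulmxA X) EiS mulmxA.
  have -> : X *m invmx S = S *m X.
    by apply: (canLR (mulmxK Su)); rewrite -mulmxA XS mulKVmx.
  by [].
have E'E1 := comm _ E'S.
have EE1 : E = E' by rewrite -{1}E'E E'E1 EE'.
by rewrite {2}EE1 /E' -mulmxA X'X mulmx1.
Qed.

Lemma conj_deriv m (X X' A : 'M[R]_n) (f : 'cV[R]_n * 'cV[R]_m -> 'cV[R]_n) v :
  smooth0mx f -> (forall v, deriv0mx f (v, 0) (A *m v)) ->
  deriv0mx (fun p => X *m f (X' *m p.1, p.2)) (v, 0) (X *m A *m X' *m v).
Proof.
move=> fs fD; rewrite -!mulmxA; apply: deriv0mx_mul.
apply: (@deriv0mx_comp _ _ _ _ _ _ _ _ _ _ (X' *m v) 0) => //.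
- exact: mulmx0.
- by apply: deriv0mx_mul; exact: (@deriv0mx_fst _ _ _ (v, 0)).
- exact: (@deriv0mx_snd _ _ _ (v, 0)).
Qed.

End Symmetry.


Theorem theorem3p1 (R : realType) (n m q : nat) (G : topologicalGroupType)
    (rho : G -> 'M[R]_n) (chi : G -> R)
    (psi psiV : 'cV[R]_n * 'cV[R]_m -> 'cV[R]_n) (A0 S0 N0 : 'M[R]_n)
    (G_compact : compact [set: G])
    (rho_action : continuous_linear_action rho)
    (chi_character : continuous_character chi)
    (psi_diffeo : local_diffeo_family setT psi psiV)
    (psi_equivariant : \forall p \near ((0, 0) : 'cV[R]_n * 'cV[R]_m), forall g,
       rho g *m psi (rho g^-1%g *m p.1, p.2) = diffeo_pow psi psiV (chi g) p)
    (psi_fix0 : \forall l \near (0 : 'cV[R]_m), psi (0, l) = 0)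
    (A0_derivative : forall v : 'cV[R]_n,
       'D_v (fun x : 'cV[R]_n => psi (x, 0)) 0 = A0 *m v)
    (A0_unit : A0 \in unitmx)
    (q_gt0 : (0 < q)%N)
    (A0_jordan_chevalley : jordan_chevalley A0 S0 N0) :
  let U := ker_space (S0 ^+ q - 1%:M) in
  exists psir psirV xs : 'cV[R]_n * 'cV[R]_m -> 'cV[R]_n,
  let B := bifurcation_map S0 psir psirV in
  local_diffeo_family U psir psirV /\ smooth_near0 (U `*` setT) xs /\
  (* (i) *)
  (\forall l \near (0 : 'cV[R]_m), psir (0, l) = 0) /\
  (forall u, U u -> 'D_u (fun y : 'cV[R]_n => psir (y, 0)) 0 = A0 *m u) /\
  (\forall l \near (0 : 'cV[R]_m), xs (0, l) = 0) /\
  (forall u, U u -> 'D_u (fun y : 'cV[R]_n => xs (y, 0)) 0 = u) /\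
  (* (ii) *)
  (\forall p \near ((0, 0) : 'cV[R]_n * 'cV[R]_m), U p.1 ->
     psir (S0 *m p.1, p.2) = S0 *m psir p) /\
  (* (iii) *)
  (\forall p \near ((0, 0) : 'cV[R]_n * 'cV[R]_m), U p.1 -> forall g,
     rho g *m psir (rho g^-1%g *m p.1, p.2) =
       diffeo_pow psir psirV (chi g) p) /\
  (* (iv): u has to be small too, since psir and xs are only local; W ranges
     over the sufficiently small neighbourhoods of the origin. *)
  (exists2 W0 : set ('cV[R]_n * 'cV[R]_m),
       nbhs ((0, 0) : 'cV[R]_n * 'cV[R]_m) W0 &
     forall W : set ('cV[R]_n * 'cV[R]_m),
     nbhs ((0, 0) : 'cV[R]_n * 'cV[R]_m) W -> W `<=` W0 ->
     \forall p \near ((0, 0) : 'cV[R]_n * 'cV[R]_m),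
       q_periodic q psi p <->
       exists u, [/\ U u, W (u, p.2), q_periodic q psir (u, p.2) &
                     p.1 = xs (u, p.2)]) /\
  (* (v) *)
  (\forall p \near ((0, 0) : 'cV[R]_n * 'cV[R]_m), U p.1 ->
     (q_periodic q psir p <-> psir p = S0 *m p.1)) /\
  (* B takes values in U *)
  (\forall p \near ((0, 0) : 'cV[R]_n * 'cV[R]_m), U p.1 -> U (B p)) /\
  (* (vi) *)
  (\forall p \near ((0, 0) : 'cV[R]_n * 'cV[R]_m), U p.1 ->
     (psir p = S0 *m p.1 <-> B p = 0)) /\
  (* (vii) *)
  (\forall p \near ((0, 0) : 'cV[R]_n * 'cV[R]_m), U p.1 ->
     B (S0 *m p.1, p.2) = S0 *m B p) /\
  (\forall p \near ((0, 0) : 'cV[R]_n * 'cV[R]_m), U p.1 -> forall g,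
     B (rho g *m p.1, p.2) = chi g *: (rho g *m B p)).
Proof.
move=> U.
have [psi_sm _ _ _ psiK psiVK] := psi_diffeo.
have psi_s : smooth0mx psi.
  by apply/smooth_near0P; move: psi_sm; rewrite setXTT.
have A_sum := jc_sum A0_jordan_chevalley.
have [k0 Nk] := jc_nilpotent A0_jordan_chevalley.
have SN := jc_comm A0_jordan_chevalley.
have Su := jordan_chevalley_unit A0_jordan_chevalley A0_unit.
have [E [T [SqE ET Ecomm]]] := spectral_projection q_gt0 (jc_semisimple A0_jordan_chevalley).
have ES : E *m S0 = S0 *m E by exact/esym/Ecomm.
have EN : E *m N0 = N0 *m E by apply/esym/Ecomm; exact: esym.
have UE u : U u <-> E *m u = u by split=> /(projE_id SqE ET).
pose KP := coords_prod (coords_mx R n 1) (coords_mx R m 1).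
have psiA v : deriv0mx psi (v, 0) (A0 *m v).
  by rewrite -A0_derivative (deriv0mx_slice psi v 0).2; exact: (smooth0mx_derive KP).
have psiD v : deriv0mx psi (v, 0) ((S0 + N0) *m v) by rewrite -A_sum.
have psi00 : psi 0 = 0 by exact: (nbhs_singleton psi_fix0).
have [ys [r [r0 yss ysD ys0 [ysE ysU]]]] :=
  @orbit_reduction R n q q_gt0 S0 N0 E T k0 Su Nk SN ES EN SqE ET m psi psi_s psi_fix0 psiD.
pose psir := reduced_map S0 N0 E psi ys.
have psir_s : smooth0mx psir by exact: (reduced_map_smooth S0 N0 E psi_s r0 yss ys0).
have psir_D v : deriv0mx psir (v, 0) ((S0 + N0) *m v).
  exact: (reduced_map_deriv q_gt0 Su SN ES EN SqE ET psi_s psiD r0 ysD ys0).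
have psir_A v : deriv0mx psir (v, 0) (A0 *m v) by rewrite A_sum.
have psir_0 : \forall l \near (0 : 'cV[R]_m), psir (0, l) = 0.
  exact: (reduced_map0 S0 N0 E psi_fix0 r0 ys0).
have psir_00 : psir 0 = 0 by exact: (nbhs_singleton psir_0).
have psir_E p : E *m p.1 = p.1 -> E *m psir p = psir p.
  exact: (reduced_map_range Su ES EN SqE ET).
have psir_comm : \forall p \near (0 : 'cV[R]_n * 'cV[R]_m), E *m p.1 = p.1 ->
    psir (S0 *m p.1, p.2) = S0 *m psir p.
  exact: (reduced_map_comm q_gt0 Su ES EN SqE ET r0 yss ys0 ysE ysU).
have [psirV [psirV_s psirV_0 psirVK psirK]] := local_inverse A0_unit psir_s psir_00 psir_A.
pose i0 := Ordinal q_gt0.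
pose xs := ys i0.
have i0s : smooth0mx xs by exact: yss.
have xs_0 : xs 0 = 0 by apply: ys0; rewrite normr0.
have rhoV g : rho g *m rho g^-1%g = 1%:M.
  by rewrite -(actionM rho_action) mulgV (action1 rho_action).
have rhoVl g : rho g^-1%g *m rho g = 1%:M by exact: mulmx1C (rhoV g).
have [C HC] := action_bound G_compact rho_action.
have HC' g (u : 'cV[R]_n) : `|rho g^-1%g *m u| <= C * `|u| by exact: HC.
have chiP := character_normr G_compact chi_character.
have N11 : (-1 == 1 :> R) = false by apply: lt_eqF; lra.
have fst_s := @smooth0mx_fst R n ('cV[R]_m : normedModType R).
(* The hypothesis evaluated at g x, which is small uniformly in g. *)
have eq1 : \forall p \near (0 : 'cV[R]_n * 'cV[R]_m), forall g,
    rho g *m psi p = diffeo_pow psi psiV (chi g) (rho g *m p.1, p.2).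
  have H := @near_act R n m G rho C (fun p => forall g,
     rho g *m psi (rho g^-1%g *m p.1, p.2) = diffeo_pow psi psiV (chi g) p)
     (fun p => p.1) HC fst_s erefl psi_equivariant.
  apply: filterS H => p H g; rewrite -(H g g) /= mulmxA rhoVl mul1mx.
  by rewrite -surjective_pairing.
have HA1 : \forall p \near (0 : 'cV[R]_n * 'cV[R]_m), forall g, chi g = 1 ->
    psi (rho g *m p.1, p.2) = rho g *m psi p.
  by apply: filterS eq1 => p H g c1; rewrite H /diffeo_pow c1 eqxx.
(* Reversibility written with [psi] alone, so that it can be differentiated and transferred to the
   reduced map before its inverse enters. *)
have HA2 : \forall p \near (0 : 'cV[R]_n * 'cV[R]_m), forall g, chi g = -1 ->
    psi (rho g *m psi p, p.2) = rho g *m p.1.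
  have H := @near_act R n m G rho C (fun p => setT p.1 -> psi (psiV p, p.2) = p.1)
     (fun p => p.1) HC fst_s erefl psiVK.
  apply: filterS2 eq1 H => p H1 H2 g c1.
  by rewrite H1 /diffeo_pow c1 N11; exact: (H2 g I).
have A1 g : chi g = 1 -> rho g *m A0 *m rho g^-1%g = A0.
  move=> c1; apply: mulmx_col_inj => v.
  apply: (deriv0mx_unique _ (psiA v)).
  apply: deriv0mx_ext (conj_deriv (rho g) (rho g^-1%g) v psi_s psiA).
  by apply: filterS psi_equivariant => p /(_ g) ->; rewrite /diffeo_pow c1 eqxx.
have A2 g : chi g = -1 -> rho g *m A0 *m rho g^-1%g = invmx A0.
  (* Differentiating psi (g psi (x)) = g x at the origin gives A_0 g A_0 = g. *)
  move=> c1; suff H : A0 *m (rho g *m A0) = rho g.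
    by rewrite -[rho g *m A0](mulKmx A0_unit) H -mulmxA rhoV mulmx1.
  apply: mulmx_col_inj => v.
  apply: (@deriv0mx_unique _ _ _ _ (fun p : 'cV[R]_n * 'cV[R]_m => rho g *m p.1) (v, 0)).
    apply: (@deriv0mx_ext _ _ _ _ (fun p => psi (rho g *m psi p, p.2))).
      by apply: filterS HA2 => p; apply.
    apply: (@deriv0mx_comp _ _ _ _ _ _ _ _ _ _ (rho g *m (A0 *m v)) 0) => //.
    - by rewrite psi00 mulmx0.
    - by rewrite -!mulmxA; exact: psiA.
    - by apply: deriv0mx_mul; exact: psiA.
    - exact: (@deriv0mx_snd _ _ _ (v, 0)).
  by apply: deriv0mx_mul; exact: (@deriv0mx_fst _ _ _ (v, 0)).
have X1 g : chi g = 1 -> rho g *m S0 = S0 *m rho g /\ rho g *m E = E *m rho g.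
  move=> c1; have jc := jordan_chevalley_conj (rhoV g) A0_jordan_chevalley.
  rewrite (A1 g c1) in jc.
  have rS := commute_of_conj (rhoVl g) (jordan_chevalley_unique jc A0_jordan_chevalley).
  by split=> //; exact: Ecomm.
have X2 g : chi g = -1 -> S0 *m rho g *m S0 = rho g /\ rho g *m E = E *m rho g.
  move=> c1; have jc := jordan_chevalley_conj (rhoV g) A0_jordan_chevalley.
  rewrite (A2 g c1) in jc.
  have jcV := jordan_chevalley_inv A0_unit A0_jordan_chevalley.
  exact: (reversing_projection Su (rhoV g) SqE ET ES Ecomm (jordan_chevalley_unique jc jcV)).
have EX g (y : 'cV[R]_n) : E *m y = y -> E *m (rho g *m y) = rho g *m y.
  move=> Ey; have rE : rho g *m E = E *m rho g.
    by have [/X1[]|/X2[]] := chiP g.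
  by rewrite mulmxA -rE -mulmxA Ey.
have ESy (y : 'cV[R]_n) : E *m y = y -> E *m (S0 *m y) = S0 *m y.
  by move=> Ey; rewrite mulmxA ES -mulmxA Ey.
have EVS : E *m invmx S0 = invmx S0 *m E by exact: inv_commute.
have EVy (y : 'cV[R]_n) : E *m y = y -> E *m (invmx S0 *m y) = invmx S0 *m y.
  by move=> Ey; rewrite mulmxA EVS -mulmxA Ey.
have RE1 := reduced_map_equivariant q_gt0 Su ES EN SqE ET r0 yss ys0 ysE ysU HC X1 HA1.
rewrite -/psir in RE1.
have RE2 := reduced_map_reversible q_gt0 Su ES EN SqE ET psi_s psi_fix0 r0 yss ys0 ysE ysU HC X2 HA2.
rewrite -/psir in RE2.
(* A_0 maps the complementary component of [psirV p] to that of [p], which is zero; A_0 is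
   invertible. *)
have psirV_E : \forall p \near (0 : 'cV[R]_n * 'cV[R]_m), E *m p.1 = p.1 ->
    E *m psirV p = psirV p.
  apply: filterS psirVK => p pV Ep.
  have := reduced_map_compl Su ES EN SqE ET psi ys (psirV p, p.2).
  rewrite -/psir pV /= mulmxBl mul1mx Ep subrr -A_sum => /esym /(congr1 (mulmx (invmx A0))).
  by rewrite mulmx0 mulKmx // mulmxBl mul1mx => /subr0_eq.
have Q1 := near_act HC psir_s psir_00 psirK.
have Sfst_s : smooth0mx (fun p : 'cV[R]_n * 'cV[R]_m => S0 *m p.1) by exact: smooth0mx_mul.
have Vfst_s : smooth0mx (fun p : 'cV[R]_n * 'cV[R]_m => invmx S0 *m p.1).
  exact: smooth0mx_mul.
have periodicP : \forall p \near (0 : 'cV[R]_n * 'cV[R]_m),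
    iter q (fun y => psir (y, p.2)) p.1 = p.1 -> psir p = S0 *m p.1.
  apply: (periodic_rot q_gt0 Su Nk SN ES EN SqE ET psir_s psir_0 psir_comm _ psir_D).
  by apply/nbhs0_dist; exists 1 => // p _; exact: psir_E.
have rotP := iter_rot ES SqE psir_comm.
(* This is [periodic_rot] with S = 1 and q = 2: a point of period 2 under a map
   with unipotent derivative is fixed. *)
have involP : \forall p \near (0 : 'cV[R]_n * 'cV[R]_m),
    invmx S0 *m psir (invmx S0 *m psir p, p.2) = p.1 -> invmx S0 *m psir p = p.1.
  pose f2 p := invmx S0 *m psir p.
  have f2s : smooth0mx f2 by exact: smooth0mx_mul.
  have f20 : \forall l \near (0 : 'cV[R]_m), f2 (0, l) = 0.
    by apply: filterS psir_0 => l H; rewrite /f2 H mulmx0.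
  have f2D v : deriv0mx f2 (v, 0) ((1%:M + invmx S0 *m N0) *m v).
    have -> : (1%:M + invmx S0 *m N0) *m v = invmx S0 *m ((S0 + N0) *m v).
      by rewrite [RHS]mulmxA mulmxDr mulVmx.
    exact: deriv0mx_mul.
  have NV : GRing.comm (invmx S0) N0.
    by rewrite /GRing.comm -!mulmxE; apply/esym; apply: inv_commute.
  have N2k : (invmx S0 *m N0) ^+ k0 = 0 by rewrite mulmxE exprMn_comm // Nk mulr0.
  have := @periodic_rot R n m 2 isT 1%:M (invmx S0 *m N0) 1%:M 0 k0 (unitmx1 _ _) N2k.
  rewrite !mul1mx !mulmx1 !mul0mx subrr expr1n subrr => H.
  have := H erefl erefl erefl erefl erefl f2 f2s f20.
  have t1 : \forall p \near (0 : 'cV[R]_n * 'cV[R]_m), 1%:M *m p.1 = p.1 ->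
     f2 (1%:M *m p.1, p.2) = 1%:M *m f2 p.
    by apply/nbhs0_dist; exists 1 => // p _ _; rewrite !mul1mx -surjective_pairing.
  have t2 : \forall p \near (0 : 'cV[R]_n * 'cV[R]_m), 1%:M *m p.1 = p.1 ->
     1%:M *m f2 p = f2 p.
    by apply/nbhs0_dist; exists 1 => // p _ _; rewrite !mul1mx.
  move=> /(_ t1 t2 f2D); apply: filterS => p Hp per.
  by have := Hp; rewrite mul1mx; apply; rewrite /= -surjective_pairing.
exists psir, psirV, xs => B.
split.
  split.
  - by apply: smooth_near0_sub; apply/smooth_near0P.
  - by apply: smooth_near0_sub; apply/smooth_near0P.
  - by apply/nbhs0_dist; exists 1 => // p _ /UE /psir_E /UE.
  - by apply: filterS psirV_E => p H /UE /H /UE.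
  - by apply: filterS psirK => p H _.
  - by apply: filterS psirVK => p H _.
split; first by apply: smooth_near0_sub; apply/smooth_near0P.
split; first exact: psir_0.
split; first by move=> u _; exact: (deriv0mx_slice psir u _).1 (psir_A u).
split; first by apply/nbhs0_dist; exists r => // l lr; exact: ys0.
split.
  move=> u /UE Eu; apply: (deriv0mx_slice xs u _).1.
  by have := ysD i0 u; rewrite expr0 mul1mx Eu.
split; first by apply: filterS psir_comm => p H /UE; exact: H.
split.
  (* Equivariance at g^-1 x. For chi g = -1, psir (g psir (g^-1 x)) = x, and applying [psirV] gives
     the claim. *)
  have H1 := near_act HC' fst_s erefl RE1.
  have H2 := near_act HC' fst_s erefl RE2.
  have H3 := near_act HC' fst_s erefl Q1.
  apply: filterS3 H1 H2 H3 => p /= h1 h2 h3 /UE Ep g.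
  have Eg := EX g^-1%g _ Ep.
  have rV (y : 'cV[R]_n) : rho g *m (rho g^-1%g *m y) = y by rewrite mulmxA rhoV mul1mx.
  have [c1|c1] := chiP g; rewrite /diffeo_pow c1 ?eqxx ?N11.
    by rewrite -(h1 g g c1 Eg) rV -surjective_pairing.
  by have := h3 g g; rewrite (h2 g g c1 Eg) rV -surjective_pairing.
split.
  have [cs c0] := orbit_center_smooth q S0 E psi_s psi_fix0.
  have per := periodic_reduced q_gt0 Su ES EN SqE ET psi_s psi_fix0 r0 ysU.
  have n0 : \forall p \near (0 : 'cV[R]_n * 'cV[R]_m), `|p| < r.
    by apply/nbhs0_dist; exists r.
  (* On this set periodicity of u under [psir] already forces psir u = S_0 u, so the orbit built
     from u closes up. Conversely, a periodic point of [psi] has its center in any prescribed W once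
     it is close enough to the origin. *)
  exists [set p | `|p| < r /\
    (iter q (fun y => psir (y, p.2)) p.1 = p.1 -> psir p = S0 *m p.1)].
    exact: filterI n0 periodicP.
  move=> W HW WW0.
  have w1 := near_app cs c0 HW.
  have w2 := near_app cs c0 rotP.
  apply: filterS3 per w1 w2 => p h1 h2 h3; split.
    move=> /h1[Ec rc pc]; exists (orbit_center q S0 E psi p); split=> //.
    - exact/UE.
    - exact: h3.
  move=> [u [/UE Eu Wu pu xu]]; have [ulr H] := WW0 _ Wu.
  rewrite /q_periodic xu.
  apply: (reduced_periodic q_gt0 Su ES EN SqE ysE _ _ Eu (H pu)).
    exact: le_lt_trans (fst_norm_le (u, p.2)) ulr.
  exact: le_lt_trans (snd_norm_le (u, p.2)) ulr.
split.
  by apply: filterS2 periodicP rotP => p h1 h2 /UE Ep; split; [exact: h1|exact: h2].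
split.
  apply: filterS psirV_E => p h /UE Ep; apply/UE.
  by rewrite /B /bifurcation_map mulmxBr EVy ?psir_E // ESy // h.
have psirV0y (M : 'M[R]_n) : M *m psirV 0 = 0 by rewrite psirV_0 mulmx0.
have V1 := near_app psirV_s psirV_0 psir_comm.
split.
  have v1 := near_app Vfst_s (mulmx0 _ _) psir_comm.
  have v2 := near_app Vfst_s (mulmx0 _ _) psirK.
  apply: filterS3 (filterI v1 v2) (filterI V1 involP) (filterI psirVK psirV_E).
  move=> p /= [h1 h2] [h3 h4] [h5 h6] /UE Ep; rewrite /B /bifurcation_map; split.
    (* Commutation at S_0^-1 u gives psir (S_0^-1 u) = u, that is psirV u = S_0^-1 u, and both terms
       of B equal u. *)
    move=> pS; have := h1 (EVy _ Ep); rewrite mulKVmx // -surjective_pairing pS.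
    move=> /(congr1 (mulmx (invmx S0))); rewrite !mulKmx // => e.
    by move: h2; rewrite -e -surjective_pairing => ->; rewrite mulKVmx // subrr.
  (* Here S_0^-1 psir u = S_0 psirV u, and applying S_0^-1 psir to the right-hand side returns u: a
     point of period 2. *)
  move=> /subr0_eq e.
  have := h4; rewrite e h3; last exact: h6.
  rewrite h5 mulKmx // => /(_ erefl) <-.
  by rewrite -e mulKVmx.
split.
  (* [psirV] inherits commutation with S_0 by applying it to psir (S_0 psirV u) = S_0 u. *)
  have v1 := near_app (smooth0mx_mul S0 psirV_s) (psirV0y S0) psirK.
  apply: filterS3 (filterI V1 v1) (filterI psirVK psirV_E) psir_comm.
  move=> p /= [h1 h2] [h3 h4] h5 /UE Ep; rewrite /B /bifurcation_map.
  move: h2; rewrite h1; last exact: h4.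
  by rewrite h3 h5 // => ->; rewrite mulKmx // mulmxBr mulKVmx // mulmxA.
have v1 := near_app psirV_s psirV_0 RE1.
have v2 := near_app psirV_s psirV_0 RE2.
have v3 := near_act HC psirV_s psirV_0 psirK.
apply: filterS3 (filterI v1 (filterI v2 v3)) (filterI psirVK psirV_E)
  (filterI RE1 (filterI RE2 Q1)).
move=> p /= [h1 [h2 h3]] [h4 h5] [h6 [h7 h8]] /UE Ep g; rewrite /B /bifurcation_map.
have Ey := h5 Ep.
have [c1|c1] := chiP g; rewrite c1.
  have [XS _] := X1 g c1.
  have XV : rho g *m invmx S0 = invmx S0 *m rho g by exact: inv_commute.
  rewrite scale1r h6 //; have := h3 g; rewrite (h1 g c1 Ey) h4 => ->.
  by rewrite mulmxBr !mulmxA XS XV.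
have [XS _] := X2 g c1.
have XSV : rho g *m S0 = invmx S0 *m rho g by rewrite -{2}XS -mulmxA mulKmx.
have SXV : S0 *m rho g = rho g *m invmx S0 by rewrite -{2}XS mulmxK.
(* Reversibility gives psirV (g u) = g psir u and psir (g u) = g psirV u, so g exchanges the two
   terms of B, whence the sign. *)
have := h8 g; rewrite (h7 g c1 Ep) => ->.
have := h2 g c1 Ey; rewrite h4 => ->.
by rewrite scaleN1r mulmxBr opprB !mulmxA XSV SXV.
Qed.
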